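(* Let $f=0$ and $G=0$, and assume the conditions on initial data, stabilizability and detectability stated in the context. Then the set of decentralized control laws $\{\hat u_1,\dots,\hat u_N\}$ given by $$\hat u_i=-R^{-1}B^T[Px_i+(\Pi-P)\bar x+s],\quad i=1,\dots,N,$$ is a representation of the set of control laws $\{\breve u_1,\dots,\breve u_N\}$ given by $$\breve u_i=-R^{-1}B^T(Px_i+\bar s),\quad\bar s=\bar K\bar x^\dagger+\phi,\quad i=1,\dots,N,$$ where $P,\Pi,s,\bar x,\bar K,\bar x^\dagger,\phi$ are as defined in the context, and in each case $x_i$ denotes the state of agent $i$ under the respective set of control laws.
   Context: Definition: for a control problem with admissible control set $\mathcal U$, a control law $u\in\mathcal U$ is a representation of another control $u^*\in\mathcal U$ if (i) they both generate the same unique state trajectory, and (ii) they both have the same open-loop value on this trajectory. Setting: the problem is to find decentralized control laws optimizing the social cost $\sum_{i=1}^NJ_i(u)$, where $J_i(u)=\mathbb E\int_0^\infty e^{-\rho t}\{\|x_i-\Gamma x^{(N)}-\eta\|_Q^2+\|u_i\|_R^2\}dt$, $x^{(N)}=\frac1N\sum_{j=1}^Nx_j$, $\|z\|_M^2=z^TMz$. Here $\rho>0$ is a discount constant; $A,\Gamma,Q\in\mathbb R^{n\times n}$, $B\in\mathbb R^{n\times r}$, $R\in\mathbb R^{r\times r}$, $\eta\in\mathbb R^n$ are constant, $Q,R$ symmetric, $R>0$. $C_{\rho/2}([0,\infty),\mathbb R^n)$ is the set of continuous $g:[0,\infty)\to\mathbb R^n$ with $\int_0^\infty e^{-\rho t}\|g\|^2dt<\infty$;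 $f,\sigma\in C_{\rho/2}([0,\infty),\mathbb R^n)$; $W_1,\dots,W_N$ are independent one-dimensional Brownian motions. In general agent $i$ evolves by $dx_i=[Ax_i+Bu_i+Gx^{(N)}+f]dt+\sigma dW_i$, so with $f=0$, $G=0$: $dx_i=[Ax_i+Bu_i]dt+\sigma dW_i$, $x_i(0)=x_{i0}$, where the $x_{i0}$ are mutually independent with common mean $\bar x_0$ and $\max_i\mathbb E\|x_{i0}\|^2<C_0$ ($C_0$ independent of $N$), independent of $\{W_i\}$. Assume $(A-\frac\rho2I,B)$ stabilizable, $Q\ge0$, $(A-\frac\rho2I,\sqrt Q)$ and $(A-\frac\rho2I,\sqrt Q(I-\Gamma))$ detectable. $P\ge0$ solves $\rho P=A^TP+PA-PBR^{-1}B^TP+Q$; $\Pi\ge0$ solves $\rho\Pi=A^T\Pi+\Pi A-\Pi BR^{-1}B^T\Pi+(I-\Gamma)^TQ(I-\Gamma)$; $s,\bar x\in C_{\rho/2}([0,\infty),\mathbb R^n)$ are determined by $\rho s=\dot s+[A-BR^{-1}B^T\Pi]^Ts-\bar\eta$ and $\dot{\bar x}=A\bar x-BR^{-1}B^T(\Pi\bar x+s)$, $\bar x(0)=\bar x_0$, where $\bar\eta=Q\eta-\Gamma^TQ\eta$. With $\bar A=A-BR^{-1}B^TP$ and $Q_\Gamma=\Gamma^TQ+Q\Gamma-\Gamma^TQ\Gamma$, $\bar K$ satisfies $\rho\bar K=\bar K\bar A+\bar A^T\bar K-\bar KBR^{-1}B^T\bar K^T-Q_\Gamma$, and $\bar x^\dagger,\phi\in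 C_{\rho/2}([0,\infty),\mathbb R^n)$ are determined by $$\frac{d\bar x^\dagger}{dt}=\bar A\bar x^\dagger-BR^{-1}B^T(\bar K\bar x^\dagger+\phi),\ \bar x^\dagger(0)=\bar x_0,\qquad\frac{d\phi}{dt}=-\big[(A-BR^{-1}B^T(P+\bar K))^T-\rho I\big]\phi+\bar\eta.$$ *)

(* Defs.v *)
From HB Require Import structures.
From mathcomp Require Import all_boot all_order all_algebra.
From mathcomp Require Import complex.
From mathcomp Require Import all_classical all_reals all_analysis.

Set Implicit Arguments.
Unset Strict Implicit.
Unset Printing Implicit Defensive.

Import Order.TTheory GRing.Theory Num.Theory.
Import numFieldNormedType.Exports.

Local Open Scope classical_set_scope.
Local Open Scope ring_scope.

Section LinearAlgebra.
Context {R : realType}.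

Definition qform n (M : 'M[R]_n) (z : 'cV[R]_n) : R := (z^T *m M *m z) 0 0.

(* Squared Euclidean norm; the library norm on matrices is the sup norm. *)
Definition sqnorm n (z : 'cV[R]_n) : R := (z^T *m z) 0 0.

Definition psd n (M : 'M[R]_n) : Prop :=
  M^T = M /\ forall z, 0 <= qform M z.

Definition pd n (M : 'M[R]_n) : Prop :=
  M^T = M /\ forall z, z != 0 -> 0 < qform M z.

Definition is_psd_sqrt n (Q S : 'M[R]_n) : Prop := psd S /\ S *m S = Q.

Definition hurwitz n (M : 'M[R]_n) : Prop :=
  forall z : complex R,
    eigenvalue (map_mx (real_complex R) M) z -> complex.Re z < 0.

Definition stabilizable n r (A : 'M[R]_n) (B : 'M[R]_(n, r)) : Prop :=
  exists F : 'M[R]_(r, n), hurwitz (A + B *m F).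

Definition detectable n m (A : 'M[R]_n) (C : 'M[R]_(m, n)) : Prop :=
  exists L : 'M[R]_(n, m), hurwitz (A + L *m C).

End LinearAlgebra.

Section DiscountedFunctions.
Context {R : realType}.

(* Time-dependent objects are total functions on [R]; only their restriction
   to [0, +oo) is ever constrained or used. *)
Definition discounted_energy (rho : R) n (g : R -> 'cV[R]_n) : \bar R :=
  (\int[lebesgue_measure]_(t in `[0%R, +oo[)
     (expR (- (rho * t)) * sqnorm (g t))%:E)%E.

Definition Crho2 (rho : R) n (g : R -> 'cV[R]_n) : Prop :=
  {within `[0%R, +oo[, continuous g} /\ (discounted_energy rho g < +oo)%E.

(* [g' = v] on [0, +oo): for [g] and [v] continuous on [0, +oo), the right
   derivative at 0 follows from the equation on (0, +oo). *)
Definition solves_ode n (g v : R -> 'cV[R]_n) : Prop :=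
  {within `[0%R, +oo[, continuous g} /\
  forall t : R, 0 < t -> is_derive t (1 : R) g (v t).

End DiscountedFunctions.

Section Stochastic.
Context {R : realType} {d : measure_display} {T : measurableType d}.
Variable Pr : probability T R.

(* sigma (X_j : j in D) *)
Definition gen_sigma (J : Type) (D : set J) (X : J -> T -> R) : set (set T) :=
  <<s [set E | exists2 j, D j &
         exists2 Y : set R, measurable Y & E = X j @^-1` Y] >>.

Definition mutually_independent (I : finType) (F : I -> set (set T)) : Prop :=
  forall (J : {set I}) (E : I -> set T),
    (forall i, i \in J -> F i (E i)) ->
    Pr (\bigcap_(i in [set i | i \in J]) E i) =
      (\prod_(i in J) Pr (E i))%E.

Definition independent2 (F G : set (set T)) : Prop :=
  forall E E', F E -> G E' -> Pr (E `&` E') = (Pr E * Pr E')%E.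

Definition brownian_motion (W : R -> T -> R) : Prop :=
  [/\ forall t, 0 <= t -> measurable_fun [set: T] (W t),
      {ae Pr, forall w, W 0 w = 0 /\
                        {within `[0%R, +oo[, continuous (fun t => W t w)}},
      forall s t, 0 <= s -> s < t ->
        forall Y : set R, measurable Y ->
          Pr ((fun w => W t w - W s w) @^-1` Y) =
          normal_prob 0 (Num.sqrt (t - s)) Y &
      forall (k : nat) (t : nat -> R), 0 <= t 0%N ->
        (forall j, t j <= t j.+1) ->
        mutually_independent (fun j : 'I_k =>
          gen_sigma [set: unit] (fun _ w => W (t j.+1) w - W (t j) w))].

(* The integral of a continuous deterministic integrand against a Brownian
   motion: the continuous version of the mean-square limit of the left-point
   Riemann sums. *)
Definition is_wiener_integral n (W : R -> T -> R) (sigma : R -> 'cV[R]_n)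
    (M : R -> T -> 'cV[R]_n) : Prop :=
  [/\ forall t (k : 'I_n), 0 <= t ->
        measurable_fun [set: T] (fun w => M t w k 0),
      {ae Pr, forall w, M 0 w = 0 /\
                        {within `[0%R, +oo[, continuous (fun t => M t w)}} &
      forall t, 0 <= t ->
        (fun m : nat => \int[Pr]_w (sqnorm (M t w -
           \sum_(j < m.+1)
             (W (j.+1%:R * t / m.+1%:R) w - W (j%:R * t / m.+1%:R) w)
               *: sigma (j%:R * t / m.+1%:R)))%:E)%E @ \oo --> 0%E].

(* Unique up to indistinguishability, and existing as soon as W is a Brownian
   motion and sigma is continuous on [0, +oo); outside that case the value is
   a default, as for [lim] or integrals. *)
Definition wiener_integral n (W : R -> T -> R) (sigma : R -> 'cV[R]_n) :
    R -> T -> 'cV[R]_n :=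
  xget (fun _ _ => 0) [set M | is_wiener_integral W sigma M].

Definition indistinguishable (I : Type) n (X Y : I -> R -> T -> 'cV[R]_n) :
    Prop :=
  {ae Pr, forall w, forall i t, 0 <= t -> X i t w = Y i t w}.

End Stochastic.

Section ControlProblem.
Context {R : realType} {d : measure_display} {T : measurableType d}.
Variable Pr : probability T R.
Variables (n r N : nat).

(* The control of agent i at time t is a function of t and of the current
   state of agent i only. *)
Definition control_law := 'I_N -> R -> 'cV[R]_n -> 'cV[R]_r.

Definition mean_field (x : 'I_N -> 'cV[R]_n) : 'cV[R]_n :=
  N%:R^-1 *: \sum_(j < N) x j.

Variables (A : 'M[R]_n) (B : 'M[R]_(n, r)) (G : 'M[R]_n).
Variables (f sigma : R -> 'cV[R]_n).
Variables (W : 'I_N -> R -> T -> R) (x0 : 'I_N -> T -> 'cV[R]_n).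
Variables (rho : R) (Gam Q : 'M[R]_n) (Rw : 'M[R]_r) (eta : 'cV[R]_n).

Definition open_loop (mu : control_law) (X : 'I_N -> R -> T -> 'cV[R]_n) :
    'I_N -> R -> T -> 'cV[R]_r :=
  fun i t w => mu i t (X i t w).

Definition drift (u : 'I_N -> R -> T -> 'cV[R]_r)
    (X : 'I_N -> R -> T -> 'cV[R]_n) (i : 'I_N) (t : R) (w : T) : 'cV[R]_n :=
  A *m X i t w + B *m u i t w + G *m mean_field (fun j => X j t w) + f t.

Definition state_trajectory (mu : control_law)
    (X : 'I_N -> R -> T -> 'cV[R]_n) : Prop :=
  (forall i t (k : 'I_n), 0 <= t ->
     measurable_fun [set: T] (fun w => X i t w k 0)) /\
  {ae Pr, forall w, forall i,
     {within `[0%R, +oo[, continuous (fun t => X i t w)} /\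
     forall t (k : 'I_n), 0 <= t ->
       let b := fun s : R => drift (open_loop mu X) X i s w k 0 in
       lebesgue_measure.-integrable `[0%R, t] (EFin \o b) /\
       X i t w k 0 = x0 i w k 0 +
         Rintegral lebesgue_measure `[0%R, t] b +
         wiener_integral Pr (W i) sigma t w k 0}.

Definition generates_unique (mu : control_law)
    (X : 'I_N -> R -> T -> 'cV[R]_n) : Prop :=
  state_trajectory mu X /\
  forall Y, state_trajectory mu Y -> indistinguishable Pr X Y.

(* Admissible decentralized controls of one agent with state x: u(t) is
   sigma(x(s), 0 <= s <= t)-measurable and E int e^{-rho t}|u|^2 dt < oo. *)
Definition decentralized_control (x : R -> T -> 'cV[R]_n)
    (u : R -> T -> 'cV[R]_r) : Prop :=
  (forall t (k : 'I_r) (Y : set R), 0 <= t -> measurable Y ->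
     gen_sigma [set p : R * 'I_n | 0 <= p.1 <= t]
       (fun p w => x p.1 w p.2 0) ((fun w => u t w k 0) @^-1` Y)) /\
  (\int[Pr]_w discounted_energy rho (fun t => u t w) < +oo)%E.

Definition admissible (mu : control_law) : Prop :=
  exists2 X, state_trajectory mu X &
    forall i, decentralized_control (X i) (open_loop mu X i).

Definition cost (X : 'I_N -> R -> T -> 'cV[R]_n)
    (u : 'I_N -> R -> T -> 'cV[R]_r) (i : 'I_N) : \bar R :=
  (\int[Pr]_w \int[lebesgue_measure]_(t in `[0%R, +oo[)
     (expR (- (rho * t)) *
      (qform Q (X i t w - Gam *m mean_field (fun j => X j t w) - eta) +
       qform Rw (u i t w)))%:E)%E.

Definition social_cost (X : 'I_N -> R -> T -> 'cV[R]_n)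
    (u : 'I_N -> R -> T -> 'cV[R]_r) : \bar R :=
  (\sum_(i < N) cost X u i)%E.

(* The open-loop value of a law on X is the control process it produces along
   X; equality of the resulting social costs is recorded as well. *)
Definition same_open_loop_value (mu mu' : control_law)
    (X : 'I_N -> R -> T -> 'cV[R]_n) : Prop :=
  indistinguishable Pr (open_loop mu X) (open_loop mu' X) /\
  social_cost X (open_loop mu X) = social_cost X (open_loop mu' X).

Definition representation (mu mu' : control_law) : Prop :=
  [/\ admissible mu, admissible mu' &
      exists X, [/\ generates_unique mu X, generates_unique mu' X &
                    same_open_loop_value mu mu' X]].

End ControlProblem.

Section MeanFieldData.
Context {R : realType}.

Definition eta_bar n (Gam Q : 'M[R]_n) (eta : 'cV[R]_n) : 'cV[R]_n :=
  Q *m eta - Gam^T *m Q *m eta.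

Definition Q_Gamma n (Gam Q : 'M[R]_n) : 'M[R]_n :=
  Gam^T *m Q + Q *m Gam - Gam^T *m Q *m Gam.

Definition A_bar n r (A : 'M[R]_n) (B : 'M[R]_(n, r)) (Rw : 'M[R]_r)
    (P : 'M[R]_n) : 'M[R]_n :=
  A - B *m invmx Rw *m B^T *m P.

End MeanFieldData.

(* Main.v *)
Require Import Defs.
From HB Require Import structures.
From mathcomp Require Import all_boot all_order all_algebra.
From mathcomp Require Import complex.
From mathcomp Require Import all_classical all_reals all_analysis.
From mathcomp Require Import measurable_realfun.
From mathcomp Require Import ring lra zify.

Set Implicit Arguments.
Unset Strict Implicit.
Unset Printing Implicit Defensive.

Import Order.TTheory GRing.Theory Num.Theory.
Import numFieldNormedType.Exports.

Local Open Scope classical_set_scope.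
Local Open Scope ring_scope.

(** The two laws are state feedbacks with the same gain, so it suffices to show
    that their affine terms agree on [0, +oo). Both closed loops yield solutions
    (x, l) of the same Hamiltonian system x' = A x - S l,
    l' = rho l - A^T l - Q' x with S = B R^-1 B^T and Q' = (I - Gam)^T Q (I - Gam),
    the costates being Pi x + s and (P + K) x + phi. For K this needs K symmetric:
    K - K^T solves a homogeneous Sylvester equation with the Hurwitz matrix
    A - S P - rho/2. Along the difference of the two solutions
    e^(-rho t) x.l is nonincreasing, vanishes at 0 and is integrable, hence is 0;
    thus S l = 0, then x' = A x with x(0) = 0 and x = 0.

    The common law is admissible because the closed-loop state is Z + M, where M
    is the Wiener integral of sigma and Z solves pathwise Z' = (A - S P)(Z + M) + g:
    the second moment of M t is controlled by that of the Riemann sums, whose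
    increments are orthogonal, and a quadratic Lyapunov function for
    A - S P - rho/2 bounds the discounted energy of Z by those of M and g. *)

(** * Lyapunov and Sylvester equations for Hurwitz matrices *)

(** [Pi] and [P + Kbar] solve the same Riccati equation, since Q - [Q_Gamma] is (I - Gam)^T Q (I -
    Gam). But [P + Kbar] is not known to be positive semidefinite or stabilizing, so uniqueness of
    Riccati solutions cannot identify the two matrices. The comparison is therefore made along the
    trajectories: membership in [Crho2] plays the role of a boundary condition at infinity. Nothing
    is claimed about the costate difference l itself; l.S l = 0 forces R^-1 B^T l = 0, which is the
    difference of the inputs once the states agree.

    On the random side, the processes are measurable at each fixed time and continuous in time, so
    expectations of time integrals are handled through Riemann sums and Fatou's lemma. The state is
    split as Z + M because M has no time derivative while Z has one: deterministic calculus then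
    applies to Z on each path, with constants that do not depend on the path and so survive the
    expectation. *)

Section RealParts.
Context {R : realType}.

Definition mxRe m n (X : 'M[complex R]_(m, n)) : 'M[R]_(m, n) :=
  map_mx (@complex.Re R) X.
Definition mxIm m n (X : 'M[complex R]_(m, n)) : 'M[R]_(m, n) :=
  map_mx (@complex.Im R) X.
Definition mxC m n (X : 'M[R]_(m, n)) : 'M[complex R]_(m, n) :=
  map_mx (real_complex R) X.

Lemma Re_sum (I : finType) (F : I -> complex R) :
  complex.Re (\sum_i F i) = \sum_i complex.Re (F i).
Proof. by apply: (big_morph (@complex.Re R)) => // -[a b] [c d]. Qed.

Lemma Im_sum (I : finType) (F : I -> complex R) :
  complex.Im (\sum_i F i) = \sum_i complex.Im (F i).
Proof. by apply: (big_morph (@complex.Im R)) => // -[a b] [c d]. Qed.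

Lemma mxRe_mul m n p (X : 'M[complex R]_(m, n)) (Y : 'M[complex R]_(n, p)) :
  mxRe (X *m Y) = mxRe X *m mxRe Y - mxIm X *m mxIm Y.
Proof.
apply/matrixP => i j; rewrite !mxE Re_sum -sumrB; apply: eq_bigr => k _.
by rewrite !mxE; case: (X i k) (Y k j) => a b [c d].
Qed.

Lemma mxIm_mul m n p (X : 'M[complex R]_(m, n)) (Y : 'M[complex R]_(n, p)) :
  mxIm (X *m Y) = mxRe X *m mxIm Y + mxIm X *m mxRe Y.
Proof.
apply/matrixP => i j; rewrite !mxE Im_sum -big_split; apply: eq_bigr => k _.
by rewrite !mxE; case: (X i k) (Y k j) => a b [c d].
Qed.

Lemma mxRe_C m n (X : 'M[R]_(m, n)) : mxRe (mxC X) = X.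
Proof. by apply/matrixP => i j; rewrite !mxE. Qed.

Lemma mxIm_C m n (X : 'M[R]_(m, n)) : mxIm (mxC X) = 0.
Proof. by apply/matrixP => i j; rewrite !mxE. Qed.

Lemma mx_ReIm_inj m n (X Y : 'M[complex R]_(m, n)) :
  mxRe X = mxRe Y -> mxIm X = mxIm Y -> X = Y.
Proof.
move=> /matrixP hr /matrixP hi; apply/matrixP => i j.
have := hr i j; have := hi i j; rewrite !mxE.
by case: (X i j) (Y i j) => a b [c d] /= -> ->.
Qed.

Lemma eigenvalue_tr (n : nat) (F : fieldType) (M : 'M[F]_n) z :
  eigenvalue M^T z = eigenvalue M z.
Proof.
rewrite !eigenvalue_root_char; congr (root _ z).
by rewrite /char_poly -(det_tr (char_poly_mx M)) /char_poly_mx linearB/= tr_scalar_mx map_trmx.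
Qed.

(** Real and imaginary parts of M (a + i b) = (al + i be)(a + i b). [eigenvalue] speaks of row
    vectors, hence the passage to the transpose. *)
Lemma eigenpair_complex (n : nat) (M : 'M[R]_n) (a b : 'cV[R]_n) (al be : R) :
  M *m a = al *: a - be *: b -> M *m b = be *: a + al *: b ->
  (a != 0) || (b != 0) -> eigenvalue (mxC M) (Complex al be).
Proof.
move=> ha hb ab0; rewrite -eigenvalue_tr.
pose v : 'cV[complex R]_n := \col_i Complex (a i 0) (b i 0).
have vR : mxRe v = a by apply/colP => i; rewrite !mxE.
have vI : mxIm v = b by apply/colP => i; rewrite !mxE.
apply/eigenvalueP; exists v^T.
  rewrite -trmx_mul; suff -> : mxC M *m v = Complex al be *: v by rewrite linearZ.
  apply: mx_ReIm_inj.
    rewrite mxRe_mul vR vI mxRe_C mxIm_C mul0mx subr0 ha.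
    by apply/colP => i; rewrite !mxE /=.
  rewrite mxIm_mul vR vI mxRe_C mxIm_C mul0mx addr0 hb.
  by apply/colP => i; rewrite !mxE /= addrC.
apply/negP => /eqP /(congr1 trmx); rewrite trmxK trmx0 => v0.
move: ab0; rewrite -vR -vI v0.
suff [-> ->] : mxRe (0 : 'cV[complex R]_n) = 0 /\ mxIm (0 : 'cV[complex R]_n) = 0.
  by rewrite eqxx.
by split; apply/colP => i; rewrite !mxE.
Qed.

Lemma complex_eigenpair (n : nat) (M : 'M[R]_n) (z : complex R) :
  eigenvalue (mxC M) z -> exists a b : 'cV[R]_n,
  [/\ M *m a = complex.Re z *: a - complex.Im z *: b,
      M *m b = complex.Im z *: a + complex.Re z *: b &
      (a != 0) || (b != 0)].
Proof.
rewrite -eigenvalue_tr => /eigenvalueP[v + v0].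
move=> /(congr1 trmx); rewrite trmx_mul trmxK linearZ /=; set u := v^T => hu.
have u0 : u != 0 by rewrite -trmx0 (inj_eq trmx_inj).
exists (mxRe u), (mxIm u); split.
- have := congr1 (@mxRe _ _) hu; rewrite mxRe_mul mxRe_C mxIm_C mul0mx subr0 => ->.
  by apply/colP => i; rewrite !mxE; case: z {hu}; case: (v 0 i).
- have := congr1 (@mxIm _ _) hu; rewrite mxIm_mul mxRe_C mxIm_C mul0mx addr0 => ->.
  by apply/colP => i; rewrite !mxE; case: z {hu}; case: (v 0 i) => ? ? ? ? /=; rewrite addrC.
- rewrite -negb_and; apply: contra u0 => /andP[/eqP ur /eqP ui]; apply/eqP.
  by apply: mx_ReIm_inj; rewrite ?ur ?ui; apply/colP => i; rewrite !mxE.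
Qed.

(** The diagonal of the triangular form [T] consists of roots of its characteristic polynomial, and
    [T] is similar to [M]. *)
Lemma hurwitz_schur (n : nat) (M : 'M[R]_n) : hurwitz M -> (0 < n)%N ->
  exists U T : 'M[complex R]_n, [/\ U \is unitarymx, U *m mxC M = T *m U,
    (forall i j : 'I_n, (i < j)%N -> T i j = 0) &
    forall i, complex.Re (T i i) < 0].
Proof.
move=> hM n0; have [U Uu] := Schur (mxC M) n0.
rewrite /similar_to; set T := conjmx U (mxC M) => hT.
have Uinv := unitarymx_unit Uu.
have TE : T = U *m mxC M *m invmx U by rewrite /T conjumx.
exists U, T; split => //.
- by rewrite TE mulmxKV.
- by move=> i j ij; move/is_trig_mxP : hT; apply.
- move=> i; apply: hM; rewrite -/(mxC M).
  apply: (@eigenvalue_conjmx _ _ _ U) => //.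
  + exact: stablemx_unit.
  + by rewrite row_free_unit.
  + rewrite -/T -topredE /= eigenvalue_root_char char_poly_trig//.
    by rewrite (bigD1 i)//= rootM root_XsubC eqxx.
Qed.

(* For T1 + i T2 lower triangular acting on p + i q: with weights de^(2 i) and de
   small, the diagonal dominates the strictly triangular part. *)
Lemma trig_weights n (T1 T2 : 'M[R]_n) :
  (forall i j : 'I_n, (i < j)%N -> T1 i j = 0 /\ T2 i j = 0) ->
  (forall i, T1 i i < 0) ->
  exists (d : 'I_n -> R) (c : R), [/\ 0 < c, forall i, 0 < d i &
    forall p q : 'I_n -> R,
    \sum_i d i * (p i * (\sum_j (T1 i j * p j - T2 i j * q j)) +
                  q i * (\sum_j (T1 i j * q j + T2 i j * p j))) <=
    - c * \sum_i (p i ^+ 2 + q i ^+ 2)].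
Proof.
move=> trig neg; have eqle (x y : R) : x = y -> x <= y by move=> ->.
have [K K0 hK] : exists2 K : R, 0 < K & forall i j, `|T1 i j| + `|T2 i j| <= K.
  exists (1 + \sum_i \sum_j (`|T1 i j| + `|T2 i j|)).
    by rewrite ltr_pwDl// sumr_ge0// => i _; rewrite sumr_ge0// => j _; rewrite addr_ge0.
  move=> i j; rewrite (bigD1 i)//= (bigD1 j)//= addrCA -addrA -[leLHS]addr0 lerD2l.
  rewrite !addr_ge0// ?ler01//; apply: sumr_ge0 => *; rewrite ?addr_ge0//.
  by apply: sumr_ge0 => *; rewrite ?addr_ge0.
have [al al0 hal] : exists2 al : R, 0 < al & forall i, T1 i i <= - al.
  exists (\big[Order.min/1]_i (- T1 i i)).
    by apply: lt_bigmin => // i _; rewrite oppr_gt0.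
  by move=> i; rewrite lerNr; apply: bigmin_le_cond.
(* Chosen so that the off-diagonal terms, of total size n K de, cost at most al / 4; at least al / 2
   of the diagonal decay survives. *)
pose de := al / (al + 4 * n%:R * K).
have den0 : 0 < al + 4 * n%:R * K by rewrite ltr_pwDl// !mulr_ge0// ltW.
have de0 : 0 < de by rewrite divr_gt0.
have de1 : de <= 1.
  by rewrite ler_pdivrMr// mul1r lerDl !mulr_ge0// ltW.
have hde : n%:R * K * de <= al / 4.
  rewrite /de mulrA ler_pdivrMr// [leRHS]mulrAC -[leRHS]mulrA mulrC ler_wpM2l ?(ltW al0)//.
  by nra.
pose u (p q : 'I_n -> R) i := p i ^+ 2 + q i ^+ 2.
exists (fun i => (de ^+ i) ^+ 2), (al / 2 * (de ^+ n) ^+ 2); split.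
- by rewrite mulr_gt0 ?divr_gt0// !exprn_gt0.
- by move=> i; rewrite !exprn_gt0.
move=> p q.
have dn i : (de ^+ n) ^+ 2 <= (de ^+ (nat_of_ord (i : 'I_n))) ^+ 2.
  rewrite ler_sqr ?nnegrE ?exprn_ge0 ?(ltW de0)//.
  by apply: (ler_wiXn2l (ltW de0) de1); exact: ltnW.
(* The middle bound treats all pairs (i, j) alike: K de / 2 times both weighted squares for each
   pair, and the decay al on the diagonal. *)
refine (@le_trans _ _ (\sum_(i < n) \sum_(j < n) ((i == j)%:R * (- al * ((de ^+ i) ^+ 2 * u p q i)) +
   K * de / 2 * ((de ^+ i) ^+ 2 * u p q i + (de ^+ j) ^+ 2 * u p q j))) _ _ _ _).
  apply: ler_sum => i _.
  rewrite !mulr_sumr -big_split mulr_sumr; apply: ler_sum => j _ /=.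
  rewrite /u; set a := de ^+ i; set b := de ^+ j.
  have a0 : 0 < a by rewrite exprn_gt0.
  have b0 : 0 < b by rewrite exprn_gt0.
  case: (ltngtP i j) => [ij|ji|/val_inj ij].
  - have [-> ->] := trig _ _ ij; rewrite (_ : (i == j) = false) ?mul0r; last first.
      by apply/negbTE; rewrite -val_eqE ltn_eqF.
    rewrite !subrr !addr0 !mulr0 addr0 mulr0 add0r.
    by rewrite !mulr_ge0 ?addr_ge0 ?mulr_ge0 ?addr_ge0 ?sqr_ge0 ?invr_ge0// ltW.
  - rewrite (_ : (i == j) = false) ?mul0r ?add0r; last first.
      by apply/negbTE; rewrite -val_eqE gtn_eqF.
    (* Below the diagonal the weights differ by at least one factor [de]; this is where the
       smallness of the off-diagonal part comes from. *)
    have ab : a <= de * b.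
      rewrite /a /b -exprS; exact: (ler_wiXn2l (ltW de0) de1).
    have h (x y z w : R) : a ^+ 2 * (x * y + z * w) <= de / 2 * (a ^+ 2 * (x ^+ 2 + z ^+ 2) + b ^+ 2 * (y ^+ 2 + w ^+ 2)).
      apply: (@le_trans _ _ (a ^+ 2 * `|x * y + z * w|)).
        by rewrite ler_wpM2l ?sqr_ge0// ler_norm.
      apply: (@le_trans _ _ (a * (de * b) * `|x * y + z * w|)).
        by rewrite ler_wpM2r// expr2 ler_wpM2l// ltW.
      rewrite (_ : _ * `|_| = de * `|(a * x) * (b * y) + (a * z) * (b * w)|); last first.
        rewrite (_ : a * x * (b * y) + a * z * (b * w) = (a * b) * (x * y + z * w)); last by ring.
        by rewrite normrM (gtr0_norm (mulr_gt0 a0 b0)); ring.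
      rewrite -[leRHS]mulrA ler_wpM2l ?(ltW de0)//.
      rewrite (_ : a ^+ 2 * _ + _ = (a * x) ^+ 2 + (a * z) ^+ 2 + (b * y) ^+ 2 + (b * w) ^+ 2); last by ring.
      have := sqr_ge0 (a * x - b * y); have := sqr_ge0 (a * z - b * w).
      have := sqr_ge0 (a * x + b * y); have := sqr_ge0 (a * z + b * w).
      rewrite ler_norml; move: (a * x) (a * z) (b * y) (b * w) => X1 X2 X3 X4; nra.
    have h' (x y z w t : R) : a ^+ 2 * (t * (x * y + z * w)) <= `|t| * (de / 2 * (a ^+ 2 * (x ^+ 2 + z ^+ 2) + b ^+ 2 * (y ^+ 2 + w ^+ 2))).
      have [t0|t0] := leP 0 t.
        by rewrite ger0_norm// mulrCA ler_wpM2l// h.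
      have := h (- x) y (- z) w; rewrite !sqrrN => hh.
      rewrite ltr0_norm// mulrCA -[leLHS]mulrNN ler_wpM2l ?oppr_ge0 ?(ltW t0)// -mulrN.
      by apply: le_trans hh; rewrite !mulNr -opprD.
    have h1 := h' (p i) (p j) (q i) (q j) (T1 i j).
    have h2 := h' (q i) (p j) (- p i) (q j) (T2 i j).
    rewrite sqrrN in h2.
    have h3 := ler_wpM2r (_ : 0 <= de / 2 * (a ^+ 2 * (p i ^+ 2 + q i ^+ 2) + b ^+ 2 * (p j ^+ 2 + q j ^+ 2))) (hK i j).
    apply: le_trans (le_trans (h3 _) _).
    + rewrite mulrDl; apply: le_trans (lerD h1 _); last first.
        rewrite (addrC (p i ^+ 2)); exact: h2.
      by apply: eqle; ring.
    + by rewrite !mulr_ge0 ?addr_ge0 ?mulr_ge0 ?addr_ge0 ?sqr_ge0 ?invr_ge0// ltW.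
    + by rewrite !mulrA.
  - rewrite -ij eqxx mul1r.
    apply: (@le_trans _ _ (- al * (a ^+ 2 * (p i ^+ 2 + q i ^+ 2)))).
      have := ler_wpM2r (_ : 0 <= a ^+ 2 * (p i ^+ 2 + q i ^+ 2)) (hal i).
      rewrite mulr_ge0 ?sqr_ge0 ?addr_ge0 ?sqr_ge0// => /(_ isT); apply: le_trans.
      by apply: eqle; ring.
    rewrite lerDl.
    by rewrite !mulr_ge0 ?addr_ge0 ?mulr_ge0 ?addr_ge0 ?sqr_ge0 ?invr_ge0// ltW.
set S := \sum_(i < n) (de ^+ i) ^+ 2 * u p q i.
have -> : \sum_(i < n) \sum_(j < n) ((i == j)%:R * (- al * ((de ^+ i) ^+ 2 * u p q i)) +
   K * de / 2 * ((de ^+ i) ^+ 2 * u p q i + (de ^+ j) ^+ 2 * u p q j)) =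
   - al * S + n%:R * K * de * S.
  transitivity (\sum_(i < n) (- al * ((de ^+ i) ^+ 2 * u p q i) +
      K * de / 2 * (n%:R * ((de ^+ i) ^+ 2 * u p q i) + S))).
    apply: eq_bigr => i _.
    rewrite big_split /= -mulr_sumr big_split /= sumr_const card_ord -/S mulr_natl.
    congr (_ + _); rewrite (bigD1 i)//= eqxx mul1r big1 ?addr0// => j.
    by rewrite eq_sym => /negbTE ->; rewrite mul0r.
  rewrite big_split/= -!mulr_sumr -/S big_split /= sumr_const card_ord.
  rewrite -mulr_sumr -/S -[S *+ n]mulr_natl; lra.
have S0 : 0 <= S.
  by apply: sumr_ge0 => i _; rewrite mulr_ge0 ?sqr_ge0 ?addr_ge0 ?sqr_ge0.
have hS : (de ^+ n) ^+ 2 * \sum_i (p i ^+ 2 + q i ^+ 2) <= S.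
  rewrite mulr_sumr; apply: ler_sum => i _; rewrite ler_wpM2r//.
  by rewrite addr_ge0 ?sqr_ge0.
move: hS; set X := \sum_i _; set Y := (de ^+ n) ^+ 2 => hS.
have := ler_wpM2r S0 hde.
have := ler_wpM2l (ltW al0) hS.
nra.
Qed.


Lemma qformE n (M : 'M[R]_n) (z : 'cV[R]_n) :
  qform M z = \sum_i z i 0 * (M *m z) i 0.
Proof. by rewrite /qform -mulmxA mxE; apply: eq_bigr => i _; rewrite mxE. Qed.

Lemma sqnorm_sum n (z : 'cV[R]_n) : sqnorm z = \sum_i z i 0 ^+ 2.
Proof. by rewrite /sqnorm mxE; apply: eq_bigr => i _; rewrite mxE. Qed.

Definition dotv n (x y : 'cV[R]_n) : R := (x^T *m y) 0 0.

Lemma dotvE n (x y : 'cV[R]_n) : dotv x y = \sum_i x i 0 * y i 0.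
Proof. by rewrite /dotv mxE; apply: eq_bigr => i _; rewrite mxE. Qed.

Lemma qform_dotv n (M : 'M[R]_n) z : qform M z = dotv z (M *m z).
Proof. by rewrite /dotv /qform mulmxA. Qed.

Lemma sqnorm_dotv n (z : 'cV[R]_n) : sqnorm z = dotv z z. Proof. by []. Qed.

(** Write U z = p + i q in the unitary Schur frame, with z real. The form p.Dp + q.Dq decays by
    [trig_weights]; it is z.Hz for H the real part of U^* D U, hence a real matrix. Unitarity turns
    |p|^2 + |q|^2 back into |z|^2, so c is unchanged. *)
Lemma hurwitz_lyapunov n (M : 'M[R]_n) : hurwitz M ->
  exists (H : 'M[R]_n) (c : R), [/\ 0 < c, psd H &
    forall z, dotv z (H *m (M *m z)) <= - c * sqnorm z].
Proof.
case: n M => [M _|n M hM].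
  exists 0, 1; split => //.
    by split=> [|z]; rewrite ?trmx0// qformE big_ord0.
  by move=> z; rewrite dotvE sqnorm_sum !big_ord0 mulr0.
have [U [T [Uu UM trig neg]]] := hurwitz_schur hM isT.
have trig' (i j : 'I_n.+1) : (i < j)%N -> mxRe T i j = 0 /\ mxIm T i j = 0.
  by move=> /trig Tij; rewrite !mxE Tij.
have neg' i : mxRe T i i < 0 by rewrite mxE.
have [d [c [c0 d0 hd]]] := trig_weights trig' neg'.
set U1 := mxRe U; set U2 := mxIm U.
pose D := diag_mx (\row_i d i).
have hHz (z w : 'cV_n.+1) : dotv z ((U1^T *m D *m U1 + U2^T *m D *m U2) *m w) =
    \sum_i d i * ((U1 *m z) i 0 * (U1 *m w) i 0 + (U2 *m z) i 0 * (U2 *m w) i 0).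
  rewrite /dotv mulmxDl mulmxDr mxE.
  have aux (V : 'M[R]_n.+1) : (z^T *m (V^T *m D *m V *m w)) 0 0 =
      \sum_i d i * ((V *m z) i 0 * (V *m w) i 0).
    rewrite !mulmxA -trmx_mul -mulmxA mxE; apply: eq_bigr => i _.
    by rewrite mul_mx_diag !mxE; ring.
  by rewrite !aux -big_split; apply: eq_bigr => i _ /=; ring.
exists (U1^T *m D *m U1 + U2^T *m D *m U2), c; split => //.
- split.
    by rewrite linearD /= !trmx_mul !trmxK tr_diag_mx !mulmxA.
  move=> z; rewrite qform_dotv hHz; apply: sumr_ge0 => i _.
  by rewrite mulr_ge0 ?(ltW (d0 _))// addr_ge0 ?sqr_ge0// -expr2 sqr_ge0.
- move=> z; rewrite hHz.
  have e1 : U1 *m M = mxRe T *m U1 - mxIm T *m U2.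
    by rewrite -mxRe_mul -UM mxRe_mul mxRe_C mxIm_C mulmx0 subr0.
  have e2 : U2 *m M = mxRe T *m U2 + mxIm T *m U1.
    by rewrite -mxIm_mul -UM mxIm_mul mxRe_C mxIm_C mulmx0 add0r.
  (* Real part of U^* U = 1, where U^* = U1^T - i U2^T. *)
  have e3 : U1^T *m U1 + U2^T *m U2 = 1%:M.
    have := Uu; rewrite -trmxC_unitary => /unitarymxP.
    rewrite trmxCK => /(congr1 (@mxRe _ _)); rewrite mxRe_mul.
    rewrite (_ : mxRe (map_mx _ _) = U1^T); last by apply/matrixP => i j; rewrite !mxE; case: (U j i).
    rewrite (_ : mxIm (map_mx _ _) = - U2^T); last by apply/matrixP => i j; rewrite !mxE; case: (U j i).
    rewrite mulNmx opprK => ->; apply/matrixP => i j; rewrite !mxE.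
    by case: (i == j).
  have -> : sqnorm z = \sum_i ((U1 *m z) i 0 ^+ 2 + (U2 *m z) i 0 ^+ 2).
    rewrite big_split /= -!sqnorm_sum /sqnorm !trmx_mul !mulmxA.
    have -> : z^T *m z = z^T *m (U1^T *m U1 + U2^T *m U2) *m z by rewrite e3 mulmx1.
    by rewrite mulmxDr mulmxDl mxE !mulmxA.
  apply: le_trans (hd (fun i => (U1 *m z) i 0) (fun i => (U2 *m z) i 0)).
  rewrite le_eqVlt; apply/orP; left; apply/eqP; apply: eq_bigr => i _.
  congr (_ * (_ * _ + _ * _)).
    rewrite mulmxA e1 mulmxBl -!mulmxA mxE [X in _ + X]mxE !mxE -sumrB.
    by apply: eq_bigr => j _; rewrite !mxE.
  rewrite mulmxA e2 mulmxDl -!mulmxA mxE !mxE -big_split.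
  by apply: eq_bigr => j _; rewrite !mxE.
Qed.

(** The equation carries plain transposes, so over the complex numbers [D] changes by the congruence
    U^T E U and not by a conjugate transpose. *)
Lemma sylvester_conj (F : fieldType) n (U T M D : 'M[F]_n) :
  U \in unitmx -> U *m M = T *m U -> D *m M + M^T *m D = 0 ->
  exists2 E, E *m T + T^T *m E = 0 & D = U^T *m E *m U.
Proof.
move=> Ui UM hD; exists ((invmx U)^T *m D *m invmx U); last first.
  have UI : U^T *m (invmx U)^T = 1%:M by rewrite -trmx_mul mulVmx// trmx1.
  by rewrite !mulmxA UI mul1mx mulmxKV.
have TE : T = U *m M *m invmx U by rewrite UM mulmxK.
have -> : (invmx U)^T *m D *m invmx U *m T = (invmx U)^T *m (D *m M) *m invmx U.
  by rewrite TE !mulmxA mulmxKV.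
have -> : T^T *m ((invmx U)^T *m D *m invmx U) = (invmx U)^T *m (M^T *m D) *m invmx U.
  have IU : U^T *m (invmx U)^T = 1%:M by rewrite -trmx_mul mulVmx// trmx1.
  by rewrite TE !trmx_mul !mulmxA -[_ *m U^T *m _]mulmxA IU mulmx1.
by rewrite -mulmxDl -mulmxDr hD mulmx0 mul0mx.
Qed.

(** In triangular coordinates, entry (i, j) expresses (T_ii + T_jj) E_ij through entries of E
    further right in row i or further down in column j. T_ii + T_jj has negative real part, so E
    vanishes entry by entry, starting from the bottom right corner. *)
Lemma hurwitz_sylvester n (M D : 'M[R]_n) : hurwitz M ->
  D *m M + M^T *m D = 0 -> D = 0.
Proof.
case: n M D => [M D _ _|n M D hM hD]; first by apply/matrixP => -[].
have [U [T [Uu UM trig neg]]] := hurwitz_schur hM isT.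
have Ui := unitarymx_unit Uu.
have hDC : mxC D *m mxC M + (mxC M)^T *m mxC D = 0.
  rewrite /mxC map_trmx -!map_mxM -map_mxD hD.
  by apply/matrixP => i j; rewrite !mxE.
have [E hE DE] := sylvester_conj Ui UM hDC.
have Eij : forall k (i j : 'I_n.+1), ((n - i) + (n - j) < k)%N -> E i j = 0.
  elim => // k IH i j hk.
  have := congr1 (fun X : 'M[complex R]_(n.+1) => X i j) hE; rewrite !mxE.
  rewrite (bigD1 j)//= big1 ?addr0; last first.
    move=> l lj; case: (ltngtP l j) => h; last by rewrite (val_inj h) eqxx in lj.
      by rewrite trig ?mulr0.
    rewrite IH ?mul0r//; have := ltn_ord l; have := ltn_ord j; lia.
  rewrite (bigD1 i)//= big1 ?addr0; last first.
    move=> l li; rewrite mxE; case: (ltngtP l i) => h; last by rewrite (val_inj h) eqxx in li.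
      by rewrite trig ?mul0r.
    rewrite IH ?mulr0//; have := ltn_ord l; have := ltn_ord i; lia.
  rewrite mxE mulrC -mulrDl => /eqP; rewrite mulf_eq0 => /orP[|/eqP//].
  have := neg i; have := neg j; case: (T i i) (T j j) => a b [a' b'] /= h1 h2.
  rewrite eq_complex /= => /andP[/eqP h3 _]; exfalso; move: h1 h2 h3; clear; lra.
have E0 : E = 0 by apply/matrixP => i j; rewrite (Eij _ _ _ (ltnSn _)) mxE.
rewrite -[D]mxRe_C DE E0 mulmx0 mul0mx.
by apply/matrixP => i j; rewrite !mxE.
Qed.

End RealParts.

(** * Quadratic forms, and stability of the Riccati closed loop *)

Section Dot.
Context {R : realType}.

Lemma dotvC n (x y : 'cV[R]_n) : dotv x y = dotv y x.
Proof. by rewrite !dotvE; apply: eq_bigr => i _; rewrite mulrC. Qed.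

Lemma dotvDr n (x y z : 'cV[R]_n) : dotv x (y + z) = dotv x y + dotv x z.
Proof. by rewrite /dotv mulmxDr mxE. Qed.

Lemma dotvNr n (x y : 'cV[R]_n) : dotv x (- y) = - dotv x y.
Proof. by rewrite /dotv mulmxN mxE. Qed.

Lemma dotvZr n a (x y : 'cV[R]_n) : dotv x (a *: y) = a * dotv x y.
Proof. by rewrite /dotv -scalemxAr mxE. Qed.

Lemma dotvDl n (x y z : 'cV[R]_n) : dotv (y + z) x = dotv y x + dotv z x.
Proof. by rewrite dotvC dotvDr !(dotvC x). Qed.

Lemma dotvNl n (x y : 'cV[R]_n) : dotv (- y) x = - dotv y x.
Proof. by rewrite dotvC dotvNr (dotvC x). Qed.

Lemma dotvZl n a (x y : 'cV[R]_n) : dotv (a *: y) x = a * dotv y x.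
Proof. by rewrite dotvC dotvZr (dotvC x). Qed.

Lemma dotv0r n (x : 'cV[R]_n) : dotv x 0 = 0.
Proof. by rewrite /dotv mulmx0 mxE. Qed.

Lemma dotv_trl m n (M : 'M[R]_(m, n)) x y : dotv x (M *m y) = dotv (M^T *m x) y.
Proof. by rewrite /dotv trmx_mul trmxK mulmxA. Qed.

Definition dotv_lin := (dotvDl, dotvDr, dotvNl, dotvNr, dotvZl, dotvZr).

Lemma sqnorm_ge0 n (x : 'cV[R]_n) : 0 <= sqnorm x.
Proof. by rewrite sqnorm_sum; apply: sumr_ge0 => i _; rewrite sqr_ge0. Qed.

Lemma sqnorm_eq0 n (x : 'cV[R]_n) : sqnorm x = 0 -> x = 0.
Proof.
rewrite sqnorm_sum => /eqP; rewrite psumr_eq0; last by move=> i _; rewrite sqr_ge0.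
move=> /allP h; apply/colP => i; rewrite mxE; apply/eqP.
by have := h i (mem_index_enum _); rewrite sqrf_eq0.
Qed.

Lemma sqnorm0 n : sqnorm (0 : 'cV[R]_n) = 0.
Proof. by rewrite sqnorm_dotv dotv0r. Qed.

Lemma sqnormZ n a (x : 'cV[R]_n) : sqnorm (a *: x) = a ^+ 2 * sqnorm x.
Proof. by rewrite sqnorm_dotv dotvZl dotvZr mulrA. Qed.

Lemma sqnormN n (x : 'cV[R]_n) : sqnorm (- x) = sqnorm x.
Proof. by rewrite sqnorm_dotv !dotv_lin opprK. Qed.

Lemma dotv_young n (e : R) (x y : 'cV[R]_n) : 0 < e ->
  2 * `|dotv x y| <= e * sqnorm x + e^-1 * sqnorm y.
Proof.
move=> e0.
have h1 := sqnorm_ge0 (e *: x + y); have h2 := sqnorm_ge0 (e *: x - y).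
have ei : 0 < e^-1 by rewrite invr_gt0.
have eq1 : e * sqnorm x + e^-1 * sqnorm y + 2 * dotv x y = e^-1 * sqnorm (e *: x + y).
  rewrite !sqnorm_dotv !dotv_lin (dotvC y x); field; exact: lt0r_neq0.
have eq2 : e * sqnorm x + e^-1 * sqnorm y - 2 * dotv x y = e^-1 * sqnorm (e *: x - y).
  rewrite !sqnorm_dotv !dotv_lin (dotvC y x); field; exact: lt0r_neq0.
have := mulr_ge0 (ltW ei) h1; rewrite -eq1.
have := mulr_ge0 (ltW ei) h2; rewrite -eq2.
have [d0|d0] := leP 0 (dotv x y); [rewrite ger0_norm//|rewrite ltr0_norm//]; lra.
Qed.

Lemma sqnormD_le n (x y : 'cV[R]_n) : sqnorm (x + y) <= 2 * sqnorm x + 2 * sqnorm y.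
Proof.
have := sqnorm_ge0 (x - y); rewrite !sqnorm_dotv !dotv_lin (dotvC y x); lra.
Qed.

Lemma sqnorm_mul_le m n (M : 'M[R]_(m, n)) :
  exists2 C : R, 0 < C & forall x, sqnorm (M *m x) <= C * sqnorm x.
Proof.
pose C := 1 + \sum_i sqnorm (row i M)^T.
exists C; first by rewrite ltr_pwDl// sumr_ge0// => i _; rewrite sqnorm_ge0.
move=> x; rewrite mulrDl mul1r mulr_suml ler_wpDl ?sqnorm_ge0// sqnorm_sum.
apply: ler_sum => i _.
have -> : (M *m x) i 0 = dotv (row i M)^T x.
  by rewrite dotvE mxE; apply: eq_bigr => j _; rewrite !mxE.
set y := (row i M)^T.
have [->|y0] := eqVneq y 0; first by rewrite dotvC dotv0r expr0n mulr_ge0 ?sqnorm_ge0.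
have ny : 0 < sqnorm y.
  by rewrite lt_neqAle sqnorm_ge0 andbT eq_sym; apply: contra y0 => /eqP/sqnorm_eq0 ->.
(* Cauchy-Schwarz for one row, from the squared distance of x to the line spanned by y. *)
have := sqnorm_ge0 (x - (dotv y x / sqnorm y) *: y).
rewrite !sqnorm_dotv !dotv_lin (dotvC x y) -!sqnorm_dotv => h.
have := mulr_ge0 (ltW ny) h; rewrite (_ : _ * (_ + _) = sqnorm y * sqnorm x - dotv y x ^+ 2).
  by rewrite subr_ge0.
by field; exact: lt0r_neq0.
Qed.

Lemma psd_kernel_sqrt n (Q S : 'M[R]_n) x : is_psd_sqrt Q S ->
  dotv x (Q *m x) = 0 -> S *m x = 0.
Proof.
move=> [[Ssym _] <-] h; apply: sqnorm_eq0.
by rewrite sqnorm_dotv dotv_trl Ssym mulmxA dotvC.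
Qed.

Lemma pd_unit n (M : 'M[R]_n) : pd M -> M \in unitmx.
Proof.
move=> [Msym Mpos]; rewrite -row_free_unit -kermx_eq0; apply/eqP/row_matrixP => i.
set u := row i _; have uM : u *m M = 0 by rewrite /u -row_mul mulmx_ker row0.
rewrite row0; apply/eqP; apply: contraT => u0.
have := Mpos u^T; rewrite -trmx0 (inj_eq trmx_inj) => /(_ u0).
by rewrite /qform trmxK uM mul0mx mxE ltxx.
Qed.

Section ControlGramian.
Variables (n r : nat) (B : 'M[R]_(n, r)) (Rw : 'M[R]_r).
Hypothesis hRw : pd Rw.
Let S := B *m invmx Rw *m B^T.

Lemma gram_sym : S^T = S.
Proof.
by rewrite /S !trmx_mul trmxK trmx_inv; case: hRw => -> _; rewrite mulmxA.
Qed.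

(** Positivity of B R^-1 B^T is read off [Rw] at the input R^-1 B^T x. In particular the form
    vanishes only if this input does. *)
Lemma gram_form x : dotv x (S *m x) = qform Rw (invmx Rw *m B^T *m x).
Proof.
have Ru := pd_unit hRw.
rewrite /S qform_dotv -!mulmxA (mulmxA Rw) mulmxV// mul1mx.
by rewrite dotv_trl dotvC.
Qed.

Lemma gram_ge0 x : 0 <= dotv x (S *m x).
Proof.
rewrite gram_form; have [->|y0] := eqVneq (invmx Rw *m B^T *m x) 0.
  by rewrite qform_dotv mulmx0 dotv0r.
by apply: ltW; case: hRw => _; apply.
Qed.

Lemma gram_eq0 x : dotv x (S *m x) = 0 -> invmx Rw *m B^T *m x = 0.
Proof.
rewrite gram_form => h; apply/eqP; apply: contraT => y0.
by case: hRw => _ /(_ _ y0); rewrite h ltxx.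
Qed.

End ControlGramian.

(** The Riccati equation tested on x. Half of the discount goes into the closed-loop matrix, for
    which x.Px is then a Lyapunov function dissipating the state cost and the control cost. *)
Lemma riccati_form n (rho : R) (A P S Q : 'M[R]_n) x :
  P^T = P -> S^T = S -> rho *: P = A^T *m P + P *m A - P *m S *m P + Q ->
  2 * dotv x (P *m ((A - S *m P - (rho / 2)%:M) *m x)) =
  - dotv x (Q *m x) - dotv (P *m x) (S *m (P *m x)).
Proof.
move=> Ps Ss /(congr1 (fun X : 'M[R]_n => dotv x (X *m x))).
rewrite -scalemxAl !mulmxDl !mulNmx mul_scalar_mx !mulmxDr !mulmxN -scalemxAr.
rewrite !dotv_lin -!mulmxA.
have -> : dotv x (A^T *m (P *m x)) = dotv (P *m x) (A *m x).
  by rewrite dotv_trl trmxK dotvC.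
have e2 y : dotv x (P *m y) = dotv (P *m x) y by rewrite dotv_trl Ps.
rewrite !e2.
move: (dotv (P *m x) (A *m x)) (dotv x (Q *m x)) (dotv (P *m x) (S *m (P *m x))) (dotv (P *m x) x).
move=> a b c d h; lra.
Qed.

(** Let a + i b be an eigenvector with Re z >= 0. Adding [riccati_form] at a and at b equates 2 Re z
    (a.Pa + b.Pb) with minus a sum of nonnegative costs, so every cost vanishes. Then sqrtQ and S P
    annihilate a and b, and the closed loop acts on them as the Hurwitz matrix A - rho/2 + L sqrtQ
    given by detectability. *)
Lemma riccati_hurwitz n r (rho : R) (A P Q sqrtQ : 'M[R]_n) (B : 'M[R]_(n, r))
    (Rw : 'M[R]_r) :
  pd Rw -> psd P -> psd Q -> is_psd_sqrt Q sqrtQ ->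
  detectable (A - (rho / 2)%:M) sqrtQ ->
  rho *: P = A^T *m P + P *m A - P *m B *m invmx Rw *m B^T *m P + Q ->
  hurwitz (A_bar A B Rw P - (rho / 2)%:M).
Proof.
move=> hRw [Ps Pge] [Qs Qge] hsq [L hL] hP z.
set S := B *m invmx Rw *m B^T.
have Ss : S^T = S := gram_sym B hRw.
have hPx x := @riccati_form n rho A P S Q x Ps Ss.
rewrite /A_bar -/S => /complex_eigenpair[a [b [ha hb ab0]]].
rewrite ltNge; apply/negP => z0.
have hPS : rho *: P = A^T *m P + P *m A - P *m S *m P + Q by rewrite hP /S !mulmxA.
have := hPx a hPS; have := hPx b hPS; rewrite ha hb !mulmxDr !mulmxN -!scalemxAr.
rewrite !dotv_lin (dotv_trl P b a) Ps (dotvC _ a) => eb ea.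
have Qa := Qge a; have Qb := Qge b; have Pa := Pge a; have Pb := Pge b.
rewrite !qform_dotv in Qa Qb Pa Pb.
have Sa : 0 <= dotv (P *m a) (S *m (P *m a)) := gram_ge0 _ hRw _.
have Sb : 0 <= dotv (P *m b) (S *m (P *m b)) := gram_ge0 _ hRw _.
have zP : 0 <= complex.Re z * (dotv a (P *m a) + dotv b (P *m b)).
  by rewrite mulr_ge0// addr_ge0.
have Qa0 : dotv a (Q *m a) = 0 by lra.
have Qb0 : dotv b (Q *m b) = 0 by lra.
have Sa0 : dotv (P *m a) (S *m (P *m a)) = 0 by lra.
have Sb0 : dotv (P *m b) (S *m (P *m b)) = 0 by lra.
have key x : dotv x (Q *m x) = 0 -> dotv (P *m x) (S *m (P *m x)) = 0 ->
    (A - (rho / 2)%:M + L *m sqrtQ) *m x = (A - S *m P - (rho / 2)%:M) *m x.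
  move=> /(psd_kernel_sqrt hsq) h1 /(gram_eq0 hRw) h2.
  have h3 : S *m (P *m x) = 0.
    by rewrite /S -!mulmxA; move: h2; rewrite -!mulmxA => ->; rewrite mulmx0.
  by rewrite !mulmxDl !mulNmx -(mulmxA L) -(mulmxA S) h1 h3 mulmx0 addr0 subr0.
have ha' := key a Qa0 Sa0; have hb' := key b Qb0 Sb0.
rewrite ha in ha'; rewrite hb in hb'.
have := hL _ (eigenpair_complex ha' hb' ab0).
by rewrite /= ltNge z0.
Qed.
End Dot.

(** * Calculus on the half-line *)

Section HalfLine.
Context {R : realType}.
Local Notation mu := (@lebesgue_measure R).
Implicit Types f g v : R -> R.

Definition hcont (V : topologicalType) (f : R -> V) : Prop :=
  {within `[0, +oo[, continuous f}.

(** Freezing a function to the left of 0 turns continuity on the half-line into continuity on the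
    line, so the usual continuity lemmas apply; [hcont_of_ext] goes back. *)
Lemma hcont_ext (V : topologicalType) (f : R -> V) :
  hcont f -> continuous (fun t : R => f (Num.max 0 t)).
Proof.
move=> /subspace_continuousP cf t.
have m0 : `[0, +oo[%classic (Num.max 0 t) by rewrite /= in_itv/= andbT le_max lexx.
apply: (@cvg_comp _ _ _ (fun s : R => Num.max 0 s) f _ _ _ _ (cf _ m0)).
move=> U; rewrite /within /= => nU.
have cm : continuous (fun s : R => Num.max 0 s).
  by move=> s; apply: (@continuous_max _ _ (cst 0) id) => //; exact: cvg_cst.
have h : \forall s \near t, `[0, +oo[%classic (Num.max 0 s) -> U (Num.max 0 s) := cm t _ nU.
apply: (@filterS _ _ _ (fun s => `[0, +oo[%classic (Num.max 0 s) -> U (Num.max 0 s)) _ _ h).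
move=> s; apply.
by rewrite /= in_itv/= andbT le_max lexx.
Qed.

Lemma hcont_eq (V : topologicalType) (f g : R -> V) :
  (forall t : R, 0 <= t -> f t = g t) -> hcont f -> hcont g.
Proof.
move=> fg; apply: subspace_eq_continuous => t; rewrite inE /= in_itv/= andbT => t0.
exact: fg.
Qed.

Lemma hcontT (V : topologicalType) (f : R -> V) : continuous f -> hcont f.
Proof. exact: continuous_subspaceT. Qed.

Lemma hcont_of_ext (V : topologicalType) (f : R -> V) :
  continuous (fun t : R => f (Num.max 0 t)) -> hcont f.
Proof. by move=> /hcontT; apply: hcont_eq => t t0; rewrite max_r. Qed.

Lemma hcont_at (V : topologicalType) (f : R -> V) t :
  hcont f -> 0 < t -> {for t, continuous f}.
Proof.
move=> /subspace_continuousP cf t0.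
have At : `[0, +oo[%classic t by rewrite /= in_itv/= andbT ltW.
move=> U nU0.
have nU : \forall s \near t, `[0, +oo[%classic s -> U (f s) := cf t At U nU0.
have gt0 : \forall s \near t, s \in `]0, +oo[%R by apply: near_in_itvoy; rewrite in_itv/= andbT.
change (\forall s \near t, U (f s)).
apply: filterS2 nU gt0 => s; rewrite in_itv/= andbT => Us s0; apply: Us.
by rewrite /= in_itv/= andbT ltW.
Qed.

Lemma hcont_seg (V : topologicalType) (f : R -> V) (a b : R) :
  hcont f -> 0 <= a -> {within `[a, b], continuous f}.
Proof.
move=> cf a0; apply: continuous_subspaceW cf => t /=.
by rewrite !in_itv/= andbT => /andP[+ _]; apply: le_trans.
Qed.

Lemma hcont_integrable f (b : R) : hcont f -> mu.-integrable `[0, b] (EFin \o f).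
Proof.
move=> cf; apply: continuous_compact_integrable; first exact: segment_compact.
exact: hcont_seg.
Qed.

Lemma hcont_measurable f : hcont f -> measurable_fun (`[0%R, +oo[%classic : set R) f.
Proof. by move=> cf; apply: subspace_continuous_measurable_fun. Qed.

Lemma Rintegral00 f : Rintegral mu `[0, 0] f = 0.
Proof. by rewrite set_itv1 Rintegral_set1. Qed.

Lemma hcont_int f : hcont f -> hcont (fun t => Rintegral mu `[0, t] f).
Proof.
move=> cf; apply/subspace_continuousP => t; rewrite /= in_itv/= andbT => t0.
(* Continuity of the integral is available on a segment; ending it at t + 1 keeps t away from the
   right end. *)
have t1 : 0 <= t + 1 by lra.
have /subspace_continuousP h := parameterized_integral_continuous t1 (hcont_integrable (t + 1) cf).
have := h t; rewrite /= in_itv/= t0 lerDl ler01 => /(_ isT) ct.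
move=> U nU0.
have nU : \forall s \near t, `[0, t + 1]%classic s -> U (Rintegral mu `[0, s] f) := ct U nU0.
have lt1 : \forall s \near t, s < t + 1 by apply: lt_nbhsl; lra.
change (\forall s \near t, `[0, +oo[%classic s -> U (Rintegral mu `[0, s] f)).
apply: filterS2 nU lt1 => s Us s1.
rewrite /= in_itv/= andbT => s0; apply: Us; rewrite /= in_itv/= s0; exact: ltW.
Qed.

Lemma is_derive_int f (t : R) : hcont f -> 0 < t ->
  is_derive t (1 : R) (fun t => Rintegral mu `[0, t] f) (f t).
Proof.
move=> cf t0.
have [] := @continuous_FTC1_closed R f 0 t (t + 1) _ (hcont_integrable _ cf) t0 (hcont_at cf t0).
  by rewrite ltrDl.
by rewrite derive1E => h1 h2; split.
Qed.

(** The derivative is known at t > 0 only; continuity at 0 extends the comparison to s = 0. *)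
Lemma hcont_nonincreasing f v : hcont f ->
  (forall t : R, 0 < t -> is_derive t (1 : R) f (v t)) ->
  (forall t : R, 0 < t -> v t <= 0) ->
  forall s t : R, 0 <= s -> s <= t -> f t <= f s.
Proof.
move=> cf df v0 s t s0 st.
have dv x : x \in `]s, t[ -> is_derive x (1 : R) f (v x).
  by rewrite in_itv/= => /andP[sx _]; apply: df; exact: le_lt_trans sx.
apply: (@ler0_derive1_le_cc R f s t); rewrite ?in_itv/= ?st ?lexx//.
- by move=> x /dv [].
- move=> x xst; have [h1] := dv x xst; rewrite derive1E => ->; apply: v0.
  by move: xst; rewrite in_itv/= => /andP[sx _]; exact: le_lt_trans sx.
- exact: hcont_seg.
Qed.

Lemma hcontD f g : hcont f -> hcont g -> hcont (fun t => f t + g t).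
Proof.
move=> /hcont_ext cf /hcont_ext cg; apply: hcont_of_ext => t.
exact: (continuousD (cf t) (cg t)).
Qed.

Lemma hcontM f g : hcont f -> hcont g -> hcont (fun t => f t * g t).
Proof.
move=> /hcont_ext cf /hcont_ext cg; apply: hcont_of_ext => t.
exact: (continuousM (cf t) (cg t)).
Qed.

Lemma hcontN f : hcont f -> hcont (fun t => - f t).
Proof.
move=> /hcont_ext cf; apply: hcont_of_ext => t; exact: (continuousN (cf t)).
Qed.

Lemma hcontB f g : hcont f -> hcont g -> hcont (fun t => f t - g t).
Proof. by move=> cf cg; apply: hcontD => //; exact: hcontN. Qed.

Lemma hcont_cst (a : R) : hcont (fun _ => a).
Proof. by apply: hcontT => t; exact: cvg_cst. Qed.

Arguments hcont_cst a : clear implicits.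

Lemma hcont_sum (I : Type) (r : seq I) (P : pred I) (F : I -> R -> R) :
  (forall i, hcont (F i)) -> hcont (fun t => \sum_(i <- r | P i) F i t).
Proof.
move=> hF; elim: r => [|i r IH].
  by apply: (hcont_eq _ (hcont_cst 0)) => t _; rewrite big_nil.
have [Pi|Pi] := boolP (P i).
  by apply: (hcont_eq _ (hcontD (hF i) IH)) => t _; rewrite big_cons Pi.
by apply: (hcont_eq _ IH) => t _; rewrite big_cons (negbTE Pi).
Qed.

Lemma hcont_expR (a : R) : hcont (fun t => expR (- (a * t))).
Proof.
apply: hcontT => t; apply: continuous_comp; last exact: continuous_expR.
apply: (@continuousN R R R (fun t => a * t) t).
by apply: (@continuousM R R (cst a) id t) => //; exact: cvg_cst.
Qed.

Arguments hcont_expR a : clear implicits.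

Lemma hcont_const_of_deriv0 f : hcont f ->
  (forall t : R, 0 < t -> is_derive t (1 : R) f 0) -> forall t : R, 0 <= t -> f t = f 0.
Proof.
move=> cf df t t0; apply/le_anti/andP; split.
  by apply: (hcont_nonincreasing cf df).
have := @hcont_nonincreasing (fun t => - f t) (fun _ => 0) (hcontN cf).
move=> /(_ _ _ 0 t); rewrite lerN2; apply => // s s0.
by apply: is_derive_eq (is_deriveN (df s s0)) _; rewrite oppr0.
Qed.

Lemma FTC2_halfline g v : hcont g -> hcont v ->
  (forall t : R, 0 < t -> is_derive t (1 : R) g (v t)) ->
  forall t : R, 0 <= t -> g t = g 0 + Rintegral mu `[0, t] v.
Proof.
move=> cg cv dg t t0.
have dG (s : R) : 0 < s -> is_derive s (1 : R) (fun t => g t - Rintegral mu `[0, t] v) 0.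
  move=> s0; apply: is_derive_eq (is_deriveB (dg s s0) (is_derive_int cv s0)) _.
  by rewrite subrr.
have := hcont_const_of_deriv0 (hcontB cg (hcont_int cv)) dG t0.
by rewrite Rintegral00 subr0 => <-; rewrite subrK.
Qed.

Lemma halfline_bigcup : \bigcup_(i : nat) (`[0, i%:R]%classic : set R) = `[0%R, +oo[%classic.
Proof.
apply/seteqP; split => [x [i _]|x]; rewrite /= !in_itv/= andbT.
  by case/andP.
move=> x0; exists (Num.bound x) => //=; rewrite in_itv/= x0/=.
by apply: ltW; exact: archi_boundP.
Qed.

(** Monotone convergence along [0, n]. It reduces extended-real integrals over the half-line to real
    integrals of continuous functions over segments. *)
Lemma integral_halfline_cvg (f : R -> R) : hcont f -> (forall t : R, 0 <= t -> 0 <= f t) ->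
  (Rintegral mu `[0, n%:R] f)%:E @[n --> \oo] --> (\int[mu]_(t in `[0%R, +oo[) (f t)%:E)%E.
Proof.
move=> cf f0.
have mf : measurable_fun (`[0%R, +oo[%classic : set R) (EFin \o f).
  by apply/measurable_EFinP; exact: hcont_measurable.
have := @ge0_nondecreasing_set_cvg_integral _ (measurableTypeR R) R (fun i : nat => `[0%R, i%:R]%classic) (EFin \o f) mu.
rewrite halfline_bigcup => h.
have {}h : (\int[mu]_(t in `[0%R, i%:R]) (f t)%:E)%E @[i --> \oo] --> (\int[mu]_(t in `[0%R, +oo[) (f t)%:E)%E.
  apply: h.
  - move=> m n mn; apply/subsetPset => x /=; rewrite !in_itv/= => /andP[-> /=].
    by move=> /le_trans; apply; rewrite ler_nat.
  - by [].
  - move=> i; apply: measurable_funS mf => // x /=; rewrite !in_itv/= andbT.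
    by case/andP.
  - by move=> i x /=; rewrite in_itv/= => /andP[x0 _]; rewrite lee_fin f0.
apply: cvg_trans h; apply: near_eq_cvg; near=> n.
rewrite /Rintegral fineK//; exact: integrable_fin_num (hcont_integrable _ cf).
Unshelve. all: by end_near. Qed.

Lemma integral_halfline_le f (C : \bar R) : hcont f -> (forall t : R, 0 <= t -> 0 <= f t) ->
  (forall n : nat, ((Rintegral mu `[0, n%:R] f)%:E <= C)%E) ->
  (\int[mu]_(t in `[0%R, +oo[) (f t)%:E <= C)%E.
Proof.
move=> cf f0 hC; have h := integral_halfline_cvg cf f0.
rewrite -(cvg_lim _ h)//; apply: lime_le; first by apply/cvg_ex; eexists; exact: h.
exact: nearW.
Qed.

Lemma Rintegral_le_halfline f (t : R) : hcont f -> (forall t : R, 0 <= t -> 0 <= f t) ->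
  ((Rintegral mu `[0, t] f)%:E <= \int[mu]_(t in `[0%R, +oo[) (f t)%:E)%E.
Proof.
move=> cf f0; rewrite /Rintegral fineK; last first.
  exact: integrable_fin_num (hcont_integrable _ cf).
apply: ge0_subset_integral => //.
- by apply/measurable_EFinP; exact: hcont_measurable.
- by move=> x /=; rewrite in_itv/= andbT lee_fin => /f0.
- by move=> x /=; rewrite !in_itv/= andbT => /andP[].
Qed.

Lemma hcont_Rintegral_ge0 f (t : R) : hcont f -> (forall t : R, 0 <= t -> 0 <= f t) ->
  0 <= Rintegral mu `[0, t] f.
Proof.
by move=> cf f0; apply: Rintegral_ge0 => x /=; rewrite in_itv/= => /andP[/f0].
Qed.

Lemma hcont_RintegralD f g (t : R) : hcont f -> hcont g ->
  Rintegral mu `[0, t] (fun s => f s + g s) = Rintegral mu `[0, t] f + Rintegral mu `[0, t] g.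
Proof. by move=> cf cg; rewrite RintegralD//; exact: hcont_integrable. Qed.

Lemma hcont_RintegralZ f a (t : R) : hcont f ->
  Rintegral mu `[0, t] (fun s => a * f s) = a * Rintegral mu `[0, t] f.
Proof. by move=> cf; rewrite RintegralZl//; exact: hcont_integrable. Qed.

End HalfLine.
Arguments hcont_cst {R} a _ _ _ : rename.
Arguments hcont_expR {R} a _ _ _ : rename.

(** * Vector-valued functions, linear equations and discounted energy *)

Section VectorCalculus.
Context {R : realType}.
Local Notation mu := (@lebesgue_measure R).

Lemma is_derive_mxP n (g : R -> 'cV[R]_n) (t : R) v :
  is_derive t (1 : R) g v <-> forall i, is_derive t (1 : R) (fun s => g s i 0) (v i 0).
Proof.
split => [[dg gv] i|h].
  have /derivable_mxP dgi := dg.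
  split; first exact: dgi.
  by rewrite -gv derive_mx// mxE.
have dg : derivable g t 1.
  by apply/derivable_mxP => i j; rewrite ord1; case: (h i).
split => //; rewrite derive_mx//; apply/colP => i; rewrite mxE.
by case: (h i).
Qed.

Lemma continuous_mxP n (g : R -> 'cV[R]_n) (t : R) :
  {for t, continuous g} <-> forall i, {for t, continuous (fun s => g s i 0)}.
Proof.
split=> [cg i|cg].
  exact: (continuous_comp cg (@coord_continuous _ _ _ i 0 (g t))).
apply/cvgrPdist_le => /= e e0; near=> x.
rewrite [leLHS]/Num.Def.normr/= mx_normrE (bigmax_le _ (ltW e0))//= => -[i j] _.
rewrite ord1 !mxE /=; move: i {j}; near: x; apply: filter_forall => i.
exact: ((cvgrPdist_le _ _).1 (cg i)).
Unshelve. all: by end_near. Qed.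

Lemma hcont_mxP n (g : R -> 'cV[R]_n) :
  hcont g <-> forall i, hcont (fun s => g s i 0).
Proof.
split=> [/hcont_ext cg i|cg].
  by apply: hcont_of_ext => t; exact: (continuous_mxP _ _).1 (cg t) i.
by apply: hcont_of_ext => t; apply/continuous_mxP => i; exact: hcont_ext (cg i) t.
Qed.

Lemma hcont_sum_ord (n : nat) (F : 'I_n -> R -> R) :
  (forall i, hcont (F i)) -> hcont (fun t => \sum_i F i t).
Proof. exact: hcont_sum. Qed.

Lemma hcontvD n (x y : R -> 'cV[R]_n) : hcont x -> hcont y -> hcont (fun t => x t + y t).
Proof.
move=> /hcont_mxP cx /hcont_mxP cy; apply/hcont_mxP => i.
by apply: (hcont_eq _ (hcontD (cx i) (cy i))) => t _; rewrite mxE.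
Qed.

Lemma hcont_mulmx m n (M : 'M[R]_(m, n)) (x : R -> 'cV[R]_n) :
  hcont x -> hcont (fun t => M *m x t).
Proof.
move=> /hcont_mxP cx; apply/hcont_mxP => i.
have h := hcont_sum_ord (fun j => hcontM (hcont_cst (M i j)) (cx j)).
apply: (hcont_eq _ h) => t _.
by rewrite mxE.
Qed.

Lemma hcontvN n (x : R -> 'cV[R]_n) : hcont x -> hcont (fun t => - x t).
Proof.
move=> /hcont_mxP cx; apply/hcont_mxP => i.
by apply: (hcont_eq _ (hcontN (cx i))) => t _; rewrite mxE.
Qed.

Lemma hcontvB n (x y : R -> 'cV[R]_n) : hcont x -> hcont y -> hcont (fun t => x t - y t).
Proof. by move=> cx cy; apply: hcontvD => //; exact: hcontvN. Qed.

Lemma hcont_dotv n (x y : R -> 'cV[R]_n) : hcont x -> hcont y ->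
  hcont (fun t => dotv (x t) (y t)).
Proof.
move=> /hcont_mxP cx /hcont_mxP cy.
by apply: (hcont_eq _ (hcont_sum_ord (fun j => hcontM (cx j) (cy j)))) => t _; rewrite dotvE.
Qed.

Lemma is_derive_sumE (n : nat) (h : 'I_n -> R -> R) (dh : 'I_n -> R) (t : R) :
  (forall i, is_derive t (1 : R) (h i) (dh i)) ->
  is_derive t (1 : R) (fun s => \sum_i h i s) (\sum_i dh i).
Proof.
move=> dhi; have := is_derive_sum dhi.
by congr (is_derive _ _ _ _); apply/funext => s; rewrite fct_sumE.
Qed.

Lemma is_derive_mulE (f g : R -> R) (t df dg : R) :
  is_derive t (1 : R) f df -> is_derive t (1 : R) g dg ->
  is_derive t (1 : R) (fun s => f s * g s) (df * g t + f t * dg).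
Proof.
move=> hf hg; have := is_deriveM hf hg => h.
by apply: is_derive_eq h _; rewrite addrC mulrC.
Qed.

Lemma is_derive_dotv n (x y : R -> 'cV[R]_n) (t : R) dx dy :
  is_derive t (1 : R) x dx -> is_derive t (1 : R) y dy ->
  is_derive t (1 : R) (fun s => dotv (x s) (y s)) (dotv dx (y t) + dotv (x t) dy).
Proof.
move=> /is_derive_mxP hx /is_derive_mxP hy.
have := is_derive_sumE (fun i => is_derive_mulE (hx i) (hy i)).
have -> : (fun s => dotv (x s) (y s)) = (fun s => \sum_i x s i 0 * y s i 0).
  by apply/funext => s; rewrite dotvE.
by move=> h; apply: is_derive_eq h _; rewrite big_split !dotvE.
Qed.

Lemma is_derive_mulmx m n (M : 'M[R]_(m, n)) (x : R -> 'cV[R]_n) (t : R) dx :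
  is_derive t (1 : R) x dx -> is_derive t (1 : R) (fun s => M *m x s) (M *m dx).
Proof.
move=> /is_derive_mxP hx; apply/is_derive_mxP => i.
have := is_derive_sumE (fun j => is_derive_mulE (is_derive_cst (M i j) t 1) (hx j)).
have -> : (fun s => (M *m x s) i 0) = (fun s => \sum_j M i j * x s j 0).
  by apply/funext => s; rewrite mxE.
move=> h; apply: is_derive_eq h _; rewrite mxE; apply: eq_bigr => j _.
by rewrite mul0r add0r.
Qed.

Lemma is_derive_expR_lin (a t : R) :
  is_derive t (1 : R) (fun s => expR (- (a * s))) (- a * expR (- (a * t))).
Proof.
have h1 : is_derive t (1 : R) (fun s => - (a * s)) (- a).
  have h := is_deriveN (is_derive_mulE (is_derive_cst a t 1) (is_derive_id t (1 : R))).
  by apply: is_derive_eq h _; rewrite mul0r add0r mulr1.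
have := @is_derive1_comp R expR (fun s => - (a * s)) t _ _ (is_derive_expR _) h1.
by move=> h; apply: is_derive_eq h _; rewrite mulrC.
Qed.

Lemma is_derive_disc n (rho : R) (x y : R -> 'cV[R]_n) (t : R) dx dy :
  is_derive t (1 : R) x dx -> is_derive t (1 : R) y dy ->
  is_derive t (1 : R) (fun s => expR (- (rho * s)) * dotv (x s) (y s))
    (expR (- (rho * t)) * (dotv dx (y t) + dotv (x t) dy - rho * dotv (x t) (y t))).
Proof.
move=> hx hy.
have h := is_derive_mulE (is_derive_expR_lin rho t) (is_derive_dotv hx hy).
by apply: is_derive_eq h _; ring.
Qed.

Lemma hcont_limit0 (F : R -> R) (a : R) : hcont F ->
  (forall t : R, 0 < t -> F t = a) -> F 0 = a.
Proof.
move=> /hcont_ext /(_ 0) cF Fa; apply/eqP; rewrite -subr_eq0; apply: contraT.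
rewrite -normr_gt0 => e0.
move/cvgrPdist_lt : cF => /(_ _ e0) [d /= d0] /(_ (d / 2)).
rewrite /= sub0r normrN gtr0_norm ?divr_gt0// ltr_pdivrMr// ltr_pMr// ltr1n.
by move=> /(_ isT); rewrite maxxx max_r ?divr_ge0 ?(ltW d0)// (Fa (d / 2)) ?ltxx// divr_gt0.
Qed.

(** Gronwall: 2 y.Ay <= (1 + C) |y|^2, so e^(-(1 + C) t) |y|^2 is nonincreasing. *)
Lemma linear_ode_zero n (A : 'M[R]_n) (y : R -> 'cV[R]_n) : hcont y ->
  (forall t : R, 0 < t -> is_derive t (1 : R) y (A *m y t)) -> y 0 = 0 ->
  forall t : R, 0 <= t -> y t = 0.
Proof.
move=> cy dy y0 t t0.
have [C C0 hC] := sqnorm_mul_le A.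
pose F s := expR (- ((1 + C) * s)) * dotv (y s) (y s).
have cF : hcont F by apply: hcontM (hcont_expR _) (hcont_dotv cy cy).
have : F t <= F 0.
  apply: (hcont_nonincreasing cF (fun s s0 => is_derive_disc (1 + C) (dy s s0) (dy s s0))) => // s s0.
  rewrite pmulr_rle0 ?expR_gt0//.
  have := dotv_young (y s) (A *m y s) (@ltr01 R); rewrite invr1 !mul1r -sqnorm_dotv.
  rewrite (dotvC (A *m _)); have := hC (y s); have := ler_norm (dotv (y s) (A *m y s)); lra.
rewrite /F y0 dotv0r mulr0 pmulr_rle0 ?expR_gt0// -sqnorm_dotv => h.
by apply: sqnorm_eq0; apply/le_anti; rewrite h sqnorm_ge0.
Qed.

Section Discounted.
Variables (rho : R).

(** Finiteness of [discounted_energy], encoded as a bound uniform over finite horizons so that all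
    estimates remain inequalities between reals. The horizon 0 yields 0 <= C. *)
Definition energy_le n (x : R -> 'cV[R]_n) (C : R) : Prop :=
  forall T : R, Rintegral mu `[0, T] (fun t => expR (- (rho * t)) * sqnorm (x t)) <= C.

Lemma hcont_energy n (x : R -> 'cV[R]_n) : hcont x ->
  hcont (fun t => expR (- (rho * t)) * sqnorm (x t)).
Proof. by move=> cx; apply: hcontM (hcont_expR _) (hcont_dotv cx cx). Qed.

Lemma energy_fun_ge0 n (x : R -> 'cV[R]_n) t : 0 <= expR (- (rho * t)) * sqnorm (x t).
Proof. by rewrite mulr_ge0 ?expR_ge0 ?sqnorm_ge0. Qed.

Lemma Crho2_energy n (x : R -> 'cV[R]_n) : Crho2 rho x -> exists C, energy_le x C.
Proof.
move=> [cx fx]; exists (fine (discounted_energy rho x)) => T.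
have := @Rintegral_le_halfline R _ T (hcont_energy cx) (fun t _ => energy_fun_ge0 x t).
rewrite -/(discounted_energy rho x) -[X in (_ <= X)%E]fineK ?lee_fin//.
by rewrite ge0_fin_numE//; apply: integral_ge0 => t _; rewrite lee_fin energy_fun_ge0.
Qed.

Lemma hcont_Rintegral_le (f g : R -> R) (T : R) : hcont f -> hcont g ->
  (forall t : R, 0 <= t -> f t <= g t) ->
  Rintegral mu `[0, T] f <= Rintegral mu `[0, T] g.
Proof.
move=> cf cg fg; apply: le_Rintegral => //; try exact: hcont_integrable.
by move=> t; rewrite /= in_itv/= => /andP[/fg].
Qed.

Lemma energy_leD n (x y : R -> 'cV[R]_n) C D : hcont x -> hcont y ->
  energy_le x C -> energy_le y D -> energy_le (fun t => x t + y t) (2 * C + 2 * D).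
Proof.
move=> cx cy hC hD T; have ex := hcont_energy cx; have ey := hcont_energy cy.
apply: (@le_trans _ _ (Rintegral mu `[0, T] (fun t =>
   2 * (expR (- (rho * t)) * sqnorm (x t)) + 2 * (expR (- (rho * t)) * sqnorm (y t))))).
  apply: hcont_Rintegral_le; first exact/hcont_energy/hcontvD.
    by apply: hcontD; apply: hcontM => //; exact: hcont_cst.
  move=> t _; have := ler_wpM2l (expR_ge0 (- (rho * t))) (sqnormD_le (x t) (y t)); lra.
rewrite hcont_RintegralD; try (apply: hcontM => //; exact: hcont_cst).
by rewrite !hcont_RintegralZ// lerD// ler_wpM2l.
Qed.

Lemma energy_leB n (x y : R -> 'cV[R]_n) C D : hcont x -> hcont y ->
  energy_le x C -> energy_le y D -> energy_le (fun t => x t - y t) (2 * C + 2 * D).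
Proof.
move=> cx cy hC hD; apply: (energy_leD cx (hcontvN cy) hC) => T.
by have := hD T; under [in X in _ -> X]eq_Rintegral do rewrite sqnormN.
Qed.

Lemma energy_le_mulmx m n (M : 'M[R]_(m, n)) (x : R -> 'cV[R]_n) C : hcont x ->
  energy_le x C -> exists D, energy_le (fun t => M *m x t) D.
Proof.
move=> cx hC; have [K K0 hK] := sqnorm_mul_le M; exists (K * C) => T.
have ex := hcont_energy cx.
apply: (@le_trans _ _ (K * Rintegral mu `[0, T] (fun t => expR (- (rho * t)) * sqnorm (x t)))).
  rewrite -hcont_RintegralZ//; apply: hcont_Rintegral_le.
  - exact/hcont_energy/hcont_mulmx.
  - by apply: hcontM => //; exact: hcont_cst.
  - by move=> t _; rewrite mulrCA ler_wpM2l ?expR_ge0.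
by rewrite ler_wpM2l// ltW.
Qed.

(* A nonincreasing function vanishing at 0 and integrable on the half-line is 0. *)
Lemma dissipation_zero n (x l : R -> 'cV[R]_n) (v : R -> R) C D :
  hcont x -> hcont l -> x 0 = 0 -> energy_le x C -> energy_le l D ->
  (forall t : R, 0 < t -> v t <= 0) ->
  (forall t : R, 0 < t -> is_derive t (1 : R)
    (fun s => expR (- (rho * s)) * dotv (x s) (l s)) (v t)) ->
  forall t : R, 0 <= t -> dotv (x t) (l t) = 0.
Proof.
move=> cx cl x0 hC hD v0 dv.
pose F s := expR (- (rho * s)) * dotv (x s) (l s).
have cF : hcont F by apply: hcontM (hcont_expR _) (hcont_dotv cx cl).
have mF := hcont_nonincreasing cF dv v0.
have F0 : F 0 = 0 by rewrite /F x0 dotvC dotv0r mulr0.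
suff FE t : 0 <= t -> F t = 0.
  move=> t t0; have /eqP := FE t t0; rewrite /F mulf_eq0 => /orP[|/eqP//].
  by rewrite gt_eqF ?expR_gt0.
move=> t0; apply/eqP; rewrite eq_le -{1}F0 mF//=; apply: contraT; rewrite -ltNge => Ft.
pose J s := Rintegral mu `[0, s] F.
(* By Young's inequality F is bounded below by minus the sum of the two energy densities. *)
have JB s : - (C + D) <= J s.
  have ex := hcont_energy cx; have el := hcont_energy cl.
  have : 0 <= Rintegral mu `[0, s] (fun t => F t +
      (expR (- (rho * t)) * sqnorm (x t) + expR (- (rho * t)) * sqnorm (l t))).
    apply: hcont_Rintegral_ge0; first by apply: hcontD => //; exact: hcontD.
    move=> r _; rewrite /F -!mulrDr mulr_ge0 ?expR_ge0//.
    have := dotv_young (x r) (l r) (@ltr01 R); rewrite invr1 !mul1r.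
    have := sqnorm_ge0 (x r); have := sqnorm_ge0 (l r).
    have := ler_norm (- dotv (x r) (l r)); rewrite normrN; lra.
  rewrite hcont_RintegralD//; last exact: hcontD.
  rewrite hcont_RintegralD// -/(J s) => h.
  have := hC s; have := hD s; lra.
(* From t on F stays below F t < 0, so J has dropped by at least C + D + |J t| + 1 at this time,
   below the bound [JB]. *)
pose T := t + (C + D + `|J t| + 1) / (- F t).
have c0 : 0 < - F t by rewrite oppr_gt0.
have CD0 : 0 <= C + D.
  have := JB 0; rewrite /J Rintegral00; lra.
have tT : t < T by rewrite ltrDl divr_gt0//; have := normr_ge0 (J t); lra.
have [||c] := @MVT _ J F t T tT.
- move=> r; rewrite in_itv/= => /andP[tr _]; apply: is_derive_int => //.
  exact: le_lt_trans tr.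
- by apply: hcont_seg => //; exact: hcont_int.
rewrite in_itv/= => /andP[tc _] JE.
have Fc : F c <= F t by apply: mF => //; exact: ltW.
have : J T - J t <= F t * (T - t) by rewrite JE ler_wpM2r// subr_ge0 ltW.
have -> : F t * (T - t) = - (C + D + `|J t| + 1).
  by rewrite /T; field; rewrite lt_eqF.
have := JB T; have := ler_norm (J t); lra.
Qed.

End Discounted.
End VectorCalculus.

(** * The two control laws agree *)

Section Representation.
Context {R : realType}.

Lemma trmxD n (X Y : 'M[R]_n) : (X + Y)^T = X^T + Y^T.
Proof. exact: linearD. Qed.

Lemma trmxB n (X Y : 'M[R]_n) : (X - Y)^T = X^T - Y^T.
Proof. exact: linearB. Qed.

Lemma Q_Gamma_hat n (Gam Q : 'M[R]_n) :
  (1%:M - Gam)^T *m Q *m (1%:M - Gam) = Q - Q_Gamma Gam Q.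
Proof.
have -> : (1%:M - Gam)^T = 1%:M - Gam^T by rewrite linearB /= trmx1.
rewrite /Q_Gamma mulmxBl mul1mx mulmxBr mulmx1 mulmxBl.
move: (Gam^T *m Q *m Gam) (Gam^T *m Q) (Q *m Gam) => a b c.
by apply/matrixP => i j; rewrite !mxE; ring.
Qed.

Lemma Q_Gamma_sym n (Gam Q : 'M[R]_n) : Q^T = Q -> (Q_Gamma Gam Q)^T = Q_Gamma Gam Q.
Proof.
move=> Qs; rewrite /Q_Gamma trmxB trmxD !trmx_mul !trmxK Qs mulmxA.
by rewrite (addrC (Q *m Gam)).
Qed.

(** The quadratic term K S K^T is symmetric whether or not K is, so it cancels between the equation
    and its transpose; what remains is linear in K - K^T. *)
Lemma kbar_sym n r (rho : R) (A P Q Gam Kbar : 'M[R]_n) (B : 'M[R]_(n, r))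
    (Rw : 'M[R]_r) : pd Rw -> Q^T = Q ->
  hurwitz (A_bar A B Rw P - (rho / 2)%:M) ->
  rho *: Kbar = Kbar *m A_bar A B Rw P + (A_bar A B Rw P)^T *m Kbar
     - Kbar *m B *m invmx Rw *m B^T *m Kbar^T - Q_Gamma Gam Q ->
  Kbar^T = Kbar.
Proof.
move=> hRw Qs hH hK; set Ab := A_bar A B Rw P in hH hK.
apply/esym/eqP; rewrite -subr_eq0; apply/eqP.
apply: (hurwitz_sylvester hH).
set S := B *m invmx Rw *m B^T.
have Ss : S^T = S := gram_sym B hRw.
have {}hK : rho *: Kbar = Kbar *m Ab + Ab^T *m Kbar - Kbar *m S *m Kbar^T - Q_Gamma Gam Q.
  by rewrite hK /S !mulmxA.
clearbody S Ab.
have hKt : rho *: Kbar^T = Ab^T *m Kbar^T + Kbar^T *m Ab - Kbar *m S *m Kbar^T - Q_Gamma Gam Q.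
  have := congr1 trmx hK; rewrite linearZ /= => ->.
  by rewrite 2!trmxB trmxD !trmx_mul !trmxK Ss Q_Gamma_sym// mulmxA.
have : rho *: (Kbar - Kbar^T) = (Kbar - Kbar^T) *m Ab + Ab^T *m (Kbar - Kbar^T).
  rewrite scalerBr hK hKt mulmxBl mulmxBr.
  move: (Kbar *m Ab) (Ab^T *m Kbar) (Kbar *m S *m Kbar^T) (Ab^T *m Kbar^T)
    (Kbar^T *m Ab) (Q_Gamma Gam Q) => a b c d e g.
  by apply/matrixP => i j; rewrite !mxE; ring.
move: (Kbar - Kbar^T) => D hD.
(* The two shifts by rho / 2 in the Sylvester operator add up to the discount rho. *)
rewrite mulmxBr trmxB tr_scalar_mx mulmxBl mul_scalar_mx mul_mx_scalar.
have -> : forall a b c : 'M[R]_n, a - c + (b - c) = (a + b) - (c + c).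
  by move=> a b c; rewrite opprD addrACA.
rewrite -hD -scalerDl -splitr subrr //.
Qed.

(** If Pm solves the Riccati equation and q the matching offset equation, the derivative of the
    costate Pm x + q no longer shows Pm except through the costate. This makes the adjoint equation
    identical for [Pi], s and for [P + Kbar], phi. *)
Lemma costate_rhs n (rho : R) (A S Pm Qh : 'M[R]_n) (x q h : 'cV[R]_n) :
  Pm^T = Pm -> S^T = S -> rho *: Pm = A^T *m Pm + Pm *m A - Pm *m S *m Pm + Qh ->
  Pm *m (A *m x - S *m (Pm *m x + q)) + (rho *: q - (A - S *m Pm)^T *m q + h) =
  rho *: (Pm *m x + q) - A^T *m (Pm *m x + q) - Qh *m x + h.
Proof.
move=> Ps Ss hP; rewrite scalerDr scalemxAl hP.
rewrite trmxB trmx_mul Ps Ss !mulmxDl !mulmxDr !mulNmx !mulmxN !mulmxDr !mulmxA.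
by apply/colP => i; rewrite !mxE; ring.
Qed.

Lemma hamiltonian_unique n (rho : R) (A S Qh : 'M[R]_n) (x l : R -> 'cV[R]_n) C D :
  (forall z, 0 <= dotv z (S *m z)) -> (forall z, dotv z (S *m z) = 0 -> S *m z = 0) ->
  (forall z, 0 <= dotv z (Qh *m z)) ->
  hcont x -> hcont l -> energy_le rho x C -> energy_le rho l D -> x 0 = 0 ->
  (forall t : R, 0 < t -> is_derive t (1 : R) x (A *m x t - S *m l t)) ->
  (forall t : R, 0 < t -> is_derive t (1 : R) l
     (rho *: l t - A^T *m l t - Qh *m x t)) ->
  forall t : R, 0 <= t -> x t = 0 /\ dotv (l t) (S *m l t) = 0.
Proof.
move=> S0 Sz Qh0 cx cl hC hD x0 dx dl.
pose v t := - expR (- (rho * t)) * (dotv (l t) (S *m l t) + dotv (x t) (Qh *m x t)).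
have dv (t : R) : 0 < t -> is_derive t (1 : R)
    (fun s => expR (- (rho * s)) * dotv (x s) (l s)) (v t).
  move=> t0; apply: is_derive_eq (is_derive_disc rho (dx t t0) (dl t t0)) _.
  rewrite /v !dotv_lin (dotv_trl A^T) trmxK (dotvC (S *m _)); ring.
have Sl0 t : 0 <= dotv (l t) (S *m l t) := S0 (l t).
have v0 (t : R) : 0 < t -> v t <= 0.
  by move=> _; rewrite /v mulNr oppr_le0 mulr_ge0 ?expR_ge0// addr_ge0.
have xl0 := dissipation_zero cx cl x0 hC hD v0 dv.
(* The discounted product is zero on a neighbourhood of t, hence so is its derivative, which is
   minus a sum of two nonnegative terms. *)
have v0' (t : R) : 0 < t -> v t = 0.
  move=> t0; have [_ <-] := dv t t0.
  rewrite (@near_eq_derive _ _ _ _ (cst 0)) ?derive_cst//.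
  have : \forall s \near t, s \in `]0, +oo[%R by apply: near_in_itvoy; rewrite in_itv/= andbT.
  by apply: filterS => s; rewrite in_itv/= andbT => s0; rewrite xl0 ?mulr0// ltW.
have Slz (t : R) : 0 < t -> dotv (l t) (S *m l t) = 0.
  move=> t0; have /eqP := v0' t t0; rewrite /v mulNr oppr_eq0 mulf_eq0 => /orP[|].
    by rewrite gt_eqF ?expR_gt0.
  by rewrite paddr_eq0 ?Sl0// => /andP[/eqP].
(* The value at 0 is reached by continuity, the equations being given at t > 0. *)
have Sl t : 0 <= t -> dotv (l t) (S *m l t) = 0.
  rewrite le_eqVlt => /predU1P[<-|/Slz//].
  apply: (@hcont_limit0 _ (fun t => dotv (l t) (S *m l t))) => //.
  by apply: hcont_dotv => //; exact: hcont_mulmx.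
move=> t t0; split; last exact: Sl.
apply: (linear_ode_zero cx _ x0 t0) => s s0.
by apply: is_derive_eq (dx s s0) _; rewrite (Sz _ (Sl _ (ltW s0))) subr0.
Qed.

Lemma psd_congr n (Gam Q : 'M[R]_n) : psd Q ->
  psd ((1%:M - Gam)^T *m Q *m (1%:M - Gam)).
Proof.
move=> [Qs Q0]; split; first by rewrite !trmx_mul trmxK Qs mulmxA.
move=> z; have := Q0 ((1%:M - Gam) *m z).
by rewrite !qform_dotv -!mulmxA (dotv_trl (1%:M - Gam)^T) trmxK.
Qed.

Lemma laws_agree n r (rho : R) (A Gam Q : 'M[R]_n) (B : 'M[R]_(n, r)) (Rw : 'M[R]_r)
  (eta : 'cV[R]_n) (sqrtQ P Pi Kbar : 'M[R]_n) (s xbar xdag phi : R -> 'cV[R]_n) :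
  pd Rw -> psd Q -> is_psd_sqrt Q sqrtQ ->
  detectable (A - (rho / 2)%:M) sqrtQ -> psd P ->
  rho *: P = A^T *m P + P *m A - P *m B *m invmx Rw *m B^T *m P + Q ->
  psd Pi ->
  rho *: Pi = A^T *m Pi + Pi *m A - Pi *m B *m invmx Rw *m B^T *m Pi
     + (1%:M - Gam)^T *m Q *m (1%:M - Gam) ->
  Crho2 rho s ->
  solves_ode s (fun t => rho *: s t - (A - B *m invmx Rw *m B^T *m Pi)^T *m s t
     + eta_bar Gam Q eta) ->
  Crho2 rho xbar ->
  solves_ode xbar (fun t =>
     A *m xbar t - B *m invmx Rw *m B^T *m (Pi *m xbar t + s t)) ->
  rho *: Kbar = Kbar *m A_bar A B Rw P + (A_bar A B Rw P)^T *m Kbar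
     - Kbar *m B *m invmx Rw *m B^T *m Kbar^T - Q_Gamma Gam Q ->
  Crho2 rho xdag ->
  solves_ode xdag (fun t => A_bar A B Rw P *m xdag t
     - B *m invmx Rw *m B^T *m (Kbar *m xdag t + phi t)) ->
  xbar 0 = xdag 0 ->
  Crho2 rho phi ->
  solves_ode phi (fun t =>
     - (((A - B *m invmx Rw *m B^T *m (P + Kbar))^T - rho%:M) *m phi t)
     + eta_bar Gam Q eta) ->
  forall t : R, 0 <= t -> invmx Rw *m B^T *m ((Pi - P) *m xbar t + s t) =
    invmx Rw *m B^T *m (Kbar *m xdag t + phi t).
Proof.
move=> hRw hQ hsq hdet hPp hP hPip hPi hs [cs ds] hx [cx dx] hK hxd [cxd dxd] x00 hp [cp dp] t t0.
have hH := riccati_hurwitz hRw hPp hQ hsq hdet hP.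
have Ks := kbar_sym hRw hQ.1 hH hK.
have Ps := hPp.1; have Pis := hPip.1.
set S := B *m invmx Rw *m B^T in ds dx dxd dp.
have Ss : S^T = S := gram_sym B hRw.
set Qh := (1%:M - Gam)^T *m Q *m (1%:M - Gam) in hPi.
have [Qhs Qh0] : psd Qh := psd_congr Gam hQ.
pose Pb := P + Kbar.
have Pbs : Pb^T = Pb by rewrite /Pb trmxD Ps Ks.
have hP' : rho *: P = A^T *m P + P *m A - P *m S *m P + Q by rewrite hP /S !mulmxA.
have hK' : rho *: Kbar = Kbar *m (A - S *m P) + (A - S *m P)^T *m Kbar
     - Kbar *m S *m Kbar - Q_Gamma Gam Q.
  by rewrite hK /A_bar Ks /S !mulmxA.
have hPi' : rho *: Pi = A^T *m Pi + Pi *m A - Pi *m S *m Pi + Qh by rewrite hPi /S !mulmxA.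
have AbE : A_bar A B Rw P = A - S *m P by [].
have S0 z : 0 <= dotv z (S *m z) := gram_ge0 B hRw z.
have SzB z : dotv z (S *m z) = 0 -> invmx Rw *m B^T *m z = 0 := @gram_eq0 _ _ _ B Rw hRw z.
have Sz z : dotv z (S *m z) = 0 -> S *m z = 0.
  by move=> /SzB h; rewrite /S -!mulmxA (mulmxA (invmx Rw)) h mulmx0.
rewrite AbE in dxd.
move: (A_bar A B Rw P) AbE hK hH => Ab AbE _ _.
(* [S] becomes an atom for the matrix expansions below; [SzB] keeps its link with the gain R^-1 B^T
   of the goal. *)
clearbody S; move: (B) (Rw) => B' Rw' in SzB *.
(* Sum of the equations of [P] and [Kbar]: the cross terms hidden in [A_bar] complete the square Pb
   S Pb, and Q - [Q_Gamma] is Qh. *)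
have hPb : rho *: Pb = A^T *m Pb + Pb *m A - Pb *m S *m Pb + Qh.
  have PSt : (A - S *m P)^T = A^T - P *m S by rewrite trmxB trmx_mul Ps Ss.
  rewrite /Pb scalerDr hP' hK' PSt /Qh Q_Gamma_hat.
  rewrite ?(mulmxDl, mulmxDr, mulNmx, mulmxN, mulmxA).
  by apply/matrixP => i j; rewrite !mxE; ring.
pose x t := xbar t - xdag t.
pose l t := (Pi *m xbar t + s t) - (Pb *m xdag t + phi t).
have cPx : hcont (fun t => Pi *m xbar t) by exact: hcont_mulmx.
have cPd : hcont (fun t => - (Pb *m xdag t)) by exact/hcontvN/hcont_mulmx.
have cx' : hcont x by exact: hcontvB.
have cl : hcont l by apply: hcontvB; apply: hcontvD => //; exact: hcont_mulmx.
have [C hC] : exists C, energy_le rho x C.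
  have [C1 h1] := Crho2_energy hx; have [C2 h2] := Crho2_energy hxd.
  exists (2 * C1 + 2 * C2); exact: energy_leB.
have [D hD] : exists D, energy_le rho l D.
  have [C1 h1] := Crho2_energy hx; have [C2 h2] := Crho2_energy hxd.
  have [C3 h3] := Crho2_energy hs; have [C4 h4] := Crho2_energy hp.
  have [D1 k1] := energy_le_mulmx Pi cx h1.
  have [D2 k2] := energy_le_mulmx Pb cxd h2.
  have cPd' : hcont (fun t => Pb *m xdag t) by exact: hcont_mulmx.
  eexists; apply: energy_leB (energy_leD cPx cs k1 h3) (energy_leD cPd' cp k2 h4).
    exact: hcontvD.
  exact: hcontvD.
have dx' (u : R) : 0 < u -> is_derive u (1 : R) x (A *m x u - S *m l u).
  move=> u0; apply: is_derive_eq (is_deriveB (dx u u0) (dxd u u0)) _.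
  rewrite /x /l /Pb ?(mulNmx, mulmxN, mulmxBl, mulmxBr, mulmxDl, mulmxDr, mulmxA).
  by apply/matrixP => i j; rewrite !mxE; ring.
have dl (u : R) : 0 < u -> is_derive u (1 : R) l (rho *: l u - A^T *m l u - Qh *m x u).
  move=> u0.
  have d1 := is_deriveD (is_derive_mulmx Pi (dx u u0)) (ds u u0).
  have d2 := is_deriveD (is_derive_mulmx Pb (dxd u u0)) (dp u u0).
  apply: is_derive_eq (is_deriveB d1 d2) _.
  rewrite (costate_rhs _ _ _ Pis Ss hPi').
  have -> : (A - S *m P) *m xdag u - S *m (Kbar *m xdag u + phi u) =
     A *m xdag u - S *m (Pb *m xdag u + phi u).
    rewrite /Pb ?(mulNmx, mulmxN, mulmxBl, mulmxBr, mulmxDl, mulmxDr, mulmxA).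
    by apply/matrixP => i j; rewrite !mxE; ring.
  have -> : - (((A - S *m (P + Kbar))^T - rho%:M) *m phi u) + eta_bar Gam Q eta =
      rho *: phi u - (A - S *m Pb)^T *m phi u + eta_bar Gam Q eta.
    by rewrite mulmxBl mul_scalar_mx opprB.
  rewrite (costate_rhs _ _ _ Pbs Ss hPb) /l /x.
  rewrite scalerBr !mulmxBr.
  by apply/matrixP => i j; rewrite !mxE; ring.
have x0 : x 0 = 0 by rewrite /x x00 subrr.
have Qh0' z : 0 <= dotv z (Qh *m z) by rewrite -qform_dotv.
have [xt /SzB lt] := hamiltonian_unique S0 Sz Qh0' cx' cl hC hD x0 dx' dl t0.
(* Since xbar = xdag, the difference of the two offsets is the costate difference l, the term in P
   cancelling. *)
apply/eqP; rewrite -subr_eq0 -mulmxBr; apply/eqP; rewrite -[RHS]lt; congr (_ *m _).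
have -> : xdag t = xbar t by apply/esym/eqP; rewrite -subr_eq0; apply/eqP.
rewrite /l /Pb.
have -> : xdag t = xbar t by apply/esym/eqP; rewrite -subr_eq0; apply/eqP.
rewrite !mulmxDl mulNmx.
by apply/matrixP => i j; rewrite !mxE; ring.
Qed.

End Representation.

(** * The matrix exponential *)

Section MatrixExponential.
Context {R : realType}.
Local Notation mu := (@lebesgue_measure R).
Variable n : nat.
Implicit Types A : 'M[R]_n.

(** Entry (i, j) of the power series of the m-th derivative of exp(t A). Working entrywise gives
    access to scalar power series, and differentiation only raises m. *)
Definition expmx_coef A (m : nat) (i j : 'I_n) (k : nat) : R :=
  (A ^+ (k + m)) i j / k`!%:R.

Definition expmx A (t : R) : 'M[R]_n :=
  \matrix_(i, j) limn (pseries (expmx_coef A 0 i j) t).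

Lemma expmx_coef_bound A :
  exists2 a : R, 0 < a & forall k i j, `|(A ^+ k) i j| <= a ^+ k.
Proof.
exists (1 + \sum_i \sum_j `|A i j|).
  by rewrite ltr_pwDl// sumr_ge0// => i _; rewrite sumr_ge0.
set a := 1 + _.
elim=> [|k IH] i j.
  by rewrite !expr0 mxE; case: (i == j); rewrite ?normr1 ?normr0.
rewrite !exprS mxE (le_trans (ler_norm_sum _ _ _))//.
apply: (@le_trans _ _ (\sum_l `|A i l| * a ^+ k)).
  by apply: ler_sum => l _; rewrite normrM ler_wpM2l.
rewrite -mulr_suml ler_wpM2r//.
  by rewrite exprn_ge0// addr_ge0// sumr_ge0// => *; rewrite sumr_ge0.
rewrite /a ler_wpDl// [leRHS](bigD1 i)//= lerDl sumr_ge0// => *; rewrite sumr_ge0//.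
Qed.

(** Domination by a^m times the exponential series at a |t|. *)
Lemma is_cvg_expmx A m i j t : cvgn (pseries (expmx_coef A m i j) t).
Proof.
have [a a0 ha] := expmx_coef_bound A.
apply: normed_cvg; apply: (@series_le_cvg _ _ (fun k => a ^+ m * exp_coeff (a * `|t|) k)).
- by move=> k; rewrite /normed_series_of /=.
- by move=> k; rewrite mulr_ge0 ?exprn_ge0 ?(ltW a0)// exp_coeff_ge0// mulr_ge0// ltW.
- move=> k; rewrite /expmx_coef /exp_coeff /= !normrM normrX normfV.
  rewrite (@ger0_norm _ k`!%:R)// exprMn mulrAC [leRHS]mulrA ler_wpM2r ?invr_ge0//.
  by rewrite mulrA ler_wpM2r ?exprn_ge0// -exprD addnC (le_trans (ha _ _ _)).
- have := @is_cvg_seriesZ _ _ (a ^+ m) (is_cvg_series_exp_coeff (a * `|t|)).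
  by congr (cvgn (series _)); apply/funext.
Qed.

Arguments is_cvg_expmx : clear implicits.

Lemma expmx_coef_diffs A m i j :
  pseries_diffs (expmx_coef A m i j) = expmx_coef A m.+1 i j.
Proof.
apply/funext => k; rewrite /pseries_diffs /expmx_coef factS natrM addSnnS.
by field; rewrite pnatr_eq0 -lt0n fact_gt0/= nat1r pnatr_eq0.
Qed.

Lemma is_derive_expmx_coef A (t : R) i j :
  is_derive t (1 : R) (fun s => expmx A s i j)
    (limn (pseries (expmx_coef A 1 i j) t)).
Proof.
(* The series converges everywhere; |t| + 1 is just a point beyond |t|. *)
have := @pseries_snd_diffs R (expmx_coef A 0 i j) (`|t| + 1) t.
rewrite !expmx_coef_diffs => /(_ (is_cvg_expmx _ _ _ _ _) (is_cvg_expmx _ _ _ _ _) (is_cvg_expmx _ _ _ _ _)).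
rewrite (ger0_norm (_ : 0 <= `|t| + 1)) ?addr_ge0// ltrDl ltr01 => /(_ isT).
by congr (is_derive _ _ _ _); apply/funext => s; rewrite mxE.
Qed.

Lemma lim_series_sum (c : 'I_n -> R) (f : 'I_n -> R^nat) :
  (forall l, cvgn (series (f l))) ->
  limn (series (fun k => \sum_l c l * f l k)) = \sum_l c l * limn (series (f l)).
Proof.
move=> cf; apply/cvg_lim => //.
have -> : series (fun k => \sum_l c l * f l k) = (fun m => \sum_l c l * series (f l) m).
  apply/funext => m; rewrite /series /= exchange_big /=; apply: eq_bigr => l _.
  by rewrite mulr_sumr.
apply: cvg_big => [|l _]; first exact: add_continuous.
by apply: cvgMl_tmp; exact: cf.
Qed.

Lemma expmx_coef1l A (t : R) i j :
  limn (pseries (expmx_coef A 1 i j) t) = (A *m expmx A t) i j.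
Proof.
rewrite mxE -[in LHS]/(pseries _ _).
transitivity (\sum_l A i l * limn (pseries (expmx_coef A 0 l j) t)); last first.
  by apply: eq_bigr => l _; rewrite [in RHS]mxE.
rewrite -lim_series_sum; last by move=> l; exact: is_cvg_expmx.
congr (limn (series _)); apply/funext => k.
rewrite /expmx_coef /= addn1 exprS mxE !mulr_suml; apply: eq_bigr => l _.
by rewrite addn0; ring.
Qed.

Lemma expmx_coef1r A (t : R) i j :
  limn (pseries (expmx_coef A 1 i j) t) = (expmx A t *m A) i j.
Proof.
rewrite mxE.
transitivity (\sum_l A l j * limn (pseries (expmx_coef A 0 i l) t)); last first.
  by apply: eq_bigr => l _; rewrite [in RHS]mxE mulrC.
rewrite -lim_series_sum; last by move=> l; exact: is_cvg_expmx.
congr (limn (series _)); apply/funext => k.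
rewrite /expmx_coef /= addn1 exprSr mxE !mulr_suml; apply: eq_bigr => l _.
by rewrite addn0; ring.
Qed.

Lemma is_derive_expmx A (t : R) i j :
  is_derive t (1 : R) (fun s => expmx A s i j) ((A *m expmx A t) i j).
Proof. by rewrite -expmx_coef1l; exact: is_derive_expmx_coef. Qed.

Lemma is_derive_expmx_r A (t : R) i j :
  is_derive t (1 : R) (fun s => expmx A s i j) ((expmx A t *m A) i j).
Proof. by rewrite -expmx_coef1r; exact: is_derive_expmx_coef. Qed.

Lemma expmx_continuous A i j : continuous (fun s => expmx A s i j).
Proof.
move=> t; apply/differentiable_continuous/derivable1_diffP.
by case: (is_derive_expmx A t i j).
Qed.

Lemma expmx0 A : expmx A 0 = 1%:M.
Proof.
apply/matrixP => i j; rewrite mxE; apply/cvg_lim => //.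
apply: (@cvg_trans _ (cst ((1%:M : 'M[R]_n) i j) @ \oo)); last exact: cvg_cst.
apply: near_eq_cvg; near=> m.
have -> : m = m.-1.+1 by rewrite prednK//; near: m; exact: nbhs_infty_gt.
rewrite /pseries /series /= big_nat_recl// big1; last first.
  by move=> k _; rewrite expr0n mulr0.
by rewrite /expmx_coef expr0 fact0 !mulr1 invr1 mulr1 addr0 addn0 expr0.
Unshelve. all: by end_near. Qed.

Lemma is_derive_expmxN A (t : R) i j :
  is_derive t (1 : R) (fun s => expmx A (- s) i j) (- (expmx A (- t) *m A) i j).
Proof.
have := @is_derive1_comp R (fun s => expmx A s i j) -%R t _ _ (is_derive_expmx_r A (- t) i j) (is_deriveNid t 1).
by move=> h; apply: is_derive_eq h _; rewrite mulrN1.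
Qed.

(** The derivative of e^(-sA) is written with A on the right and that of e^(sA) with A on the left,
    so the two terms of the product rule cancel directly. *)
Lemma expmxNK A (t : R) : 0 <= t -> expmx A (- t) *m expmx A t = 1%:M.
Proof.
move=> t0; apply/matrixP => i j.
pose f s := \sum_l expmx A (- s) i l * expmx A s l j.
have df (s : R) : 0 < s -> is_derive s (1 : R) f 0.
  move=> _.
  have := is_derive_sumE (fun l => is_derive_mulE (is_derive_expmxN A s i l) (is_derive_expmx A s l j)).
  move=> h; apply: is_derive_eq h _.
  rewrite big_split /=.
  have -> : \sum_(l < n) - (expmx A (- s) *m A) i l * expmx A s l j = - (expmx A (- s) *m A *m expmx A s) i j.
    by rewrite [in RHS]mxE -sumrN; apply: eq_bigr => l _; rewrite mulNr.
  have -> : \sum_(l < n) expmx A (- s) i l * (A *m expmx A s) l j = (expmx A (- s) *m (A *m expmx A s)) i j.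
    by rewrite [in RHS]mxE.
  by rewrite mulmxA addNr.
have cf : hcont f.
  apply: hcont_sum_ord => l; apply: hcontM; apply: hcontT => s; last exact: expmx_continuous.
  apply/differentiable_continuous/derivable1_diffP.
  by case: (is_derive_expmxN A s i l).
have := hcont_const_of_deriv0 cf df t0.
rewrite mxE /f => ->; rewrite oppr0 expmx0.
by rewrite -[RHS](congr1 (fun X : 'M[R]_n => X i j) (mul1mx 1%:M)) [in RHS]mxE.
Qed.

Lemma expmxKN A (t : R) : 0 <= t -> expmx A t *m expmx A (- t) = 1%:M.
Proof. by move=> /expmxNK /mulmx1C. Qed.

Definition vint (h : R -> 'cV[R]_n) (t : R) : 'cV[R]_n :=
  \col_i Rintegral mu `[0, t] (fun s => h s i 0).

(** Variation of constants, with e^(tA) factored out of the integral: the product rule then applies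
    and only e^(tA) e^(-tA) = 1 is required. *)
Definition lin_sol A (h : R -> 'cV[R]_n) (z0 : 'cV[R]_n) (t : R) : 'cV[R]_n :=
  expmx A t *m (z0 + vint (fun s => expmx A (- s) *m h s) t).

Lemma hcont_mulmxf (M : R -> 'M[R]_n) (x : R -> 'cV[R]_n) :
  (forall i j, hcont (fun s => M s i j)) -> hcont x -> hcont (fun t => M t *m x t).
Proof.
move=> cM /hcont_mxP cx; apply/hcont_mxP => i.
have h := hcont_sum_ord (fun j => hcontM (cM i j) (cx j)).
by apply: (hcont_eq _ h) => t _; rewrite mxE.
Qed.

Lemma hcont_expmx A i j : hcont (fun s => expmx A s i j).
Proof. exact/hcontT/expmx_continuous. Qed.

Lemma hcont_expmxN A i j : hcont (fun s => expmx A (- s) i j).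
Proof.
apply: hcontT => s; apply/differentiable_continuous/derivable1_diffP.
by case: (is_derive_expmxN A s i j).
Qed.

Lemma hcont_vint h : hcont h -> hcont (vint h).
Proof.
move=> /hcont_mxP ch; apply/hcont_mxP => i.
by apply: (hcont_eq _ (hcont_int (ch i))) => t _; rewrite mxE.
Qed.

Lemma is_derive_vint h (t : R) : hcont h -> 0 < t -> is_derive t (1 : R) (vint h) (h t).
Proof.
move=> /hcont_mxP ch t0; apply/is_derive_mxP => i.
have := is_derive_int (ch i) t0.
by congr (is_derive _ _ _ _); apply/funext => s; rewrite mxE.
Qed.

Lemma lin_sol_hcont A h z0 : hcont h -> hcont (lin_sol A h z0).
Proof.
move=> ch; apply: hcont_mulmxf; first exact: hcont_expmx.
apply: hcontvD; first by apply: hcontT => t; exact: cvg_cst.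
by apply: hcont_vint; apply: hcont_mulmxf => //; exact: hcont_expmxN.
Qed.

Lemma lin_sol0 A h z0 : lin_sol A h z0 0 = z0.
Proof.
rewrite /lin_sol expmx0 mul1mx (_ : vint _ 0 = 0) ?addr0//.
by apply/colP => i; rewrite !mxE Rintegral00.
Qed.

Lemma lin_sol_ode A h z0 (t : R) : hcont h -> 0 < t ->
  is_derive t (1 : R) (lin_sol A h z0) (A *m lin_sol A h z0 t + h t).
Proof.
move=> ch t0.
have cg : hcont (fun s => expmx A (- s) *m h s).
  by apply: hcont_mulmxf => //; exact: hcont_expmxN.
have dy : is_derive t (1 : R) (fun s => z0 + vint (fun s => expmx A (- s) *m h s) s)
    (expmx A (- t) *m h t).
  have := is_deriveD (is_derive_cst z0 t 1) (is_derive_vint cg t0).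
  by move=> H; apply: is_derive_eq H _; rewrite add0r.
set y := fun s => z0 + _ in dy.
apply/is_derive_mxP => i.
have /is_derive_mxP dyi := dy.
have := is_derive_sumE (fun l => is_derive_mulE (is_derive_expmx A t i l) (dyi l)).
have -> : (fun s => lin_sol A h z0 s i 0) = (fun s => \sum_l expmx A s i l * y s l 0).
  by apply/funext => s; rewrite mxE.
move=> H; apply: is_derive_eq H _; rewrite big_split /=.
have -> : \sum_(l < n) (A *m expmx A t) i l * y t l 0 = (A *m lin_sol A h z0 t) i 0.
  by rewrite /lin_sol mulmxA [in RHS]mxE.
have -> : \sum_(l < n) expmx A t i l * (expmx A (- t) *m h t) l 0 = h t i 0.
  rewrite -[in RHS](mul1mx (h t)) -(expmxKN A (ltW t0)) -mulmxA [in RHS]mxE //.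
by rewrite [in RHS]mxE.
Qed.

End MatrixExponential.

(** * Pathwise energy estimate *)

Section PathEnergy.
Context {R : realType}.
Local Notation mu := (@lebesgue_measure R).

(** K is chosen before z and h, so one constant serves all sample paths and the estimate can be
    integrated over them. *)
Lemma path_energy n (rho : R) (M : 'M[R]_n) : hurwitz (M - (rho / 2)%:M) ->
  exists2 K : R, 0 < K & forall z h : R -> 'cV[R]_n, hcont z -> hcont h ->
    (forall t : R, 0 < t -> is_derive t (1 : R) z (M *m z t + h t)) ->
    forall T : R, 0 <= T ->
    Rintegral mu `[0, T] (fun t => expR (- (rho * t)) * sqnorm (z t)) <=
    K * (sqnorm (z 0) + Rintegral mu `[0, T] (fun t => expR (- (rho * t)) * sqnorm (h t))).
Proof.
move=> /hurwitz_lyapunov [H [c [c0 [Hs H0] hH]]].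
have [C C0 hC] := sqnorm_mul_le H.
(* Monotonicity of W below gives c Iz <= V 0 + c^-1 C Ih, and V 0 <= (1 + C) |z 0|^2. *)
exists (c^-1 * (1 + C + c^-1 * C)); first by rewrite mulr_gt0 ?invr_gt0// !addr_gt0 ?mulr_gt0 ?invr_gt0.
move=> z h cz ch dz T T0.
pose V t := expR (- (rho * t)) * dotv (z t) (H *m z t).
pose ez t := expR (- (rho * t)) * sqnorm (z t).
pose eh t := expR (- (rho * t)) * sqnorm (h t).
have cez : hcont ez by exact: hcont_energy.
have ceh : hcont eh by exact: hcont_energy.
have cV : hcont V by apply: hcontM (hcont_expR _) (hcont_dotv cz (hcont_mulmx cz)).
(* The Lyapunov function yields -2c |z|^2. Young's inequality with parameter c spends c |z|^2 on the
   forcing term, and the remaining c |z|^2 pays for the integral of [ez]. *)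
pose W t := V t + (c * Rintegral mu `[0, t] ez - c^-1 * C * Rintegral mu `[0, t] eh).
pose dV t := expR (- (rho * t)) * (dotv (M *m z t + h t) (H *m z t) +
   dotv (z t) (H *m (M *m z t + h t)) - rho * dotv (z t) (H *m z t)).
have cW : hcont W.
  apply: hcontD cV _; apply: hcontB; apply: hcontM (hcont_cst _) _; exact: hcont_int.
have dW (t : R) : 0 < t -> is_derive t (1 : R) W (dV t + (c * ez t - c^-1 * C * eh t)).
  move=> t0.
  have d1 := is_derive_disc rho (dz t t0) (is_derive_mulmx H (dz t t0)).
  have d2 := is_derive_mulE (is_derive_cst c t 1) (is_derive_int cez t0).
  have d3 := is_derive_mulE (is_derive_cst (c^-1 * C) t 1) (is_derive_int ceh t0).
  have := is_deriveD d1 (is_deriveB d2 d3).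
  by move=> d; apply: is_derive_eq d _; rewrite !mul0r !add0r.
have dW0 (t : R) : 0 < t -> dV t + (c * ez t - c^-1 * C * eh t) <= 0.
  move=> t0; rewrite /dV /ez /eh.
  have -> : dotv (M *m z t + h t) (H *m z t) + dotv (z t) (H *m (M *m z t + h t)) -
      rho * dotv (z t) (H *m z t) =
      2 * dotv (z t) (H *m ((M - (rho / 2)%:M) *m z t)) + 2 * dotv (z t) (H *m h t).
    rewrite mulmxBl mul_scalar_mx mulmxBr -scalemxAr mulmxDr !dotv_lin.
    rewrite (dotvC (M *m z t)) (dotvC (h t)) -{1 2}Hs -!dotv_trl; lra.
  have h1 := hH (z t); have h2 := dotv_young (z t) (H *m h t) c0.
  have ci : 0 < c^-1 by rewrite invr_gt0.
  have h3 := ler_wpM2l (ltW ci) (hC (h t)).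
  have h4 := ler_norm (dotv (z t) (H *m h t)).
  set e := expR _.
  rewrite (_ : _ + _ = e * (2 * dotv (z t) (H *m ((M - (rho / 2)%:M) *m z t)) +
     2 * dotv (z t) (H *m h t) + c * sqnorm (z t) - c^-1 * (C * sqnorm (h t)))); last by ring.
  rewrite mulr_ge0_le0 ?expR_ge0//; lra.
have := hcont_nonincreasing cW dW dW0 (lexx 0) T0.
rewrite /W !Rintegral00 !mulr0 subr0 addr0 {2}/V mulr0 oppr0 expR0 mul1r.
have VT : 0 <= V T by rewrite mulr_ge0 ?expR_ge0// -qform_dotv.
have V0 := dotv_young (z 0) (H *m z 0) (@ltr01 R).
rewrite invr1 !mul1r in V0; have V0' := hC (z 0).
have V0'' := ler_norm (dotv (z 0) (H *m z 0)).
have z0 := sqnorm_ge0 (z 0).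
pose Iz := Rintegral mu `[0, T] ez; pose Ih := Rintegral mu `[0, T] eh.
rewrite -/Iz -/Ih => main.
change (Iz <= c^-1 * (1 + C + c^-1 * C) * (sqnorm (z 0) + Ih)).
have Ih0 : 0 <= Ih by apply: hcont_Rintegral_ge0 => // t _; exact: energy_fun_ge0.
rewrite -mulrA ler_pdivlMl//.
have ci : 0 < c^-1 by rewrite invr_gt0.
have e1 : 0 <= c^-1 * C * sqnorm (z 0) by rewrite !mulr_ge0// ltW.
have e2 : 0 <= C * Ih by rewrite mulr_ge0// ltW.
have e3 : 0 <= C * sqnorm (z 0) by rewrite mulr_ge0// ltW.
nra.
Qed.

End PathEnergy.

(** * Riemann sums *)

Section RiemannSums.
Context {R : realType}.
Local Notation mu := (@lebesgue_measure R).

(** Heine-Cantor through near-coverings, the modulus d being the parameter that tends to 0 from the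
    right. Only x is confined to the segment. *)
Lemma continuous_segment_uniform (f : R -> R) (a b e : R) : continuous f -> 0 < e ->
  exists2 d : R, 0 < d & forall x y : R, a <= x <= b -> `|x - y| < d -> `|f x - f y| < e.
Proof.
move=> cf e0.
pose P (d x : R) := forall y, `|x - y| < d -> `|f x - f y| < e.
have /compact_near_coveringP/(_ R (0 : R)^'+ P _) : compact (`[a, b]%classic : set R).
  exact: segment_compact.
case.
  move=> x _; have e2 : 0 < e / 2 by rewrite divr_gt0.
  have /cvgrPdist_lt/(_ _ e2) [eta /= eta0 heta] := cf x.
  exists (ball x (eta / 2), `]0, (eta / 2)[%classic).
    split; first by apply: nbhsx_ballx; rewrite divr_gt0.
    have eh : 0 < eta / 2 by rewrite divr_gt0.
    by apply: filterS2 (nbhs_right_gt (0 : R)) (nbhs_right_lt eh) => z z0 ze; rewrite /= in_itv/= z0.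
  move=> [x' d] /= [xx'].
  rewrite in_itv/= => /andP[d0 dd] y xy.
  have h1 : `|f x - f x'| < e / 2.
    by apply: heta; apply: lt_le_trans xx' _; lra.
  have h2 : `|f x - f y| < e / 2.
    apply: heta => /=; rewrite -(subrK x' x) -addrA (le_lt_trans (ler_normD _ _))//.
    have : `|x - x'| < eta / 2 by [].
    by move: dd xy; lra.
  rewrite -(subrK (f x) (f x')) -addrA (le_lt_trans (ler_normD _ _))//.
  by rewrite distrC; lra.
move=> d /= d0 hd; exists (d / 2); first by rewrite divr_gt0.
move=> x y xab xy; apply: (hd (d / 2)) => //=; rewrite ?divr_gt0//.
  by rewrite sub0r normrN gtr0_norm ?divr_gt0// ltr_pdivrMr// ltr_pMr// ltr1n.
Qed.

(** Left-point sums on the same nodes as in [is_wiener_integral], so that second moments of Wiener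
    sums are sums of this form. *)
Definition riemann_sum (f : R -> R) (t : R) (m : nat) : R :=
  \sum_(j < m.+1) (t / m.+1%:R) * f (j%:R * t / m.+1%:R).

(** By the mean value theorem the integral over a cell is h f(c) for some c in it; uniform
    continuity makes the error per cell at most h e / t. *)
Lemma riemann_sum_cvg (f : R -> R) (t : R) : hcont f -> 0 <= t ->
  riemann_sum f t @ \oo --> Rintegral mu `[0, t] f.
Proof.
move=> cf; rewrite le_eqVlt => /predU1P[<-|t0].
  rewrite Rintegral00; apply: (@cvg_trans _ (cst (0 : R) @ \oo)); last exact: cvg_cst.
  apply: near_eq_cvg; near=> m.
  by rewrite /riemann_sum big1// => j _; rewrite mul0r mul0r.
pose g s := f (Num.max 0 s).
have cg : continuous g := hcont_ext cf.
apply/cvgrPdist_le => e e0.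
have et0 : 0 < e / t by rewrite divr_gt0.
have [d d0 hd] := @continuous_segment_uniform g 0 t _ cg et0.
near=> m.
pose h := t / m.+1%:R; have h0 : 0 < h by rewrite divr_gt0.
have hd' : h < d.
  rewrite /h ltr_pdivrMr// -ltr_pdivrMl// mulrC.
  rewrite (@lt_trans _ _ m%:R)// ?ltr_nat//.
  near: m; exact: nbhs_infty_gtr.
pose F s := Rintegral mu `[0, s] f.
have FE : F t = \sum_(j < m.+1) (F (j.+1%:R * h) - F (j%:R * h)).
  rewrite -(big_mkord xpredT (fun j => F (j.+1%:R * h) - F (j%:R * h))).
  rewrite telescope_sumr// mul0r {3}/F Rintegral00 subr0 /h mulrC divfK//.
rewrite -/(F t) FE /riemann_sum -sumrB (le_trans (ler_norm_sum _ _ _))//.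
have -> : e = \sum_(j < m.+1) (h * (e / t)).
  rewrite sumr_const card_ord -mulr_natl /h; field.
  by rewrite (gt_eqF t0)/= nat1r pnatr_eq0.
apply: ler_sum => j _.
have jh0 : 0 <= j%:R * h by rewrite mulr_ge0// ltW.
have jh1 : j%:R * h < j.+1%:R * h by rewrite ltr_pM2r// ltr_nat.
have [||c] := @MVT _ F f _ _ jh1.
- move=> r; rewrite in_itv/= => /andP[tr _]; apply: is_derive_int => //.
  exact: le_lt_trans tr.
- by apply: hcont_seg => //; exact: hcont_int.
rewrite in_itv/= => /andP[c1 c2] ->.
rewrite -mulrBl -natrB// subSnn mul1r -/h -mulrA -/h mulrC -mulrBr normrM gtr0_norm//.
rewrite ler_wpM2l ?(ltW h0)//.
have c0 : 0 <= c by apply: le_trans jh0 _; exact: ltW.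
rewrite distrC ltW//; have := hd (j%:R * h) c; rewrite /g !max_r//; apply.
  rewrite jh0/= -[leRHS](@divfK _ m.+1%:R)// -/h mulrC ler_wpM2l ?(ltW h0)// ler_nat.
  exact: ltnW.
rewrite distrC ger0_norm ?subr_ge0 ?ltW//; apply: lt_trans hd'.
by move: c2; rewrite -natr1 mulrDl mul1r; lra.
Unshelve. all: by end_near. Qed.

End RiemannSums.

(** * Second moment of the normal law *)

Section NormalMoment.
Context {R : realType}.
Local Notation mu := (@lebesgue_measure R).

Lemma is_derive_normal_pdf (s t : R) : 0 < s ->
  is_derive t (1 : R) (normal_pdf 0 s) (- (t / s ^+ 2) * normal_pdf 0 s t).
Proof.
move=> s0.
have -> : normal_pdf 0 s = (fun x => normal_peak s * expR (- (x ^+ 2 / (s ^+ 2 *+ 2)))).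
  apply/funext => x; rewrite normal_pdfE ?gt_eqF// /normal_fun subr0.
  by rewrite mulNr.
set k := (s ^+ 2 *+ 2)^-1.
have h0 : is_derive t (1 : R) (fun x : R => - (x ^+ 2 * k)) (- (2 * t * k)).
  have h := is_derive_mulE (is_derive_mulE (is_derive_id t (1 : R)) (is_derive_id t (1 : R))) (is_derive_cst k t 1).
  have h' := is_deriveN h.
  by apply: is_derive_eq h' _; rewrite mulr0 addr0 /cst /=; ring.
have h1 := @is_derive1_comp R expR _ t _ _ (is_derive_expR _) h0.
have h2 := is_derive_mulE (is_derive_cst (normal_peak s) t 1) h1.
apply: is_derive_eq h2 _.
rewrite mul0r add0r /=.
have -> : 2 * t * k = t / s ^+ 2.
  by rewrite /k -mulr_natr; field; rewrite gt_eqF.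
by ring.
Qed.

Lemma hcont_normal_pdf (s : R) : 0 < s -> hcont (normal_pdf 0 s).
Proof. by move=> s0; apply/hcontT/continuous_normal_pdf; rewrite gt_eqF. Qed.

Lemma hcont_id : hcont (fun t : R => t).
Proof. by apply: hcontT => t; exact: cvg_id. Qed.

Lemma normal_pdf_even (s x : R) : 0 < s -> normal_pdf 0 s (- x) = normal_pdf 0 s x.
Proof.
by move=> s0; rewrite !normal_pdfE ?gt_eqF// /normal_fun !subr0 sqrrN.
Qed.

(** From e^-y <= 1 / y at y = n^2 / (2 s^2), the product is at most a constant over n. *)
Lemma normal_pdf_tail (s : R) : 0 < s ->
  (n%:R * normal_pdf 0 s n%:R) @[n --> \oo] --> (0 : R).
Proof.
move=> s0; set K := normal_peak s * (s ^+ 2 *+ 2).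
have K0 : 0 <= K by rewrite mulr_ge0 ?normal_peak_ge0// mulrn_wge0// sqr_ge0.
apply: (@squeeze_cvgr _ _ _ _ (cst 0) (fun n => K * n%:R^-1)).
- near=> n; have n0 : (0 : R) < n%:R by rewrite ltr0n; near: n; exact: nbhs_infty_gt.
  rewrite mulr_ge0 ?normal_pdf_ge0//=.
  rewrite normal_pdfE ?gt_eqF// /normal_fun subr0 mulNr expRN.
  set y := n%:R ^+ 2 / (s ^+ 2 *+ 2).
  have y0 : 0 < y by apply: divr_gt0; rewrite ?pmulrn_lgt0// exprn_gt0.
  have : (expR y)^-1 <= y^-1.
    by rewrite lef_pV2 ?posrE ?expR_gt0//; have := expR_ge1Dx y; lra.
  move=> h; apply: (@le_trans _ _ (n%:R * (normal_peak s * y^-1))).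
    by rewrite !ler_wpM2l ?normal_peak_ge0// ltW.
  rewrite /y /K invf_div le_eqVlt; apply/orP; left; apply/eqP.
  by field; rewrite gt_eqF.
- exact: cvg_cst.
- rewrite -[X in _ --> X](mulr0 K); apply: cvgMl_tmp.
  by rewrite -(@cvg_shiftS _ (fun n : nat => n%:R^-1 : R)); exact: cvg_harmonic.
Unshelve. all: by end_near. Qed.

(** Integration by parts: the derivative of -s^2 x p(x) is x^2 p(x) - s^2 p(x), and the boundary
    term is [normal_pdf_tail]. Evenness reduces the line to the half-line. *)
Lemma normal_second_moment_pdf (s : R) : 0 < s ->
  (\int[mu]_x (x ^+ 2 * normal_pdf 0 s x)%:E = (s ^+ 2)%:E)%E.
Proof.
move=> s0; set p := normal_pdf 0 s.
have cp : hcont p := hcont_normal_pdf s0.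
have cx2 : hcont (fun t : R => t ^+ 2 * p t).
  apply: hcontM => //; apply: hcontM; exact: hcont_id.
have half : (\int[mu]_(x in `[0%R, +oo[) (p x)%:E = (2^-1)%:E)%E.
  have := @integral_normal_pdf R 0 s.
  rewrite ge0_symfun_integralT; last 3 first.
  - by move=> x; exact: normal_pdf_ge0.
  - by apply: continuous_normal_pdf; rewrite gt_eqF.
  - by move=> x /=; rewrite normal_pdf_even.
  rewrite -set_itvcy => h.
  have : (2^-1%:E * (2%:E * \int[mu]_(x in `[0%R, +oo[) (p x)%:E) = (2^-1)%:E)%E.
    by rewrite h mule1.
  by rewrite muleA -EFinM mulVf// mul1e.
have key (t : R) : 0 <= t -> Rintegral mu `[0, t] (fun t => t ^+ 2 * p t) =
    s ^+ 2 * Rintegral mu `[0, t] p - s ^+ 2 * (t * p t).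
  move=> t0.
  pose g t := - s ^+ 2 * (t * p t).
  have cg : hcont g.
    apply: (hcontM (hcont_cst _)); apply: hcontM => //; exact: hcont_id.
  have cv : hcont (fun t => t ^+ 2 * p t + - s ^+ 2 * p t).
    by apply: hcontD => //; apply: (hcontM (hcont_cst _)).
  have dg (r : R) : 0 < r -> is_derive r (1 : R) g (r ^+ 2 * p r + - s ^+ 2 * p r).
    move=> r0; have h := is_derive_mulE (is_derive_cst (- s ^+ 2) r 1)
      (is_derive_mulE (is_derive_id r (1 : R)) (is_derive_normal_pdf r s0)).
    apply: is_derive_eq h _; rewrite -/p mul0r add0r /cst /=; field.
    by rewrite gt_eqF.
  have := FTC2_halfline cg cv dg t0.
  rewrite {1 2}/g mul0r mulr0 add0r hcont_RintegralD//; last first.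
    by apply: (hcontM (hcont_cst _)).
  by rewrite hcont_RintegralZ// => h; lra.
rewrite ge0_symfun_integralT; last 3 first.
- by move=> x; rewrite mulr_ge0 ?sqr_ge0 ?normal_pdf_ge0.
- move=> x; apply: cvgM; first exact: sqr_continuous.
  by apply: continuous_normal_pdf; rewrite gt_eqF.
- by move=> x /=; rewrite /p normal_pdf_even// sqrrN.
rewrite -set_itvcy.
suff -> : (\int[mu]_(x in `[0%R, +oo[) (x ^+ 2 * p x)%:E = (s ^+ 2 / 2)%:E)%E.
  by rewrite -EFinM mulrC divfK.
have h1 : (Rintegral mu `[0, n%:R] (fun t => t ^+ 2 * p t))%:E @[n --> \oo] -->
    (\int[mu]_(x in `[0%R, +oo[) (x ^+ 2 * p x)%:E)%E.
  apply: integral_halfline_cvg => // t t0.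
  by rewrite mulr_ge0 ?sqr_ge0 ?normal_pdf_ge0.
have h2 : (Rintegral mu `[0, n%:R] p)%:E @[n --> \oo] --> (2^-1)%:E.
  by rewrite -half; apply: integral_halfline_cvg => // t _; exact: normal_pdf_ge0.
have h2' : Rintegral mu `[0, n%:R] p @[n --> \oo] --> (2^-1 : R).
  exact: (fine_cvg h2).
have h3 : (Rintegral mu `[0, n%:R] (fun t => t ^+ 2 * p t)) @[n --> \oo] --> s ^+ 2 / 2.
  rewrite -[X in _ --> X]subr0 -[X in _ --> _ - X](mulr0 (s ^+ 2)).
  have -> : (fun n : nat => Rintegral mu `[0, n%:R] (fun t => t ^+ 2 * p t)) =
     (fun n : nat => s ^+ 2 * Rintegral mu `[0, n%:R] p - s ^+ 2 * (n%:R * p n%:R)).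
    by apply/funext => n; rewrite key.
  apply: cvgB; first exact: cvgMl_tmp.
  by apply: cvgMl_tmp; exact: normal_pdf_tail.
have h4 : (Rintegral mu `[0, n%:R] (fun t => t ^+ 2 * p t))%:E @[n --> \oo] --> (s ^+ 2 / 2)%:E.
  by apply: cvg_EFin => //; exact: nearW.
by rewrite -(cvg_lim _ h1)// (cvg_lim _ h4).
Qed.

(** The Radon-Nikodym derivative and the density have the same integral over every measurable set,
    hence agree almost everywhere. *)
Lemma normal_prob_density (s : R) (f : R -> \bar R) : measurable_fun setT f ->
  (forall x, 0 <= f x)%E ->
  (\int[normal_prob 0 s]_x f x = \int[mu]_x (f x * (normal_pdf 0 s x)%:E))%E.
Proof.
move=> mf f0.
have dom := @normal_prob_dominates R 0 s.
rewrite -(Radon_Nikodym_SigmaFinite.change_of_variables dom)//.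
apply: ge0_ae_eq_integral => //.
- apply: emeasurable_funM => //.
  exact: measurable_int (Radon_Nikodym_SigmaFinite.f_integrable dom).
- apply: emeasurable_funM => //; apply/measurable_EFinP; exact: measurable_normal_pdf.
- by move=> x _; rewrite mule_ge0//; exact: Radon_Nikodym_SigmaFinite.f_ge0.
- by move=> x _; rewrite mule_ge0// lee_fin normal_pdf_ge0.
- have : ae_eq mu setT (Radon_Nikodym_SigmaFinite.f (normal_prob 0 s) mu)
      (fun x => (normal_pdf 0 s x)%:E).
    apply: integral_ae_eq => //.
    + exact: Radon_Nikodym_SigmaFinite.f_integrable.
    + apply/measurable_EFinP; exact: measurable_normal_pdf.
    + by move=> E _ mE; rewrite -Radon_Nikodym_SigmaFinite.f_integral.
  by apply: filterS => x /= h /h ->.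
Qed.

Lemma normal_second_moment (s : R) : 0 < s ->
  (\int[normal_prob 0 s]_x (x ^+ 2)%:E = (s ^+ 2)%:E)%E.
Proof.
move=> s0; rewrite normal_prob_density.
- by rewrite -normal_second_moment_pdf//; apply: eq_integral => x _; rewrite EFinM.
- by apply/measurable_EFinP; exact: measurable_funX.
- by move=> x; rewrite lee_fin sqr_ge0.
Qed.

End NormalMoment.

(** * Second moment of the Wiener integral *)

Section SecondMoments.
Context {R : realType} {d : measure_display} {T : measurableType d}.
Variable Pr : probability T R.
Local Notation mu := (@lebesgue_measure R).
Implicit Types f g : T -> R.

Lemma measurable_sqnorm n (X : T -> 'cV[R]_n) :
  (forall k, measurable_fun setT (fun w => X w k 0)) ->
  measurable_fun setT (fun w => sqnorm (X w)).
Proof.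
move=> mX; have -> : (fun w => sqnorm (X w)) = (fun w => \sum_i X w i 0 ^+ 2).
  by apply/funext => w; rewrite sqnorm_sum.
by apply: measurable_sum => i; exact: measurable_funX.
Qed.

Definition mean f : R := Rintegral Pr [set: T] f.
Definition L1rv f : Prop := Pr.-integrable [set: T] (EFin \o f).
Definition L2rv f : Prop := measurable_fun [set: T] f /\ L1rv (fun w => f w ^+ 2).

Lemma L1rvD f g : L1rv f -> L1rv g -> L1rv (fun w => f w + g w).
Proof. by move=> lf lg; have := integrableD measurableT lf lg. Qed.

Lemma L1rvZ (a : R) f : L1rv f -> L1rv (fun w => a * f w).
Proof. by move=> lf; have := integrableZl measurableT a lf. Qed.

Lemma L1rv0 : L1rv (fun _ => 0).
Proof. exact: integrable0. Qed.

Lemma meanD f g : L1rv f -> L1rv g -> mean (fun w => f w + g w) = mean f + mean g.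
Proof. by move=> lf lg; rewrite /mean RintegralD. Qed.

Lemma meanZ (a : R) f : L1rv f -> mean (fun w => a * f w) = a * mean f.
Proof. by move=> lf; rewrite /mean RintegralZl. Qed.

Lemma mean0 : mean (fun _ => 0) = 0.
Proof. by rewrite /mean Rintegral_cst// mul0r. Qed.

Lemma L1rv_sum (I : Type) (r : seq I) (F : I -> T -> R) : (forall i, L1rv (F i)) ->
  L1rv (fun w => \sum_(i <- r) F i w) /\
  mean (fun w => \sum_(i <- r) F i w) = \sum_(i <- r) mean (F i).
Proof.
move=> hF; elim: r => [|i r [IH1 IH2]].
  rewrite (_ : (fun w => _) = fun _ => 0); last by apply/funext => w; rewrite big_nil.
  by rewrite big_nil mean0; split => //; exact: L1rv0.
rewrite (_ : (fun w => _) = fun w => F i w + \sum_(i <- r) F i w); last first.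
  by apply/funext => w; rewrite big_cons.
by rewrite big_cons meanD// IH2; split => //; exact: L1rvD.
Qed.

Lemma L2rv_mul f g : L2rv f -> L2rv g -> L1rv (fun w => f w * g w).
Proof.
move=> [mf lf] [mg lg].
apply: (@le_integrable _ _ _ Pr _ measurableT _ (EFin \o (fun w => f w ^+ 2 + g w ^+ 2))).
- by apply/measurable_EFinP; exact: measurable_funM.
- move=> w _; rewrite lee_fin [leRHS]ger0_norm ?addr_ge0 ?sqr_ge0//.
  have := sqr_ge0 (f w + g w); have := sqr_ge0 (f w - g w).
  have := sqr_ge0 (f w); have := sqr_ge0 (g w).
  by rewrite ler_norml; nra.
- exact: L1rvD.
Qed.

Lemma mean_EFin f : L1rv f -> (\int[Pr]_w (f w)%:E = (mean f)%:E)%E.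
Proof. by move=> lf; rewrite /mean /Rintegral fineK//; exact: integrable_fin_num. Qed.

(** Pythagoras in L2: the square expands into a double sum whose off-diagonal means vanish. *)
Lemma orthogonal_sum n (m : nat) (X : 'I_m -> T -> R) (D : 'I_m -> 'cV[R]_n) :
  (forall j, L2rv (X j)) ->
  (forall j k, j != k -> mean (fun w => X j w * X k w) = 0) ->
  L1rv (fun w => sqnorm (\sum_j X j w *: D j)) /\
  mean (fun w => sqnorm (\sum_j X j w *: D j)) =
    \sum_j mean (fun w => X j w ^+ 2) * sqnorm (D j).
Proof.
move=> l2 orth.
have -> : (fun w => sqnorm (\sum_j X j w *: D j)) =
    (fun w => \sum_j \sum_k dotv (D j) (D k) * (X j w * X k w)).
  apply/funext => w; rewrite sqnorm_dotv.
  have suml (y : 'cV[R]_n) : dotv (\sum_j X j w *: D j) y = \sum_j X j w * dotv (D j) y.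
    apply: (big_ind2 (fun (a : 'cV[R]_n) b => dotv a y = b)).
    - by rewrite dotvC dotv0r.
    - by move=> a b a' b' <- <-; rewrite dotvDl.
    - by move=> j _; rewrite dotvZl.
  rewrite suml; apply: eq_bigr => j _; rewrite dotvC suml mulr_sumr.
  by apply: eq_bigr => k _; rewrite (dotvC (D k)); ring.
have l1 j k : L1rv (fun w => dotv (D j) (D k) * (X j w * X k w)).
  by apply: L1rvZ; exact: L2rv_mul.
have l2' j := L1rv_sum (index_enum _) (l1 j).
have [l3 e3] := L1rv_sum (index_enum _) (fun j => (l2' j).1).
split => //; rewrite e3; apply: eq_bigr => j _; rewrite (l2' j).2.
rewrite (bigD1 j)//= big1 ?addr0; last first.
  by move=> k kj; rewrite meanZ ?orth ?mulr0//; [rewrite eq_sym|exact: L2rv_mul].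
by rewrite meanZ; [rewrite mulrC|exact: L2rv_mul].
Qed.

Section Brownian.
Variable W : R -> T -> R.
Hypothesis hW : brownian_motion Pr W.

Lemma bm_increment_measurable s t : 0 <= s -> 0 <= t ->
  measurable_fun [set: T] (fun w => W t w - W s w).
Proof. by move=> s0 t0; case: hW => mW _ _ _; apply: measurable_funB; exact: mW. Qed.

Lemma bm_increment_int s t : 0 <= s -> s <= t ->
  (\int[Pr]_w ((W t w - W s w) ^+ 2)%:E = (t - s)%:E)%E.
Proof.
(* The law of an increment is specified for s < t only; s = t is the zero increment. *)
move=> s0; rewrite le_eqVlt => /predU1P[<-|st].
  under eq_integral do rewrite subrr expr0n.
  by rewrite integral0 subrr.
have mX := bm_increment_measurable s0 (le_trans s0 (ltW st)).
have ts : 0 < Num.sqrt (t - s) by rewrite sqrtr_gt0 subr_gt0.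
have := normal_second_moment ts; rewrite sqr_sqrtr ?subr_ge0 ?(ltW st)// => <-.
pose X (w : T) : measurableTypeR R := W t w - W s w.
transitivity (\int[pushforward Pr X]_(x in [set: measurableTypeR R]) (x ^+ 2)%:E)%E.
  have mX' : measurable_fun [set: T] X := mX.
  rewrite (ge0_integral_pushforward mX')//.
  - by apply/measurable_EFinP; exact: measurable_funX.
  - by move=> y _; rewrite lee_fin sqr_ge0.
by apply: eq_measure_integral => Y mY _; case: hW => _ _ hN _; exact: hN.
Qed.

Lemma bm_increment_L2rv s t : 0 <= s -> s <= t -> L2rv (fun w => W t w - W s w).
Proof.
move=> s0 st; have mX := bm_increment_measurable s0 (le_trans s0 st).
split=> //; apply/integrableP; split.
  by apply/measurable_EFinP; exact: measurable_funX.
under eq_integral do rewrite /= ger0_norm ?sqr_ge0//.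
by rewrite bm_increment_int// ltry.
Qed.

Lemma bm_increment_var s t : 0 <= s -> s <= t -> mean (fun w => (W t w - W s w) ^+ 2) = t - s.
Proof. by move=> s0 st; rewrite /mean /Rintegral bm_increment_int. Qed.

(* Polarization: the variances of all increments determine the covariances. *)
Lemma bm_increment_orth a b c e : 0 <= a -> a <= b -> b <= c -> c <= e ->
  mean (fun w => (W b w - W a w) * (W e w - W c w)) = 0.
Proof.
move=> a0 ab bc ce.
have b0 := le_trans a0 ab; have c0 := le_trans b0 bc.
have ac := le_trans ab bc; have be := le_trans bc ce; have ae := le_trans ac ce.
pose V s t w := (W t w - W s w) ^+ 2.
have lV s t : 0 <= s -> s <= t -> L1rv (V s t) by move=> s0 st; case: (bm_increment_L2rv s0 st).
have -> : (fun w => (W b w - W a w) * (W e w - W c w)) =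
    (fun w => 2^-1 * ((V a e w + -1 * V a c w) + (-1 * V b e w + V b c w))).
  by apply/funext => w; rewrite /V; field.
have l1 : L1rv (fun w => V a e w + -1 * V a c w) by apply: L1rvD (lV _ _ _ _) (L1rvZ _ (lV _ _ _ _)).
have l2 : L1rv (fun w => -1 * V b e w + V b c w) by apply: L1rvD (L1rvZ _ (lV _ _ _ _)) (lV _ _ _ _).
rewrite meanZ; last exact: L1rvD.
rewrite meanD// meanD; [|exact: lV|by apply: L1rvZ; exact: lV].
rewrite meanD; [|by apply: L1rvZ; exact: lV|exact: lV].
rewrite !meanZ; [|exact: lV|exact: lV].
rewrite !bm_increment_var//; lra.
Qed.

Variable n : nat.
Variable sigma : R -> 'cV[R]_n.
Hypothesis csigma : hcont sigma.

Definition wiener_sum (t : R) (m : nat) (w : T) : 'cV[R]_n :=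
  \sum_(j < m.+1) (W (j.+1%:R * t / m.+1%:R) w - W (j%:R * t / m.+1%:R) w)
               *: sigma (j%:R * t / m.+1%:R).

(** Isometry for step integrands: increments over distinct cells are orthogonal, each with variance
    the length of its cell. *)
Lemma wiener_sum_moment t m : 0 <= t ->
  L1rv (fun w => sqnorm (wiener_sum t m w)) /\
  mean (fun w => sqnorm (wiener_sum t m w)) = riemann_sum (fun s => sqnorm (sigma s)) t m.
Proof.
move=> t0.
have j0 (j : nat) : 0 <= j%:R * t / m.+1%:R by rewrite mulr_ge0// mulr_ge0.
have jk (j k : nat) : (j <= k)%N -> j%:R * t / m.+1%:R <= k%:R * t / m.+1%:R.
  by move=> jk; rewrite ler_pM2r ?invr_gt0// ler_wpM2r// ler_nat.
have := @orthogonal_sum n m.+1 (fun j w => W (j.+1%:R * t / m.+1%:R) w - W (j%:R * t / m.+1%:R) w)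
  (fun j => sigma (j%:R * t / m.+1%:R)).
case.
- by move=> j; apply: bm_increment_L2rv => //; exact: jk.
- move=> j k; rewrite -val_eqE /= neq_ltn => /orP[h|h].
    by apply: bm_increment_orth => //; exact: jk.
  under eq_fun do rewrite mulrC.
  by apply: bm_increment_orth => //; exact: jk.
move=> l1 e1; split => //; rewrite e1; apply: eq_bigr => j _.
rewrite bm_increment_var//; last exact: jk.
by congr (_ * _); rewrite -mulrBl -mulrBl -natrB// subSnn mul1r.
Qed.

(** The factor 2 comes from |M|^2 <= 2 |M - S_m|^2 + 2 |S_m|^2. The first term tends to 0 in mean by
    definition, and the second has a Riemann sum as its mean. *)
Lemma wiener_integral_moment (M : R -> T -> 'cV[R]_n) t : 0 <= t ->
  is_wiener_integral Pr W sigma M ->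
  (\int[Pr]_w (sqnorm (M t w))%:E <=
   (2 * Rintegral mu `[0, t] (fun s => sqnorm (sigma s)))%:E)%E.
Proof.
move=> t0 [mM _ cM].
have mN (X : T -> 'cV[R]_n) : (forall k, measurable_fun setT (fun w => X w k 0)) ->
    measurable_fun setT (fun w => (sqnorm (X w))%:E).
  by move=> mX; apply/measurable_EFinP; exact: measurable_sqnorm.
have mS m k : measurable_fun setT (fun w => wiener_sum t m w k 0).
  have -> : (fun w => wiener_sum t m w k 0) = (fun w => \sum_(j < m.+1)
     (W (j.+1%:R * t / m.+1%:R) w - W (j%:R * t / m.+1%:R) w) * sigma (j%:R * t / m.+1%:R) k 0).
    by apply/funext => w; rewrite summxE; apply: eq_bigr => j _; rewrite mxE.
  apply: measurable_sum => j; apply: measurable_funM => //.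
  by apply: bm_increment_measurable; rewrite mulr_ge0// mulr_ge0.
have mD m : measurable_fun setT (fun w => (sqnorm (M t w - wiener_sum t m w))%:E).
  apply: mN => k; have -> : (fun w => (M t w - wiener_sum t m w) k 0) =
     (fun w => M t w k 0 - wiener_sum t m w k 0) by apply/funext => w; rewrite !mxE.
  by apply: measurable_funB => //; exact: mM.
pose a m := (\int[Pr]_w (sqnorm (M t w - wiener_sum t m w))%:E)%E.
pose f s := sqnorm (sigma s).
have key m : (\int[Pr]_w (sqnorm (M t w))%:E <= 2%:E * a m + (2 * riemann_sum f t m)%:E)%E.
  have [l1 e1] := wiener_sum_moment m t0.
  have := mean_EFin l1; rewrite e1 -/f => e2.
  rewrite EFinM -e2 -ge0_integralZl//; last first.
    by move=> w _; rewrite lee_fin sqnorm_ge0.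
  rewrite -ge0_integralZl//; [|exact: mN|by move=> w _; rewrite lee_fin sqnorm_ge0].
  rewrite -ge0_integralD//.
  - apply: ge0_le_integral => //.
    + by move=> w _; rewrite lee_fin sqnorm_ge0.
    + by apply: mN => k; exact: mM.
    + apply: emeasurable_funD; apply: emeasurable_funM => //; exact: mN.
    + move=> w _; rewrite -!EFinM -EFinD lee_fin.
      by have := sqnormD_le (M t w - wiener_sum t m w) (wiener_sum t m w); rewrite subrK.
  - by move=> w _; rewrite mule_ge0// lee_fin sqnorm_ge0.
  - by apply: emeasurable_funM.
  - by move=> w _; rewrite mule_ge0// lee_fin sqnorm_ge0.
  - by apply: emeasurable_funM => //; exact: mN.
have ca : a m @[m --> \oo] --> 0%E by exact: cM.
have cb : (2 * riemann_sum f t m)%:E @[m --> \oo] --> (2 * Rintegral mu `[0, t] f)%:E.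
  apply: cvg_EFin; first exact: nearW.
  by apply: cvgMl_tmp; apply: riemann_sum_cvg => //; exact: hcont_dotv.
have c2a : (2%:E * a m)%E @[m --> \oo] --> 0%E.
  by rewrite -[X in _ --> X](mule0 2%:E); apply: cvgeZl.
have cs : (2%:E * a m + (2 * riemann_sum f t m)%:E)%E @[m --> \oo] -->
    (0 + (2 * Rintegral mu `[0, t] f)%:E)%E by apply: cvgeD.
rewrite add0e in cs.
rewrite -(cvg_lim _ cs)//; apply: lime_ge; first by apply/cvg_ex; eexists; exact: cs.
exact: nearW.
Qed.

End Brownian.
End SecondMoments.

(** * Path integrals of random processes *)

Section PathIntegrals.
Context {R : realType} {d : measure_display} {T : measurableType d}.
Variable Pr : probability T R.
Local Notation mu := (@lebesgue_measure R).

(** Fatou's lemma with convergent bounds: every inequality between expectations below is proved on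
    Riemann sums or finite horizons and passed to the limit here. *)
Lemma fatou_cvg_le (u_ : nat -> T -> \bar R) (u : T -> \bar R) (b_ : nat -> \bar R) b :
  (forall m, measurable_fun setT (u_ m)) -> (forall m w, 0 <= u_ m w)%E ->
  (forall w, u_ m w @[m --> \oo] --> u w) ->
  (forall m, (\int[Pr]_w u_ m w <= b_ m)%E) -> b_ @ \oo --> b ->
  (\int[Pr]_w u w <= b)%E.
Proof.
move=> mu_ u0 cu ub cb.
have -> : u = (fun w => limn_einf (u_^~ w)).
  by apply/funext => w; rewrite (cvg_limn_einf_sup (cu w)).1.
apply: (le_trans (fatou Pr measurableT mu_ (fun n x _ => u0 n x))).
rewrite limn_einf_lim -(cvg_lim _ cb)//; apply: lee_lim.
- exact: is_cvg_einfs.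
- by apply/cvg_ex; exists b.
- apply: nearW => m; apply: le_trans (ub m).
  by apply: ereal_inf_lbound; exists m => /=.
Qed.

Section Path.
Variable F : R -> T -> R.
Hypothesis cF : forall w, hcont (fun t => F t w).
Hypothesis mF : forall t, 0 <= t -> measurable_fun setT (F t).

Lemma measurable_riemann_sum t m : 0 <= t ->
  measurable_fun setT (fun w => riemann_sum (fun s => F s w) t m).
Proof.
move=> t0; apply: measurable_sum => j; apply: measurable_funM => //.
by apply: mF; rewrite mulr_ge0// mulr_ge0.
Qed.

Lemma measurable_path_Rintegral t : 0 <= t ->
  measurable_fun setT (fun w => Rintegral mu `[0, t] (fun s => F s w)).
Proof.
move=> t0; apply: (@measurable_fun_cvg _ _ _ _ (fun m w => riemann_sum (fun s => F s w) t m)).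
  by move=> m; exact: measurable_riemann_sum.
by move=> w _; exact: riemann_sum_cvg.
Qed.

Hypothesis F0 : forall t w, 0 <= t -> 0 <= F t w.

Lemma measurable_path_halfline :
  measurable_fun setT (fun w => \int[mu]_(t in `[0%R, +oo[) (F t w)%:E)%E.
Proof.
apply: (@emeasurable_fun_cvg _ _ _ _
  (fun n w => (Rintegral mu `[0, n%:R] (fun s => F s w))%:E)).
  by move=> n; apply/measurable_EFinP; exact: measurable_path_Rintegral.
by move=> w _; apply: integral_halfline_cvg => // t t0; exact: F0.
Qed.

(** A one-sided Tonelli inequality. It holds for Riemann sums by linearity, and continuity of phi
    makes the bounds converge. *)
Lemma path_Rintegral_le (phi : R -> R) t : 0 <= t -> hcont phi ->
  (forall s, 0 <= s -> (\int[Pr]_w (F s w)%:E <= (phi s)%:E)%E) ->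
  (\int[Pr]_w (Rintegral mu `[0, t] (fun s => F s w))%:E <= (Rintegral mu `[0, t] phi)%:E)%E.
Proof.
move=> t0 cphi hF.
apply: (@fatou_cvg_le (fun m w => (riemann_sum (fun s => F s w) t m)%:E) _
  (fun m => (riemann_sum phi t m)%:E)).
- by move=> m; apply/measurable_EFinP; exact: measurable_riemann_sum.
- move=> m w; rewrite lee_fin; apply: sumr_ge0 => j _.
  by rewrite mulr_ge0 ?divr_ge0// F0// mulr_ge0// mulr_ge0.
- move=> w; apply: cvg_EFin; first exact: nearW.
  exact: riemann_sum_cvg.
- move=> m; rewrite /riemann_sum.
  under eq_integral do rewrite -sumEFin.
  have jt (j : nat) : 0 <= j%:R * t / m.+1%:R by rewrite mulr_ge0// mulr_ge0.
  rewrite ge0_integral_sum//; last 2 first.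
  + by move=> j; apply/measurable_EFinP; apply: measurable_funM => //; exact: mF.
  + by move=> j w _; rewrite lee_fin mulr_ge0 ?divr_ge0// F0.
  rewrite -sumEFin; apply: lee_sum => j _.
  under eq_integral do rewrite EFinM.
  rewrite ge0_integralZl//; last 3 first.
  + by apply/measurable_EFinP; exact: mF.
  + by move=> w _; rewrite lee_fin F0.
  + by rewrite lee_fin divr_ge0.
  by rewrite [leRHS]EFinM lee_wpmul2l ?lee_fin ?divr_ge0//; exact: hF.
- by apply: cvg_EFin; [exact: nearW|exact: riemann_sum_cvg].
Qed.

Lemma path_halfline_le C :
  (forall n : nat, (\int[Pr]_w (Rintegral mu `[0, n%:R] (fun s => F s w))%:E <= C)%E) ->
  (\int[Pr]_w \int[mu]_(t in `[0%R, +oo[) (F t w)%:E <= C)%E.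
Proof.
move=> hC.
apply: (@fatou_cvg_le (fun n w => (Rintegral mu `[0, n%:R] (fun s => F s w))%:E) _ (cst C)).
- by move=> m; apply/measurable_EFinP; exact: measurable_path_Rintegral.
- move=> m w; rewrite lee_fin; apply: hcont_Rintegral_ge0 => // t t0; exact: F0.
- by move=> w; apply: integral_halfline_cvg => // t t0; exact: F0.
- exact: hC.
- exact: cvg_cst.
Qed.

End Path.

Lemma measurable_mulmx m n (A : 'M[R]_(m, n)) (X : T -> 'cV[R]_n) :
  (forall k, measurable_fun setT (fun w => X w k 0)) ->
  forall k, measurable_fun setT (fun w => (A *m X w) k 0).
Proof.
move=> mX k; have -> : (fun w => (A *m X w) k 0) = (fun w => \sum_i A k i * X w i 0).
  by apply/funext => w; rewrite mxE.
by apply: measurable_sum => i; apply: measurable_funM.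
Qed.

Lemma measurable_addmx n (X Y : T -> 'cV[R]_n) :
  (forall k, measurable_fun setT (fun w => X w k 0)) ->
  (forall k, measurable_fun setT (fun w => Y w k 0)) ->
  forall k, measurable_fun setT (fun w => (X w + Y w) k 0).
Proof.
move=> mX mY k; have -> : (fun w => (X w + Y w) k 0) = (fun w => X w k 0 + Y w k 0).
  by apply/funext => w; rewrite mxE.
exact: measurable_funD.
Qed.

(* The Wiener integral is only almost surely continuous; setting it to 0 on a
   null set makes all its paths continuous. If no Wiener integral exists, its
   default value 0 already has all the properties. *)
Lemma wiener_version (W : R -> T -> R) n (sigma : R -> 'cV[R]_n) :
  brownian_motion Pr W -> hcont sigma ->
  exists M : R -> T -> 'cV[R]_n, [/\
    (forall w, M 0 w = 0 /\ hcont (fun t => M t w)),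
    (forall t k, 0 <= t -> measurable_fun setT (fun w => M t w k 0)),
    {ae Pr, forall w, forall t, M t w = wiener_integral Pr W sigma t w} &
    forall t, 0 <= t -> (\int[Pr]_w (sqnorm (M t w))%:E <=
      (2 * Rintegral mu `[0, t] (fun s => sqnorm (sigma s)))%:E)%E].
Proof.
move=> hW cs; rewrite /wiener_integral.
case: xgetP => [M _ /= hM|_]; last first.
  exists (fun _ _ => 0); split.
  - by move=> w; split => //; apply: hcontT => t; exact: cvg_cst.
  - move=> t k _; rewrite (_ : (fun _ => _) = cst 0)//.
    by apply/funext => w; rewrite mxE.
  - exact: aeW.
  - move=> t t0; under eq_integral do rewrite sqnorm0.
    rewrite integral0 lee_fin mulr_ge0//.
    by apply: hcont_Rintegral_ge0 => [|s _]; [exact: hcont_dotv|exact: sqnorm_ge0].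
have [mM [A [mA A0 sA]] _] := hM.
pose M' t w := (1 - \1_A w) *: M t w.
exists M'; split.
- move=> w; rewrite /M' indicE; have [wA|/negP wA] := boolP (w \in A).
    rewrite subrr scale0r; split => //.
    have -> : (fun t => 0 *: M t w) = (fun=> 0) by apply/funext => t; rewrite scale0r.
    by apply: hcontT => t; exact: cvg_cst.
  have [M0 cM] : M 0 w = 0 /\ {within `[0, +oo[, continuous (fun t => M t w)}.
    by apply: contrapT => h; apply: wA; rewrite inE; exact: sA.
  rewrite subr0 scale1r; split => //.
  by have -> : (fun t => 1 *: M t w) = (fun t => M t w) by apply/funext => t; rewrite scale1r.
- move=> t k t0; have -> : (fun w => M' t w k 0) = (fun w => (1 - \1_A w) * M t w k 0).
    by apply/funext => w; rewrite mxE.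
  apply: measurable_funM; last exact: mM.
  by apply: measurable_funB => //; exact: measurable_indic.
- exists A; split => // w /= h; apply: contrapT => wA; apply: h => t.
  rewrite /M' indicE (_ : (w \in A) = false) ?subr0 ?scale1r//.
  by apply/negbTE/negP; rewrite inE.
- move=> t t0; apply: le_trans (wiener_integral_moment hW cs t0 hM).
  have mM' : forall k, measurable_fun setT (fun w => M t w k 0) by move=> k; exact: mM.
  apply: ge0_le_integral => //.
  + by move=> w _; rewrite lee_fin sqnorm_ge0.
  + apply/measurable_EFinP; apply: measurable_sqnorm => k.
    have -> : (fun w => M' t w k 0) = (fun w => (1 - \1_A w) * M t w k 0).
      by apply/funext => w; rewrite mxE.
    apply: measurable_funM => //.
    by apply: measurable_funB => //; exact: measurable_indic.
  + by apply/measurable_EFinP; exact: measurable_sqnorm.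
  + move=> w _; rewrite lee_fin /M' sqnormZ indicE.
    by case: (w \in A); rewrite ?subrr ?subr0 ?expr0n/= ?mul0r ?expr1n ?mul1r ?sqnorm_ge0.
Qed.

End PathIntegrals.

(** * The closed-loop state of one agent *)

Section Agent.
Context {R : realType} {d : measure_display} {T : measurableType d}.
Variable Pr : probability T R.
Local Notation mu := (@lebesgue_measure R).

(** Integrate the derivative of e^(-rho s) times the primitive of f; the boundary term at t is
    nonnegative and is dropped. It turns the linear-in-time moment bound of the noise into 2 / rho
    times the energy of sigma. *)
Lemma discounted_primitive_le (rho : R) (f : R -> R) (t : R) : 0 < rho -> hcont f ->
  (forall s : R, 0 <= s -> 0 <= f s) -> 0 <= t ->
  Rintegral mu `[0, t] (fun s => expR (- (rho * s)) * Rintegral mu `[0, s] f) <=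
  rho^-1 * Rintegral mu `[0, t] (fun s => expR (- (rho * s)) * f s).
Proof.
move=> r0 cf f0 t0.
pose q s := Rintegral mu `[0, s] f.
have cq : hcont q := hcont_int cf.
have ceq : hcont (fun s => expR (- (rho * s)) * q s) by apply: hcontM (hcont_expR _) cq.
have cef : hcont (fun s => expR (- (rho * s)) * f s) by apply: hcontM (hcont_expR _) cf.
pose g s := expR (- (rho * s)) * q s.
have dg (s : R) : 0 < s -> is_derive s (1 : R) g
    (- rho * (expR (- (rho * s)) * q s) + expR (- (rho * s)) * f s).
  move=> s0; have h := is_derive_mulE (is_derive_expR_lin rho s) (is_derive_int cf s0).
  by apply: is_derive_eq h _; rewrite -/(q s); ring.
have cv : hcont (fun s => - rho * (expR (- (rho * s)) * q s) + expR (- (rho * s)) * f s).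
  by apply: hcontD => //; apply: (hcontM (hcont_cst _)).
have := FTC2_halfline ceq cv dg t0.
rewrite hcont_RintegralD//; last by apply: (hcontM (hcont_cst _)).
rewrite hcont_RintegralZ// {2}/q Rintegral00 mulr0 add0r => h.
have gt0 : 0 <= expR (- (rho * t)) * q t.
  by rewrite mulr_ge0 ?expR_ge0//; exact: hcont_Rintegral_ge0.
by rewrite ler_pdivlMl// -/q; move: h gt0; set X := Rintegral _ _ _; lra.
Qed.

Lemma noise_energy (rho : R) n (sigma : R -> 'cV[R]_n) (C : R) (M : R -> T -> 'cV[R]_n) :
  0 < rho -> hcont sigma -> energy_le rho sigma C ->
  (forall w, hcont (fun t => M t w)) ->
  (forall t k, 0 <= t -> measurable_fun setT (fun w => M t w k 0)) ->
  (forall t, 0 <= t -> (\int[Pr]_w (sqnorm (M t w))%:E <=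
      (2 * Rintegral mu `[0, t] (fun s => sqnorm (sigma s)))%:E)%E) ->
  (\int[Pr]_w discounted_energy rho (fun t => M t w) <= (2 * (rho^-1 * C))%:E)%E.
Proof.
move=> r0 cs hC cM mM hM; rewrite /discounted_energy.
have mF t : 0 <= t -> measurable_fun setT (fun w => expR (- (rho * t)) * sqnorm (M t w)).
  by move=> t0; apply: measurable_funM => //; apply: measurable_sqnorm => k; exact: mM.
have cF w : hcont (fun t => expR (- (rho * t)) * sqnorm (M t w)) by exact: hcont_energy.
have F0 t w : 0 <= t -> 0 <= expR (- (rho * t)) * sqnorm (M t w).
  by move=> _; rewrite mulr_ge0 ?expR_ge0 ?sqnorm_ge0.
have cns : hcont (fun s => sqnorm (sigma s)) by exact: hcont_dotv.
apply: (path_halfline_le cF mF F0) => m.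
pose phi t := 2 * (expR (- (rho * t)) * Rintegral mu `[0, t] (fun s => sqnorm (sigma s))).
have cphi' : hcont (fun t => expR (- (rho * t)) * Rintegral mu `[0, t] (fun s => sqnorm (sigma s))).
  by apply: hcontM (hcont_expR _) (hcont_int cns).
have cphi : hcont phi by apply: (hcontM (hcont_cst _)).
apply: le_trans (path_Rintegral_le cF mF F0 (ler0n _ _) cphi _) _.
  move=> s s0; under eq_integral do rewrite EFinM.
  have mS : measurable_fun setT (fun w => (sqnorm (M s w))%:E).
    by apply/measurable_EFinP; apply: measurable_sqnorm => k; exact: mM.
  rewrite ge0_integralZl ?lee_fin ?expR_ge0//; last first.
    by move=> w _; rewrite lee_fin sqnorm_ge0.
  rewrite /phi mulrCA [leRHS]EFinM lee_wpmul2l ?lee_fin ?expR_ge0//; exact: hM.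
rewrite lee_fin hcont_RintegralZ// ler_wpM2l//.
apply: le_trans (discounted_primitive_le r0 cns _ _) _ => //.
  by move=> s _; exact: sqnorm_ge0.
by rewrite ler_wpM2l ?invr_ge0 ?(ltW r0)//; exact: hC.
Qed.

Lemma lin_sol_integral n (A : 'M[R]_n) (h : R -> 'cV[R]_n) z0 (t : R) k : hcont h -> 0 <= t ->
  lin_sol A h z0 t k 0 =
  z0 k 0 + Rintegral mu `[0, t] (fun s => (A *m lin_sol A h z0 s + h s) k 0).
Proof.
move=> ch t0; have cz := @lin_sol_hcont _ _ A h z0 ch.
have cv : hcont (fun s => A *m lin_sol A h z0 s + h s).
  by apply: hcontvD => //; exact: hcont_mulmx.
have /hcont_mxP cz' := cz; have /hcont_mxP cv' := cv.
have dz (s : R) : 0 < s -> is_derive s (1 : R) (fun r => lin_sol A h z0 r k 0)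
    ((A *m lin_sol A h z0 s + h s) k 0).
  by move=> s0; have /is_derive_mxP := @lin_sol_ode _ _ A h z0 s ch s0.
by rewrite (FTC2_halfline (cz' k) (cv' k) dz t0) lin_sol0.
Qed.

Lemma agent_solution n (rho : R) (A : 'M[R]_n) (g sigma : R -> 'cV[R]_n) (W : R -> T -> R)
    (x0 : T -> 'cV[R]_n) (Cs Cg : R) :
  0 < rho -> hurwitz (A - (rho / 2)%:M) -> brownian_motion Pr W ->
  hcont sigma -> energy_le rho sigma Cs -> hcont g -> energy_le rho g Cg ->
  (forall k, measurable_fun setT (fun w => x0 w k 0)) ->
  (\int[Pr]_w (sqnorm (x0 w))%:E < +oo)%E ->
  exists X : R -> T -> 'cV[R]_n, [/\ forall w, hcont (fun t => X t w),
    forall t k, 0 <= t -> measurable_fun setT (fun w => X t w k 0),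
    {ae Pr, forall w, forall t k, 0 <= t -> X t w k 0 = x0 w k 0 +
      Rintegral mu `[0, t] (fun s => (A *m X s w + g s) k 0) +
      wiener_integral Pr W sigma t w k 0} &
    (\int[Pr]_w discounted_energy rho (fun t => X t w) < +oo)%E].
Proof.
move=> r0 hA hW cs hCs cg hCg mx0 hx0.
have [M [hM mM aeM mom]] := wiener_version hW cs.
have cM w : hcont (fun t => M t w) := (hM w).2.
pose h t w := A *m M t w + g t.
have ch w : hcont (fun t => h t w) by apply: hcontvD => //; exact: hcont_mulmx.
pose Z t w := lin_sol A (h^~ w) (x0 w) t.
have cZ w : hcont (fun t => Z t w) by exact: lin_sol_hcont.
pose X t w := Z t w + M t w.
have cX w : hcont (fun t => X t w) by exact: hcontvD.
have mh t k : 0 <= t -> measurable_fun setT (fun w => h t w k 0).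
  move=> t0; apply: measurable_addmx => [k'|k'].
    by apply: measurable_mulmx => k''; exact: mM.
  exact: measurable_cst.
have mZ t k : 0 <= t -> measurable_fun setT (fun w => Z t w k 0).
  move=> t0; apply: measurable_mulmx => k'; apply: measurable_addmx => // j.
  have -> : (fun w => vint (fun s => expmx A (- s) *m h s w) t j 0) =
     (fun w => Rintegral mu `[0, t] (fun s => (expmx A (- s) *m h s w) j 0)).
    by apply/funext => w; rewrite mxE.
  apply: (@measurable_path_Rintegral _ _ _ (fun s w => (expmx A (- s) *m h s w) j 0)) => //.
    move=> w; have /hcont_mxP := hcont_mulmxf (@hcont_expmxN _ _ A) (ch w); exact.
  by move=> s s0; apply: measurable_mulmx => l; exact: mh.
have mX t k : 0 <= t -> measurable_fun setT (fun w => X t w k 0).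
  by move=> t0; apply: measurable_addmx => k'; [exact: mZ|exact: mM].
exists X; split => //.
  apply: filterS aeM => w hw t k t0.
  (* Z is x0 plus the integral of A Z + A M + g; as X = Z + M, the integrand is A X + g and M is
     left as the noise term. *)
  rewrite {1}/X mxE /Z lin_sol_integral// hw; congr (_ + _ + _).
  apply: eq_Rintegral => s _; rewrite /X mulmxDr -/(Z s w) /h addrA.
  by rewrite ?mxE.
have [K K0 hK] := path_energy hA.
have [D D0 hD] := sqnorm_mul_le A.
have mE t : 0 <= t -> measurable_fun setT (fun w => expR (- (rho * t)) * sqnorm (X t w)).
  by move=> t0; apply: measurable_funM => //; apply: measurable_sqnorm => k; exact: mX.
have mEM t : 0 <= t -> measurable_fun setT (fun w => expR (- (rho * t)) * sqnorm (M t w)).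
  by move=> t0; apply: measurable_funM => //; apply: measurable_sqnorm => k; exact: mM.
have cE w : hcont (fun t => expR (- (rho * t)) * sqnorm (X t w)) by exact: hcont_energy.
have cEM w : hcont (fun t => expR (- (rho * t)) * sqnorm (M t w)) by exact: hcont_energy.
have mDX : measurable_fun setT (fun w => discounted_energy rho (fun t => X t w)).
  exact: (measurable_path_halfline cE mE (fun t w _ => energy_fun_ge0 rho (fun t => X t w) t)).
have mDM : measurable_fun setT (fun w => discounted_energy rho (fun t => M t w)).
  exact: (measurable_path_halfline cEM mEM (fun t w _ => energy_fun_ge0 rho (fun t => M t w) t)).
have DM0 w : (0 <= discounted_energy rho (fun t => M t w))%E.
  by apply: integral_ge0 => t _; rewrite lee_fin mulr_ge0 ?expR_ge0 ?sqnorm_ge0.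
have Cg0 : 0 <= Cg.
  by apply: le_trans (hCg 0); rewrite Rintegral00.
(* From |X|^2 <= 2 |Z|^2 + 2 |M|^2, then [path_energy] for Z with forcing h, whose energy is at most
   2 D times that of M plus 2 Cg. *)
pose al := 2 * K * (2 * Cg); pose be := 2 * K; pose ga := 2 * K * (2 * D) + 2.
have al0 : 0 <= al by rewrite !mulr_ge0// ltW.
have be0 : 0 <= be by rewrite !mulr_ge0// ltW.
have ga0 : 0 <= ga by rewrite addr_ge0// !mulr_ge0// ltW.
have bound w : (discounted_energy rho (fun t => X t w) <=
    al%:E + be%:E * (sqnorm (x0 w))%:E + ga%:E * discounted_energy rho (fun t => M t w))%E.
  apply: integral_halfline_le => //; first by move=> t _; rewrite mulr_ge0 ?expR_ge0 ?sqnorm_ge0.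
  move=> m.
  pose J := Rintegral mu `[0, m%:R] (fun t => expR (- (rho * t)) * sqnorm (M t w)).
  have hJ : (J%:E <= discounted_energy rho (fun t => M t w))%E.
    exact: (@Rintegral_le_halfline R _ m%:R (cEM w) (fun t _ => energy_fun_ge0 rho (fun t => M t w) t)).
  apply: (@le_trans _ _ (al%:E + be%:E * (sqnorm (x0 w))%:E + ga%:E * J%:E)%E); last first.
    by rewrite leeD2l// lee_wpmul2l// lee_fin.
  rewrite -!EFinM -!EFinD lee_fin.
  have cez : hcont (fun t => expR (- (rho * t)) * sqnorm (Z t w)) by exact: hcont_energy.
  have ceg : hcont (fun t => expR (- (rho * t)) * sqnorm (g t)) by exact: hcont_energy.
  have ceh : hcont (fun t => expR (- (rho * t)) * sqnorm (h t w)) by exact: hcont_energy.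
  have e1 : Rintegral mu `[0, m%:R] (fun t => expR (- (rho * t)) * sqnorm (X t w)) <=
      2 * Rintegral mu `[0, m%:R] (fun t => expR (- (rho * t)) * sqnorm (Z t w)) + 2 * J.
    rewrite -!hcont_RintegralZ// -hcont_RintegralD; try (by apply: (hcontM (hcont_cst _))).
    apply: hcont_Rintegral_le => //.
      by apply: hcontD; apply: (hcontM (hcont_cst _)).
    move=> t _; have := ler_wpM2l (expR_ge0 (- (rho * t))) (sqnormD_le (Z t w) (M t w)).
    rewrite -/(X t w); lra.
  have e2 := hK _ _ (cZ w) (ch w) (fun t t0 => @lin_sol_ode _ _ A _ (x0 w) t (ch w) t0) m%:R (ler0n _ _).
  rewrite {2}/Z lin_sol0 in e2.
  have e3 : Rintegral mu `[0, m%:R] (fun t => expR (- (rho * t)) * sqnorm (h t w)) <=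
      2 * D * J + 2 * Cg.
    apply: (@le_trans _ _ (2 * D * J + 2 * Rintegral mu `[0, m%:R]
        (fun t => expR (- (rho * t)) * sqnorm (g t)))); last first.
      by rewrite lerD2l ler_wpM2l.
    rewrite -!hcont_RintegralZ// -hcont_RintegralD; try (by apply: (hcontM (hcont_cst _))).
    apply: hcont_Rintegral_le => //.
      by apply: hcontD; apply: (hcontM (hcont_cst _)).
    move=> t _; have := ler_wpM2l (expR_ge0 (- (rho * t))) (sqnormD_le (A *m M t w) (g t)).
    rewrite -/(h t w).
    have := ler_wpM2l (expR_ge0 (- (rho * t))) (hD (M t w)); lra.
  have := ler_wpM2l (ltW K0) e3; rewrite /al /be /ga; lra.
apply: (@le_lt_trans _ _ (\int[Pr]_w (al%:E + be%:E * (sqnorm (x0 w))%:E +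
    ga%:E * discounted_energy rho (fun t => M t w)))%E).
  apply: ge0_le_integral => //.
  - by move=> w _; apply: integral_ge0 => t _; rewrite lee_fin mulr_ge0 ?expR_ge0 ?sqnorm_ge0.
  - apply: emeasurable_funD; last by apply: emeasurable_funM.
    apply: emeasurable_funD => //; apply: emeasurable_funM => //.
    by apply/measurable_EFinP; exact: measurable_sqnorm.
have mx : measurable_fun setT (fun w => (sqnorm (x0 w))%:E).
  by apply/measurable_EFinP; exact: measurable_sqnorm.
rewrite ge0_integralD//; last 4 first.
- by move=> w _; rewrite adde_ge0 ?lee_fin// mulr_ge0 ?sqnorm_ge0.
- by apply: emeasurable_funD => //; exact: emeasurable_funM.
- by move=> w _; rewrite mule_ge0 ?lee_fin.
- exact: emeasurable_funM.
rewrite ge0_integralD//; last 2 first.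
- by move=> w _; rewrite lee_fin mulr_ge0 ?sqnorm_ge0.
- exact: emeasurable_funM.
rewrite !ge0_integralZl//; last by move=> w _; rewrite lee_fin sqnorm_ge0.
rewrite integral_cst//.
apply: lte_add_pinfty; first apply: lte_add_pinfty.
- apply: lte_mul_pinfty => //; rewrite -ge0_fin_numE//; exact: fin_num_measure.
- exact: lte_mul_pinfty.
- apply: lte_mul_pinfty => //.
  apply: le_lt_trans (noise_energy r0 cs hCs cM mM mom) _; exact: ltry.
Qed.

End Agent.

(** * Affine feedback laws *)

Section AffineLaw.
Context {R : realType} {d : measure_display} {T : measurableType d}.
Variable Pr : probability T R.
Local Notation mu := (@lebesgue_measure R).
Variables (n r N : nat).
Variables (A : 'M[R]_n) (B : 'M[R]_(n, r)) (sigma : R -> 'cV[R]_n).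
Variables (W : 'I_N -> R -> T -> R) (x0 : 'I_N -> T -> 'cV[R]_n).
Variables (F : 'M[R]_(r, n)) (e : R -> 'cV[R]_r).
Hypothesis ce : hcont e.

(** Required at t >= 0 only, because [laws_agree] identifies the offsets of the two laws on the
    half-line. *)
Definition affine_law (u : control_law n r N) : Prop :=
  forall i (t : R) x, 0 <= t -> u i t x = F *m x + e t.

Let Ab := A + B *m F.
Let g t := B *m e t.

Let cg : hcont g. Proof. exact: hcont_mulmx. Qed.

Lemma drift_affine u (X : 'I_N -> R -> T -> 'cV[R]_n) i t w : affine_law u -> 0 <= t ->
  @drift R d T n r N A B 0 (fun=> 0) (open_loop u X) X i t w = Ab *m X i t w + g t.
Proof.
move=> hu t0; rewrite /drift /open_loop hu// mul0mx !addr0 mulmxDr /Ab mulmxDl.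
by rewrite -mulmxA addrA.
Qed.

Let drift_hcont (y : R -> 'cV[R]_n) k : hcont y ->
  hcont (fun s => (Ab *m y s + g s) k 0).
Proof.
move=> cy; have : hcont (fun s => Ab *m y s + g s).
  by apply: hcontvD => //; exact: hcont_mulmx.
by move/hcont_mxP; apply.
Qed.

Lemma drift_affine_Rintegral u (X : 'I_N -> R -> T -> 'cV[R]_n) i (t : R) w k : affine_law u ->
  Rintegral mu `[0, t] (fun s => @drift R d T n r N A B 0 (fun=> 0) (open_loop u X) X i s w k 0) =
  Rintegral mu `[0, t] (fun s => (Ab *m X i s w + g s) k 0).
Proof.
move=> hu; apply: eq_Rintegral => s; rewrite inE/= in_itv/= => /andP[s0 _].
by rewrite drift_affine.
Qed.

Lemma affine_trajectory u (X : 'I_N -> R -> T -> 'cV[R]_n) : affine_law u ->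
  (forall i t k, 0 <= t -> measurable_fun setT (fun w => X i t w k 0)) ->
  (forall i w, hcont (fun t => X i t w)) ->
  {ae Pr, forall w, forall i t k, 0 <= t -> X i t w k 0 = x0 i w k 0 +
      Rintegral mu `[0, t] (fun s => (Ab *m X i s w + g s) k 0) +
      wiener_integral Pr (W i) sigma t w k 0} ->
  state_trajectory Pr A B 0 (fun=> 0) sigma W x0 u X.
Proof.
move=> hu mX cX aeX; split=> //; apply: filterS aeX => w hw i; split; first exact: cX.
move=> t k t0; split; last by rewrite drift_affine_Rintegral// hw.
have := hcont_integrable t (@drift_hcont _ k (cX i w)).
apply: eq_integrable => // s; rewrite inE/= in_itv/= => /andP[s0 _].
by rewrite /= drift_affine.
Qed.

Lemma affine_unique u (X Y : 'I_N -> R -> T -> 'cV[R]_n) : affine_law u ->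
  state_trajectory Pr A B 0 (fun=> 0) sigma W x0 u X ->
  state_trajectory Pr A B 0 (fun=> 0) sigma W x0 u Y ->
  indistinguishable Pr X Y.
Proof.
move=> hu [_ hX] [_ hY]; apply: filterS2 hX hY => w hX hY i t t0.
have [cX eX] := hX i; have [cY eY] := hY i.
pose bX s := Ab *m X i s w + g s; pose bY s := Ab *m Y i s w + g s.
have cbX : hcont bX by apply: hcontvD => //; exact: hcont_mulmx.
have cbY : hcont bY by apply: hcontvD => //; exact: hcont_mulmx.
(* The noise cancels in the difference of the states. It is represented by the drift integrals,
   which are differentiable by construction. *)
pose D s := vint bX s - vint bY s.
have DE (s : R) : 0 <= s -> D s = X i s w - Y i s w.
  move=> s0; apply/colP => k; rewrite !mxE.
  have [_ ->] := eX s k s0; have [_ ->] := eY s k s0.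
  by rewrite !drift_affine_Rintegral// /bX /bY; lra.
have cD : hcont D by apply: hcontvB; exact: hcont_vint.
have dD (s : R) : 0 < s -> is_derive s (1 : R) D (Ab *m D s).
  move=> s0; apply: is_derive_eq (is_deriveB (is_derive_vint cbX s0) (is_derive_vint cbY s0)) _.
  by rewrite (DE s (ltW s0)) mulmxBr /bX /bY opprD addrACA subrr addr0.
have D0 : D 0 = 0.
  by apply/colP => k; rewrite !mxE !Rintegral00 subrr.
have := linear_ode_zero cD dD D0 t0; rewrite DE// => /eqP.
by rewrite subr_eq0 => /eqP.
Qed.

Lemma affine_decentralized rho u (X : 'I_N -> R -> T -> 'cV[R]_n) Ce i : affine_law u ->
  energy_le rho e Ce ->
  (forall t k, 0 <= t -> measurable_fun setT (fun w => X i t w k 0)) ->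
  (forall w, hcont (fun t => X i t w)) ->
  (\int[Pr]_w discounted_energy rho (fun t => X i t w) < +oo)%E ->
  decentralized_control Pr rho (X i) (open_loop u X i).
Proof.
move=> hu he mX cX eX; split.
  move=> t k Y t0 mY.
  (* Generators of the information of agent i up to time t. The control at t is affine in the state
     at t, whose coordinates are measurable for them. *)
  pose G := [set E : set T | exists2 j : R * 'I_n, [set p : R * 'I_n | 0 <= p.1 <= t] j &
    exists2 Z : set R, measurable Z & E = (fun w => X i j.1 w j.2 0) @^-1` Z].
  change (<<s G >> ((fun w => open_loop u X i t w k 0) @^-1` Y)).
  have mG l : measurable_fun [set: g_sigma_algebraType G] (fun w => X i t w l 0).
    move=> _ Z mZ; rewrite setTI; apply: sub_sigma_algebra.
    exists (t, l); first by rewrite /= t0 lexx.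
    by exists Z.
  have mu' : measurable_fun [set: g_sigma_algebraType G] (fun w => \sum_l F k l * X i t w l 0 + e t k 0).
    apply: measurable_funD => //; apply: measurable_sum => l.
    exact: measurable_funM.
  have := mu' measurableT Y mY; rewrite setTI /measurable /=.
  have -> // : (fun w => open_loop u X i t w k 0) = (fun w => \sum_l F k l * X i t w l 0 + e t k 0).
  by apply/funext => w; rewrite /open_loop hu// !mxE.
have [C C0 hC] := sqnorm_mul_le F.
pose U t w := F *m X i t w + e t.
have cU w : hcont (fun t => U t w) by apply: hcontvD => //; exact: hcont_mulmx.
have cEU w : hcont (fun t => expR (- (rho * t)) * sqnorm (U t w)) by exact: hcont_energy.
have mU t : 0 <= t -> measurable_fun setT (fun w => expR (- (rho * t)) * sqnorm (U t w)).
  move=> t0; apply: measurable_funM => //; apply: measurable_sqnorm.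
  apply: measurable_addmx => k; last exact: measurable_cst.
  by apply: measurable_mulmx => l; exact: mX.
have cE w : hcont (fun t => expR (- (rho * t)) * sqnorm (X i t w)) by exact: hcont_energy.
have mE t : 0 <= t -> measurable_fun setT (fun w => expR (- (rho * t)) * sqnorm (X i t w)).
  by move=> t0; apply: measurable_funM => //; apply: measurable_sqnorm => k; exact: mX.
have -> : (fun w => discounted_energy rho (fun t => open_loop u X i t w)) =
    (fun w => discounted_energy rho (fun t => U t w)).
  apply/funext => w; apply: eq_integral => t; rewrite inE/= in_itv/= andbT => t0.
  by rewrite /open_loop hu.
have mDU : measurable_fun setT (fun w => discounted_energy rho (fun t => U t w)).
  exact: (measurable_path_halfline cEU mU (fun t w _ => energy_fun_ge0 rho (fun t => U t w) t)).
have mDX : measurable_fun setT (fun w => discounted_energy rho (fun t => X i t w)).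
  exact: (measurable_path_halfline cE mE (fun t w _ => energy_fun_ge0 rho (fun t => X i t w) t)).
have DX0 w : (0 <= discounted_energy rho (fun t => X i t w))%E.
  by apply: integral_ge0 => t _; rewrite lee_fin mulr_ge0 ?expR_ge0 ?sqnorm_ge0.
have Ce0 : 0 <= Ce by apply: le_trans (he 0); rewrite Rintegral00.
have C20 : 0 <= 2 * C by rewrite mulr_ge0// ltW.
have cee : hcont (fun t => expR (- (rho * t)) * sqnorm (e t)) by exact: hcont_energy.
have bound w : (discounted_energy rho (fun t => U t w) <=
    (2 * Ce)%:E + (2 * C)%:E * discounted_energy rho (fun t => X i t w))%E.
  apply: integral_halfline_le => //; first by move=> t _; rewrite mulr_ge0 ?expR_ge0 ?sqnorm_ge0.
  move=> m; pose J := Rintegral mu `[0, m%:R] (fun t => expR (- (rho * t)) * sqnorm (X i t w)).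
  have hJ : (J%:E <= discounted_energy rho (fun t => X i t w))%E.
    exact: (@Rintegral_le_halfline R _ m%:R (cE w) (fun t _ => energy_fun_ge0 rho (fun t => X i t w) t)).
  apply: (@le_trans _ _ ((2 * Ce)%:E + (2 * C)%:E * J%:E)%E); last first.
    by rewrite leeD2l// lee_wpmul2l// lee_fin.
  rewrite -EFinM -EFinD lee_fin.
  apply: (@le_trans _ _ (2 * Rintegral mu `[0, m%:R] (fun t => expR (- (rho * t)) * sqnorm (e t)) + 2 * C * J)); last first.
    by rewrite lerD2r ler_wpM2l.
  rewrite -!hcont_RintegralZ// -hcont_RintegralD; try (by apply: (hcontM (hcont_cst _))).
  apply: hcont_Rintegral_le => //.
    by apply: hcontD; apply: (hcontM (hcont_cst _)).
  move=> t _; have := ler_wpM2l (expR_ge0 (- (rho * t))) (sqnormD_le (F *m X i t w) (e t)).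
  rewrite -/(U t w); have := ler_wpM2l (expR_ge0 (- (rho * t))) (hC (X i t w)); lra.
apply: (@le_lt_trans _ _ (\int[Pr]_w ((2 * Ce)%:E + (2 * C)%:E * discounted_energy rho (fun t => X i t w)))%E).
  apply: ge0_le_integral => //.
  - by move=> w _; apply: integral_ge0 => t _; rewrite lee_fin mulr_ge0 ?expR_ge0 ?sqnorm_ge0.
  - by apply: emeasurable_funD => //; exact: emeasurable_funM.
rewrite ge0_integralD//; last 3 first.
- by move=> w _; rewrite lee_fin mulr_ge0.
- by move=> w _; rewrite mule_ge0 ?lee_fin.
- exact: emeasurable_funM.
rewrite ge0_integralZl// integral_cst//.
apply: lte_add_pinfty; apply: lte_mul_pinfty => //; rewrite ?lee_fin ?mulr_ge0//.
by rewrite -ge0_fin_numE//; exact: fin_num_measure.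
Qed.

End AffineLaw.

(** * Both laws as affine feedbacks with common gain and offset *)

Theorem mainTheorem10
  (R : realType) (n r : nat)
  (rho : R) (A Gam Q : 'M[R]_n) (B : 'M[R]_(n, r)) (Rw : 'M[R]_r)
  (eta xbar0 : 'cV[R]_n) (f sigma : R -> 'cV[R]_n) (G : 'M[R]_n) (C0 : R)
  (N : nat) (d : measure_display) (T : measurableType d)
  (Pr : probability T R)
  (W : 'I_N -> R -> T -> R) (x0 : 'I_N -> T -> 'cV[R]_n)
  (sqrtQ P Pi Kbar : 'M[R]_n) (s xbar xdag phi : R -> 'cV[R]_n)
  (hf : f = fun=> 0) (hG : G = 0)
  (hN : (0 < N)%N) (hrho : 0 < rho) (hRw : pd Rw)
  (hsigma : Crho2 rho sigma)
  (hW : forall i, brownian_motion Pr (W i))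
  (hWindep : mutually_independent Pr
     (fun i : 'I_N => gen_sigma [set t : R | 0 <= t] (W i)))
  (hx0meas : forall i (k : 'I_n),
     measurable_fun [set: T] (fun w => x0 i w k 0))
  (hx0indep : mutually_independent Pr
     (fun i : 'I_N => gen_sigma [set: 'I_n] (fun k w => x0 i w k 0)))
  (hx0mean : forall i (k : 'I_n),
     'E_Pr[(fun w => x0 i w k 0%R)]%E = (xbar0 k 0)%:E)
  (hx0bound : forall i, (\int[Pr]_w (sqnorm (x0 i w))%:E < C0%:E)%E)
  (hx0W : independent2 Pr
     (gen_sigma [set: 'I_N * 'I_n] (fun p w => x0 p.1 w p.2 0))
     (gen_sigma [set p : 'I_N * R | 0 <= p.2] (fun p => W p.1 p.2)))
  (hstab : stabilizable (A - (rho / 2)%:M) B)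
  (hQ : psd Q) (hsqrtQ : is_psd_sqrt Q sqrtQ)
  (hdet : detectable (A - (rho / 2)%:M) sqrtQ)
  (hdetGam : detectable (A - (rho / 2)%:M) (sqrtQ *m (1%:M - Gam)))
  (hPpsd : psd P)
  (hP : rho *: P =
     A^T *m P + P *m A - P *m B *m invmx Rw *m B^T *m P + Q)
  (hPipsd : psd Pi)
  (hPi : rho *: Pi =
     A^T *m Pi + Pi *m A - Pi *m B *m invmx Rw *m B^T *m Pi
     + (1%:M - Gam)^T *m Q *m (1%:M - Gam))
  (hs : Crho2 rho s)
  (hsode : solves_ode s (fun t =>
     rho *: s t - (A - B *m invmx Rw *m B^T *m Pi)^T *m s t
     + eta_bar Gam Q eta))
  (hxbar : Crho2 rho xbar)
  (hxbarode : solves_ode xbar (fun t =>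
     A *m xbar t - B *m invmx Rw *m B^T *m (Pi *m xbar t + s t)))
  (hxbarinit : xbar 0 = xbar0)
  (hKbar : rho *: Kbar =
     Kbar *m A_bar A B Rw P + (A_bar A B Rw P)^T *m Kbar
     - Kbar *m B *m invmx Rw *m B^T *m Kbar^T - Q_Gamma Gam Q)
  (hxdag : Crho2 rho xdag)
  (hxdagode : solves_ode xdag (fun t =>
     A_bar A B Rw P *m xdag t
     - B *m invmx Rw *m B^T *m (Kbar *m xdag t + phi t)))
  (hxdaginit : xdag 0 = xbar0)
  (hphi : Crho2 rho phi)
  (hphiode : solves_ode phi (fun t =>
     - (((A - B *m invmx Rw *m B^T *m (P + Kbar))^T - rho%:M) *m phi t)
     + eta_bar Gam Q eta)) :
  let u_hat : control_law n r N := fun _ t x =>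
    - (invmx Rw *m B^T *m (P *m x + (Pi - P) *m xbar t + s t)) in
  let sbar := fun t => Kbar *m xdag t + phi t in
  let u_breve : control_law n r N := fun _ t x =>
    - (invmx Rw *m B^T *m (P *m x + sbar t)) in
  representation Pr A B G f sigma W x0 rho Gam Q Rw eta u_hat u_breve.
Proof.
move=> u_hat sbar u_breve; subst f G.
have [csig esig] := hsigma.
pose L := invmx Rw *m B^T.
(* F is the gain of both laws; e is the offset of [u_breve], and [laws_agree] gives [u_hat] the same
   one for t >= 0. *)
pose F := - (L *m P); pose e t := - (L *m sbar t).
have csb : hcont sbar by apply: hcontvD hphi.1; apply: hcont_mulmx; exact: hxdag.1.
have ce : hcont e by apply: hcontvN; exact: hcont_mulmx.
have aff q x : - (L *m (P *m x + q)) = F *m x + - (L *m q).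
  by rewrite mulmxDr opprD /F mulNmx mulmxA.
have hbr : affine_law F e u_breve.
  by move=> i t x t0; exact: aff.
have hhat : affine_law F e u_hat.
  move=> i t x t0; rewrite /u_hat /e /sbar.
  rewrite -(laws_agree hRw hQ hsqrtQ hdet hPpsd hP hPipsd hPi hs hsode hxbar hxbarode
    hKbar hxdag hxdagode _ hphi hphiode t0) ?hxbarinit ?hxdaginit//.
  by rewrite -addrA; exact: aff.
have AbE : A + B *m F = A_bar A B Rw P by rewrite /F /L /A_bar mulmxN !mulmxA.
have hAb : hurwitz (A + B *m F - (rho / 2)%:M).
  by rewrite AbE; exact: riccati_hurwitz hRw hPpsd hQ hsqrtQ hdet hP.
have [Cs hCs] := Crho2_energy hsigma.
have [Ce hCe] : exists C, energy_le rho e C.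
  have [C1 h1] := Crho2_energy hxdag; have [C2 h2] := Crho2_energy hphi.
  have [C3 h3] := energy_le_mulmx Kbar hxdag.1 h1.
  have h4 := energy_leD (hcont_mulmx hxdag.1) hphi.1 h3 h2.
  have [C5 h5] := energy_le_mulmx (- L) csb h4.
  exists C5 => T0; have := h5 T0.
  by under [in X in X -> _]eq_Rintegral do rewrite mulNmx.
have cg : hcont (fun t => B *m e t) by exact: hcont_mulmx.
have [Cg hCg] := energy_le_mulmx B ce hCe.
have x0fin i : (\int[Pr]_w (sqnorm (x0 i w))%:E < +oo)%E.
  by apply: lt_trans (hx0bound i) _; exact: ltry.
have sol i := agent_solution hrho hAb (hW i) csig hCs cg hCg (hx0meas i) (x0fin i).
(* With G = 0 and each control depending on its own state, the agents are decoupled and solved one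
   by one. The equations involve the laws through F and e only, so one family of states serves
   both. *)
pose X i := sval (cid (sol i)).
have cX i w : hcont (fun t => X i t w) by rewrite /X; case: (cid (sol i)) => ? [].
have mX i t k : 0 <= t -> measurable_fun setT (fun w => X i t w k 0).
  by rewrite /X; case: (cid (sol i)) => ? [] /= _ h _ _; exact: h.
have aeX : {ae Pr, forall w, forall i t k, 0 <= t -> X i t w k 0 = x0 i w k 0 +
      Rintegral lebesgue_measure `[0, t] (fun s => ((A + B *m F) *m X i s w + B *m e s) k 0) +
      wiener_integral Pr (W i) sigma t w k 0}.
  by apply: filter_forall => i; rewrite /X; case: (cid (sol i)) => ? [].
have eX i : (\int[Pr]_w discounted_energy rho (fun t => X i t w) < +oo)%E.
  by rewrite /X; case: (cid (sol i)) => ? [].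
have traj u : affine_law F e u -> state_trajectory Pr A B 0 (fun=> 0) sigma W x0 u X.
  move=> hu; exact: (affine_trajectory ce hu mX cX aeX).
have gen u : affine_law F e u -> generates_unique Pr A B 0 (fun=> 0) sigma W x0 u X.
  by move=> hu; split; [exact: traj|move=> Y hY; exact: (affine_unique ce hu (traj u hu) hY)].
have adm u : affine_law F e u -> admissible Pr A B 0 (fun=> 0) sigma W x0 rho u.
  move=> hu; exists X; first exact: traj.
  by move=> i; apply: (affine_decentralized ce hu hCe (mX i) (cX i) (eX i)).
have olE i (t : R) w : 0 <= t -> open_loop u_hat X i t w = open_loop u_breve X i t w.
  by move=> t0; rewrite /open_loop hhat// hbr.
split; [exact: adm|exact: adm|exists X; split; [exact: gen|exact: gen|split]].
  by apply: aeW => w i t; exact: olE.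
apply: eq_bigr => i _; apply: eq_integral => w _; apply: eq_integral => t.
by rewrite inE/= in_itv/= andbT => t0; rewrite olE.
Qed.
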